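(* Let $\Gamma$ be a finite simple graph, with complement $\overline{\Gamma}$. Then $\Gamma$ is isomorphic to the prime graph of a pseudo $\mathrm{PSL}(2,7)$-solvable group $G$ if and only if one of the following holds: (1) $\overline{\Gamma}$ is triangle-free and $3$-colorable. (2) $\overline{\Gamma}$ has exactly one triangle $\{a,b,c\}$, where (for a suitable naming of its vertices) the vertices $a,b$ are not adjacent in $\overline{\Gamma}$ to any vertices outside $\{a,b,c\}$, and $\overline{\Gamma}$ has a $3$-coloring for which all the neighbors of $c$ other than $a$ and $b$ have the same color.
   Context: All groups are finite and all graphs are simple. For a finite group $G$, the prime graph $\Gamma(G)$ has as vertices the prime divisors of $|G|$; two distinct vertices $p,q$ are adjacent if and only if $G$ contains an element of order $pq$. A group $G$ is pseudo $\mathrm{PSL}(2,7)$-solvable if each of its composition factors is abelian or isomorphic to $\mathrm{PSL}(2,7)$ (in particular solvable groups are allowed). A $3$-coloring is a proper vertex coloring using at most three colors. *)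

(* Defs.v *)
From mathcomp Require Import all_boot all_order all_algebra.
From mathcomp Require Import all_fingroup all_solvable.

Set Implicit Arguments.
Unset Strict Implicit.
Unset Printing Implicit Defensive.

Import GRing.Theory.
Local Open Scope group_scope.

Section SpecialLinear.

Variables (n : nat) (R : finComUnitRingType).

Definition SLgroup := [set u : {'GL_n[R]} | (\det (GLval u) == 1)%R].

Fact SLgroup_group_set : group_set SLgroup.
Proof.
apply/group_setP; split; first by rewrite inE GL_1E det1.
by move=> u v; rewrite !inE GL_MxE det_mulmx => /eqP-> /eqP->; rewrite mulr1.
Qed.

Canonical SLgroup_group := group SLgroup_group_set.

Definition PSLgroup : {group coset_of 'Z(SLgroup)} :=
  [group of SLgroup / 'Z(SLgroup)].

End SpecialLinear.

Definition PSL27 := PSLgroup 2 'F_7.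

(* [mkfactors G s] lists representatives, up to isomorphism, of the successive
   quotients of the composition series [s] of [G].                            *)
Definition pseudo_PSL27_solvable (gT : finGroupType) (G : {group gT}) : Prop :=
  forall s : seq {group gT}, comps G s ->
  forall F : section gT, F \in mkfactors G s -> abelian F \/ F \isog PSL27.

(* The vertex type [seq_sub (primes #|G|)] is the finite type of the prime
   divisors of #|G|.                                                          *)
Definition prime_graph (gT : finGroupType) (G : {group gT}) :
    rel (seq_sub (primes #|G|)) :=
  fun p q => (p != q) && [exists x in G, #[x] == (ssval p * ssval q)%N].
Arguments prime_graph {gT} G p q.

Definition graph_compl (T : finType) (e : rel T) : rel T :=
  fun x y => (x != y) && ~~ e x y.

Definition graph_iso (T U : finType) (e : rel T) (e' : rel U) : Prop :=
  exists2 f : T -> U, bijective f & {mono f : x y / e x y >-> e' x y}.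

Definition triangle (T : finType) (e : rel T) (x y z : T) : bool :=
  [&& e x y, e y z & e x z].

Definition triangle_free (T : finType) (e : rel T) : Prop :=
  forall x y z : T, ~~ triangle e x y z.

(* Since [triangle] speaks of ordered triples, uniqueness is stated for the
   underlying vertex sets.                                                    *)
Definition unique_triangle (T : finType) (e : rel T) (a b c : T) : Prop :=
  triangle e a b c /\
  forall x y z : T, triangle e x y z -> [set x; y; z] = [set a; b; c].

Definition three_coloring (T : finType) (e : rel T) (col : T -> 'I_3) : Prop :=
  forall x y : T, e x y -> col x != col y.

(* Main.v *)
(* Forward direction. In a solvable group any three primes contain an adjacent
   pair (Lucido), and the complement of the prime graph is three-coloured by
   putting the primes of rank at least two in one class and splitting the primes
   with cyclic Sylow subgroups according to whether they divide the order of a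
   Fitting subgroup. If [G] is not solvable, a solvable normal subgroup [N] has
   [K = PSL(2,7)] in [G / N] such that every conjugate of [K] equals or
   centralises it, and some solvable subgroup of [G] containing [N] has order
   divisible by every odd prime divisor of [#|G|]. If [2] divides [#|N|], that
   subgroup settles the question. Otherwise a Klein four-group makes [2] adjacent
   to the primes of [N]; unless [3] and [7] are adjacent, the Frobenius subgroup
   [7 : 3] of [K] does the same for [3], and makes the primes of [N] not adjacent
   to [7] have rank at least two, that is, the same colour.

   Converse. Order the three colours, choose for the vertices of each colour
   primes congruent to 1 modulo all the primes of the previous ones, and realise
   the first two colours by a metacyclic group [J] with prescribed Frobenius
   actions. For each prime [r] of the third colour add a module over ['F_r] of
   [J * K], [K] trivial or [PSL(2,7)], in which the elements of prime order [t]
   have no nonzero fixed vector exactly when [r] and [t] must not be adjacent. *)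

Require Import Defs.
From HB Require Import structures.
From mathcomp Require Import all_boot all_order all_algebra.
From mathcomp Require Import all_fingroup all_solvable all_field.

Set Implicit Arguments.
Unset Strict Implicit.
Unset Printing Implicit Defensive.

Import GRing.Theory FiniteModule.

(** * Primes congruent to 1 modulo n *)

(** One fact governs both directions: if an element of prime order acts without fixed points on a
    group [Q] and on an abelian group [A] of coprime order normalised by [Q], then [Q] centralises
    [A]. Nonadjacent primes produce such actions, so triangles in the complement are obstructed.
    Conversely, if [p] and [q] must both act without fixed vectors on a module over ['F_r], the
    absence of triangles lets them commute, and a linear character nontrivial on both can be
    induced. The prime 2 stands apart because the subgroups of order 21 of [PSL(2,7)] are solvable
    and form one conjugacy class; conjugacy is what lets the existence of odd Hall subgroups pass to
    extensions. The colour condition on [c] has two sources. A cyclic Sylow subgroup has an abelian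
    automorphism group, on which [7 : 3] cannot be represented faithfully. And in the groups
    constructed, [PSL(2,7)] commutes with the primes of the first two colours, so only the last
    colour can contain further neighbours of [c]. The prime of [c] is 7 because [PSL(2,7)] permutes
    7 points: modulo constants, elements of order 7 fix no function on them, while elements of order
    2 and 3 do. *)

Section Dirichlet.

Local Open Scope ring_scope.

(** The constant term of [X^n - 1] is [-1]; hence a prime dividing the value of ['Phi_n] at [a]
    cannot divide [a]. *)
Lemma Cyclotomic0_unit n : (0 < n)%N -> exists u : int, ('Phi_n).[0] * u = -1.
Proof.
move=> n_gt0; exists (\prod_(d <- rem n (divisors n)) ('Phi_d).[0]).
have := congr1 (fun p => p.[0]) (prod_Cyclotomic n_gt0).
rewrite (big_rem n) ?divisors_id //= hornerM horner_prod => ->.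
by rewrite !hornerE expr0n gtn_eqF // sub0r.
Qed.

Lemma Cyclotomic_big_value n D : (0 < n)%N -> (0 < D)%N -> exists2 a : nat, (D %| a)%N &
  (1 < `|('Phi_n).[a%:Z]|)%N.
Proof.
(* The roots of [h] are the points where [f] takes a value among 0, 1 and -1; [size h] distinct
   multiples of [D] cannot all be roots. *)
move=> n_gt0 D_gt0; pose f := 'Phi_n; pose h := (f ^+ 2 - 1) * f.
have sf : (1 < size f)%N by rewrite size_Cyclotomic ltnS totient_gt0.
have f0 : f != 0 by rewrite -size_poly_gt0 (leq_trans _ sf).
have h0 : h != 0.
  rewrite mulf_neq0 // subr_eq0; apply: contraTneq sf => f1.
  have := congr1 (fun p : {poly int} => size p) f1; rewrite /= expr2 size_mul // size_poly1.
  by case: (size f) => [|[|m]] //; rewrite addnS.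
pose s := [seq (D * i.+1)%:Z | i <- iota 0 (size h)].
have us : uniq s.
  rewrite map_inj_uniq ?iota_uniq // => i j [] /eqP.
  by rewrite eqn_pmul2l // eqSS => /eqP.
have : ~~ all (root h) s.
  apply/negP=> rs; have := max_poly_roots h0 rs us.
  by rewrite size_map size_iota ltnn.
case/allPn=> _ /mapP[i _ ->]; rewrite rootE /h !hornerE /= mulf_eq0 negb_or subr_eq0 sqrf_eq1 negb_or.
move=> H; exists (D * i.+1)%N; first exact: dvdn_mulr.
move: H; rewrite -/f; case: (f.[_]) => [[|[|m]]|[|m]] //=.
Qed.

(* If [n * M`!] divides [a], then [a] has order exactly [n] modulo every prime
   divisor of the value at [a] of the [n]-th cyclotomic polynomial. *)
Lemma dirichlet1 n M : (0 < n)%N -> exists q, [/\ prime q, (M < q)%N & (n %| q.-1)%N].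
Proof.
move=> n_gt0; have D_gt0 : (0 < n * M`!)%N by rewrite muln_gt0 n_gt0 fact_gt0.
have [a Da big] := Cyclotomic_big_value n_gt0 D_gt0.
pose q := pdiv `|('Phi_n).[a%:Z]|; have pr_q : prime q by rewrite pdiv_prime.
have charF := pchar_Fp pr_q; pose al : 'F_q := a%:R.
pose P d := map_poly (intr : int -> 'F_q) 'Phi_d.
have P0 : root (P n) al.
  rewrite /root /al pmulrn horner_map /= -(dvdz_pcharf charF).
  by rewrite dvdzE pdiv_dvd.
have al0 : al != 0.
  apply: contraTneq P0 => ->; rewrite /root -[0](rmorph0 (intr : {rmorphism int -> 'F_q})) horner_map /=.
  have [u eq_u] := Cyclotomic0_unit n_gt0; apply/eqP=> z.
  have := congr1 (intr : int -> 'F_q) eq_u; rewrite rmorphM /= z mul0r rmorphN1 => /eqP.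
  by rewrite eq_sym oppr_eq0 oner_eq0.
have q'D : ~~ (q %| n * M`!)%N.
  by apply: contra al0 => qD; rewrite -(dvdn_pcharf charF) (dvdn_trans qD Da).
have n0 : n%:R != 0 :> 'F_q.
  by apply: contra q'D; rewrite -(dvdn_pcharf charF) => /dvdn_mulr->.
have prodP m : (0 < m)%N -> \prod_(d <- divisors m) P d = 'X^m - 1.
  by move=> m_gt0; rewrite -rmorph_prod prod_Cyclotomic // rmorphB /= map_polyXn rmorph1.
have aln : al ^+ n = 1.
  apply/eqP; rewrite -subr_eq0; have := congr1 (fun p => p.[al]) (prodP n n_gt0).
  rewrite !hornerE => <-; rewrite (big_rem n) ?divisors_id //= hornerM.
  by rewrite (eqP P0) mul0r.
have [m prim_m m_n] := prim_order_exists n_gt0 aln.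
have m_gt0 := prim_order_gt0 prim_m.
(* Were [m] smaller, [al] would be a common root of two different cyclotomic factors of [X^n - 1],
   which is separable modulo [q]. *)
have eq_mn : m = n.
  apply: contraTeq isT => neq_mn.
  have : root (\prod_(d <- divisors m) P d) al.
    by rewrite prodP // rootE !hornerE (prim_expr_order prim_m) subrr.
  rewrite rootE horner_prod prodf_seq_eq0 => /hasP[d]; rewrite -dvdn_divisors // => d_m /= Pd.
  have neq_dn : d != n.
    apply: contraNneq neq_mn => dn; rewrite eqn_dvd m_n -dn d_m. by [].
  have := separable_Xn_sub_1 n0; rewrite -(prodP n n_gt0) (big_rem n) ?divisors_id //= (big_rem d) /=.
    rewrite mulrA separable_mul => /and3P[]; rewrite separable_mul => /and3P[_ _ cop] _ _.
    by have := coprimep_root cop P0; rewrite (eqP Pd) eqxx.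
  by rewrite mem_rem_uniq ?divisors_uniq // inE neq_dn -dvdn_divisors // (dvdn_trans d_m).
exists q; split=> //.
  by rewrite ltnNge; apply: contra q'D => le_qM; rewrite dvdn_mull // dvdn_fact // prime_gt0.
rewrite -eq_mn (prim_order_dvd prim_m).
have cardF : #|'F_q| = q.-1.+1 by rewrite card_Fp // prednK ?prime_gt0.
have := expf_card al; rewrite cardF exprS => /eqP.
by rewrite -subr_eq0 -[X in _ - X]mulr1 -mulrBr mulf_eq0 (negPf al0) subr_eq0.
Qed.

End Dirichlet.

Import GroupScope.

(** * Adjacency of primes and fixed points of coprime actions *)

Section PrimeAdjacency.

Variable gT : finGroupType.
Implicit Types (G H N A : {group gT}) (p q : nat).

(** The adjacency of [prime_graph] on plain numbers, so that a group can be compared with its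
    subgroups and quotients without the dependent vertex type. *)
Definition adj (G : {set gT}) (p q : nat) := [exists x in G, #[x] == (p * q)%N].

Lemma adjC G p q : adj G p q = adj G q p.
Proof. by rewrite /adj mulnC. Qed.

Lemma adjS G H p q : H \subset G -> adj H p q -> adj G p q.
Proof.
by move=> sHG /exists_inP[x Hx ox]; apply/exists_inP; exists x; rewrite // (subsetP sHG).
Qed.

Lemma order_multiple G x n : x \in G -> n %| #[x] -> exists2 y, y \in G & #[y] = n.
Proof.
move=> Gx /dvdnP[k ok]; exists (x ^+ k); first exact: groupX.
have k_gt0 : 0 < k by case: k ok (order_gt0 x) => // ->.
by rewrite orderXdiv ok ?dvdn_mulr // mulKn.
Qed.

Lemma adj_commute G p q x y : prime p -> prime q -> p != q ->
  x \in G -> y \in G -> commute x y -> p %| #[x] -> q %| #[y] -> adj G p q.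
Proof.
move=> pr_p pr_q neq_pq Gx Gy cxy p_x q_y.
have [i ox] : exists i, #[x ^+ i] = p.
  have /dvdnP[k ok] := p_x; exists k.
  by rewrite orderXdiv ok ?dvdn_mulr // mulKn //; case: k ok (order_gt0 x) => // ->.
have [j oy] : exists j, #[y ^+ j] = q.
  have /dvdnP[k ok] := q_y; exists k.
  by rewrite orderXdiv ok ?dvdn_mulr // mulKn //; case: k ok (order_gt0 y) => // ->.
apply/exists_inP; exists (x ^+ i * y ^+ j); first by rewrite groupM ?groupX.
rewrite orderM ?ox ?oy //; first exact/commuteX2.
by rewrite prime_coprime // dvdn_prime2.
Qed.

Lemma adjP G p q : prime p -> prime q -> adj G p q ->
  exists x y, [/\ x \in G, y \in G, commute x y, #[x] = p & #[y] = q].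
Proof.
move=> pr_p pr_q /exists_inP[z Gz /eqP oz].
exists (z ^+ q), (z ^+ p); split; rewrite ?groupX //.
- exact/commuteX2.
- by rewrite orderXdiv oz ?dvdn_mull // mulnK ?prime_gt0.
- by rewrite orderXdiv oz ?dvdn_mulr // mulKn ?prime_gt0.
Qed.

(** Mostly used in contrapositive form: nonadjacent primes force an action without fixed points. *)
Lemma adj_cent G A p q x : prime p -> prime q -> p != q ->
  A \subset G -> p.-group A -> x \in G -> q %| #[x] -> 'C_A[x] != 1 -> adj G p q.
Proof.
move=> pr_p pr_q neq_pq sAG pA Gx q_x /trivgPn[a /setIP[Aa /cent1P cax] nt_a].
apply: (adj_commute pr_p pr_q neq_pq (subsetP sAG a Aa) Gx) => //.
have pa := mem_p_elt pA Aa.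
by rewrite -(pdiv_p_elt pa nt_a) pdiv_dvd.
Qed.

End PrimeAdjacency.

Lemma adj_quo (gT : finGroupType) (G N : {group gT}) p q :
  N <| G -> adj (G / N) p q -> adj G p q.
Proof.
move=> nsNG /exists_inP[x /morphimP[y Ny Gy ->] /eqP o_y].
have dv : (p * q)%N %| #[y] by rewrite -o_y morph_order.
by have [z Gz oz] := order_multiple Gy dv; apply/exists_inP; exists z; rewrite ?oz.
Qed.

Lemma adj_injm (gT rT : finGroupType) (D G : {group gT}) (f : {morphism D >-> rT}) p q :
  'injm f -> G \subset D -> adj (f @* G) p q = adj G p q.
Proof.
move=> injf sGD; apply/exists_inP/exists_inP=> [[_ /morphimP[x Dx Gx ->]]|[x Gx]] ox.
  by exists x; rewrite // -(order_injm injf Dx).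
by exists (f x); [rewrite mem_morphim ?(subsetP sGD) | rewrite order_injm ?(subsetP sGD)].
Qed.

(** The sum over an orbit of [z] is itself fixed by [z]. *)
Lemma sum_regular (gT : finGroupType) (A : {group gT}) (abA : abelian A) n z
    (v : fmod_of abA) : 0 < n -> z \in 'N(A) -> z ^+ n = 1 -> 'C_A[z] = 1 ->
  (\sum_(i < n) v ^@ (z ^+ i) = 0)%R.
Proof.
move=> n_gt0 nAz zn1 regA; set w := (X in X = _).
have w_fix : (w ^@ z = w)%R.
  rewrite /w actr_sum -(prednK n_gt0) big_ord_recr [RHS]big_ord_recl /= addrC; congr (_ + _)%R.
    by rewrite -actrM ?groupX // -expgSr (prednK n_gt0) zn1 expg0.
  by apply: eq_bigr => i _; rewrite -actrM ?groupX // -expgSr.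
apply: val_inj; rewrite /= -/(fmval w).
have: fmval w \in 'C_A[z].
  rewrite inE fmodP; apply/cent1P/commgP/conjg_fixP.
  by have /(congr1 val) := w_fix; rewrite fmvalJ.
by rewrite regA => /set1P.
Qed.

(* For [a] in [A], the sum of the conjugates of [a] under the cyclic groups
   [<[y ^ z]>], [z] in [Q], vanishes; for a fixed nonzero exponent [i] the elements
   [(y ^+ i) ^ z] run through the coset [y ^+ i * Q], so these terms are
   fixed by [Q], and hence so is [a ^+ #|Q|].                               *)
Lemma regular_cent (gT : finGroupType) (A Q : {group gT}) (y : gT) :
    abelian A -> prime #[y] -> y \in 'N(Q) -> y \in 'N(A) -> Q \subset 'N(A) ->
    coprime #|Q| #|A| -> 'C_Q[y] = 1 -> 'C_A[y] = 1 -> Q \subset 'C(A).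
Proof.
move=> abA pr_y nQy nAy nAQ coQA regQ regA.
apply/subsetP=> q Qq; apply/centP=> a Aa.
pose v := fmod abA a.
pose S (w : fmod_of abA) := (\sum_(z in Q) w ^@ z)%R.
have nAx (x : gT) : x \in Q -> x \in 'N(A) by move/(subsetP nAQ).
have S_fix w (z : gT) : z \in Q -> (S w ^@ z)%R = S w.
  move=> Qz; rewrite /S actr_sum [RHS](reindex_inj (mulIg z)) /=.
  by apply: eq_big => [x|x Qx]; rewrite ?groupMr // actrM ?nAx.
have sum0 (z : gT) : z \in Q -> (\sum_(i < #[y]) v ^@ ((y ^+ i) ^ z) = 0)%R.
  move=> Qz; under eq_bigr => i _ do rewrite conjXg.
  apply: sum_regular; rewrite ?groupJ ?(nAx z) ?order_gt0 -?conjXg ?expg_order ?conj1g //.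
  by rewrite -conjg_set1 normJ -{1}(normP (nAx z Qz)) -conjIg regA conjs1g.
have Si (i : 'I_#[y]) : i != 0%N :> nat -> (\sum_(z in Q) v ^@ ((y ^+ i) ^ z) = S (v ^@ (y ^+ i)))%R.
  move=> nz_i; have regQi : 'C_Q[y ^+ i] = 1.
    apply/trivgP; rewrite -regQ; apply: setIS; rewrite /= -(cent_cycle (y ^+ i)) -(cent_cycle y) centS //.
    rewrite cycle_subG; have: generator <[y]> (y ^+ i).
      by rewrite generator_coprime prime_coprime // gtnNdvd // lt0n.
    by move=> /eqP E; rewrite /= -E cycle_id.
  pose h (z : gT) := [~ y ^+ i, z].
  have nQi : y ^+ i \in 'N(Q) by rewrite groupX.
  have hQ (z : gT) : z \in Q -> h z \in Q.
    by move=> Qz; rewrite /h commgEr groupM // memJ_norm ?groupV // .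
  have inj_h : {in Q &, injective h}.
    move=> z1 z2 Q1 Q2 /(congr1 (mulg (y ^+ i))); rewrite -!conjg_mulR => eq12.
    apply/eqP; rewrite eq_mulgV1 -in_set1 -[[set 1]]regQi inE groupM ?groupV //=.
    by apply/cent1P/esym/commgP/conjg_fixP; rewrite conjgM eq12 conjgK.
  have hQQ : h @: Q = Q.
    apply/eqP; rewrite eqEcard card_in_imset // leqnn andbT.
    by apply/subsetP=> _ /imsetP[z Qz ->]; apply: hQ.
  rewrite /S -[in RHS]hQQ big_imset //=; apply: eq_bigr => z Qz.
  by rewrite -actrM ?groupX ?(nAx (h z)) ?hQ // conjg_mulR.
have y0 : 0 < #[y] by exact: order_gt0.
have: (\sum_(z in Q) \sum_(i < #[y]) v ^@ ((y ^+ i) ^ z) = 0)%R by apply: big1.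
rewrite exchange_big (bigD1 (Ordinal y0)) //= => /eqP; rewrite addr_eq0 => /eqP eqS.
have fix_nv : ((v *+ #|Q|) ^@ q = v *+ #|Q|)%R.
  have -> : (v *+ #|Q| = - \sum_(i < #[y] | i != Ordinal y0) S (v ^@ (y ^+ i)))%R.
    under [in RHS]eq_bigr => i nz_i do rewrite -Si //.
    rewrite -eqS -sumr_const; apply: eq_bigr => z _.
    by rewrite expg0 conj1g actr1.
  by rewrite actNr actr_sum; congr (- _)%R; apply: eq_bigr => i _; apply: S_fix.
apply/esym/commgP/conjg_fixP.
have nAq := nAx q Qq.
(* Since [#|Q|] is prime to [#|A|], an element of [A] is determined by its power of exponent
   [#|Q|]. *)
have inj : {in A &, injective (fun x => x ^+ #|Q|)}.
  by apply: can_in_inj (expgK _); rewrite coprime_sym.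
apply: inj; rewrite ?memJ_norm //=.
by have /(congr1 val) := fix_nv; rewrite fmvalJ // fmvalZ /= fmodK // conjXg.
Qed.

(* The sum of the conjugates of [v] under the [p + 1] subgroups of order [p] of
   [<[x, y]>] is both zero and [p v], up to a sum of conjugates under [<[y]>]. *)
Lemma regular_noncyclic (gT : finGroupType) (A : {group gT}) p (x y : gT) :
    abelian A -> prime p -> coprime p #|A| -> commute x y -> x ^+ p = 1 -> y ^+ p = 1 ->
    x \in 'N(A) -> y \in 'N(A) -> 'C_A[y] = 1 ->
  (forall k, 'C_A[x * y ^+ k] = 1) -> A :=: 1.
Proof.
move=> abA pr_p coA cxy xp yp nAx nAy regy regxy.
have p_gt0 := prime_gt0 pr_p.
apply/trivgP/subsetP=> a Aa; rewrite inE.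
pose v := fmod abA a.
have: (\sum_(k < p) \sum_(i < p) v ^@ ((x * y ^+ k) ^+ i) = 0)%R.
  apply: big1 => k _; apply: sum_regular; rewrite ?groupM ?groupX //.
  by rewrite expgMn; [rewrite xp -expgM mulnC expgM yp expg1n mulg1 | exact: commuteX].
rewrite exchange_big (bigD1 (Ordinal p_gt0)) //= [X in (_ + X)%R]big1 ?addr0 => [|i nz_i]; last first.
  have co_pi : coprime p i by rewrite prime_coprime // gtnNdvd // lt0n.
  rewrite -[RHS](sum_regular (v ^@ (x ^+ i)) p_gt0 nAy yp regy).
  have lt_m k : (k * i %% p < p) by rewrite ltn_mod.
  (* For nonzero [i] multiplication by [i] permutes the residues modulo [p], so the
     [(x * y ^+ k) ^+ i] run through the coset of [x ^+ i] modulo [<[y]>]. *)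
  pose h (k : 'I_p) := Ordinal (lt_m k).
  rewrite [RHS](reindex_inj (h := h)) /=; last first.
    move=> k1 k2 /(congr1 val) /= /eqP eq12; apply/val_inj/eqP => /=.
    wlog le21 : k1 k2 eq12 / k2 <= k1.
      by move=> IH; have [|/ltnW] := leqP k2 k1; [apply: IH | rewrite eq_sym; apply: IH; rewrite eq_sym].
    rewrite eqn_mod_dvd ?leq_mul2r ?le21 ?orbT // -mulnBl Gauss_dvdl // in eq12.
    rewrite eqn_leq le21 andbT -subn_eq0; apply: contraLR eq12 => nz.
    by rewrite gtnNdvd ?lt0n // (leq_ltn_trans (leq_subr _ _)).
  apply: eq_bigr => k _; rewrite -actrM ?groupX //; congr (_ ^@ _)%R.
  rewrite expgMn; last exact: commuteX.
  by rewrite -expgM (expg_mod _ yp).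
under eq_bigr => k _ do rewrite expg0 actr1.
rewrite sumr_const card_ord => /(congr1 val); rewrite fmvalZ /= fmodK // => ap1.
have: #[a] %| gcdn p #|A| by rewrite dvdn_gcd order_dvdn ap1 eqxx order_dvdG.
by rewrite (eqnP coA) dvdn1 order_eq1.
Qed.

(** * Solvable groups *)

Section Solvable.

Variable gT : finGroupType.
Implicit Types (G H N A B E P Q : {group gT}) (p q r : nat).

Lemma dvdn_Hall (pi : nat_pred) G H p :
  pi.-Hall(G) H -> p \in pi -> prime p -> p %| #|G| -> p %| #|H|.
Proof.
move=> hallH pi_p pr_p p_G.
by rewrite (card_Hall hallH) -[p](@part_pnat_id pi) ?pnatE // partn_dvd.
Qed.

(** If [y] has fixed points neither on [B] nor on [A], then [regular_cent] makes [B] and [A]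
    commute. *)
Lemma adj_chain G A B (y : gT) p q r : prime p -> prime q -> prime r ->
    p != q -> p != r -> q != r -> A \subset G -> B \subset G -> y \in G ->
    abelian A -> r.-group A -> A :!=: 1 -> q.-group B -> B :!=: 1 -> #[y] = p ->
    y \in 'N(A) -> y \in 'N(B) -> B \subset 'N(A) ->
  [|| adj G p q, adj G q r | adj G p r].
Proof.
move=> pr_p pr_q pr_r neq_pq neq_pr neq_qr sAG sBG Gy abA rA ntA qB ntB oy nAy nBy nAB.
apply/or3P; have [regB | ntCB] := eqVneq 'C_B[y] 1; last first.
  by constructor 1; rewrite adjC (adj_cent pr_q _ _ sBG qB Gy) ?oy // eq_sym.
have [regA | ntCA] := eqVneq 'C_A[y] 1; last first.
  by constructor 3; rewrite adjC (adj_cent pr_r _ _ sAG rA Gy) ?oy // eq_sym.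
constructor 2.
have coBA : coprime #|B| #|A|.
  by apply: (pnat_coprime qB); apply: pi_pnat rA _; rewrite !inE eq_sym.
have cAB : B \subset 'C(A) by apply: (regular_cent abA _ nBy nAy nAB coBA regB regA); rewrite oy.
have [_ q_B _] := pgroup_pdiv qB ntB.
have [b Bb ob] := Cauchy pr_q q_B.
have [_ r_A _] := pgroup_pdiv rA ntA.
have [a Aa oa] := Cauchy pr_r r_A.
apply: (adj_commute pr_q pr_r neq_qr (subsetP sBG b Bb) (subsetP sAG a Aa)); rewrite ?ob ?oa //.
exact: (centsP cAB).
Qed.

Lemma solvable_minnormal G : solvable G -> G :!=: 1 ->
  exists A : {group gT}, exists p, [/\ A <| G, A :!=: 1, abelian A, p.-group A & prime p].
Proof.
move=> solG ntG.
have [A [_ nsAG ntA] /and3P[pA abA _]] := solvable_norm_abelem solG (normal_refl G) ntG.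
by exists A, (pdiv #|A|); rewrite pdiv_prime ?cardG_gt1.
Qed.

(** A minimal normal subgroup of a Hall subgroup for [p] and [q] is a group for one of these primes;
    an element of the other prime order acts on it, and both act on [A], as [adj_chain] requires. *)
Lemma adj_pair G A p q r : prime p -> prime q -> prime r ->
    p != q -> p != r -> q != r -> solvable G -> A <| G ->
    abelian A -> r.-group A -> A :!=: 1 -> p %| #|G| -> q %| #|G| ->
  [|| adj G p q, adj G q r | adj G p r].
Proof.
move=> pr_p pr_q pr_r neq_pq neq_pr neq_qr solG /andP[sAG nAG] abA rA ntA p_G q_G.
have [H hallH] := Hall_exists (pred2 p q) solG.
have sHG := pHall_sub hallH.
have dvH t : t \in pred2 p q -> prime t -> t %| #|G| -> t %| #|H|.
  exact: dvdn_Hall hallH.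
have pH := dvH p (predU1l _ (erefl p)) pr_p p_G.
have qH : q %| #|H| by apply: dvH; rewrite // !inE eqxx orbT.
have ntH : H :!=: 1 by apply: contraTneq pH => ->; rewrite cards1 dvdn1 neq_ltn prime_gt1 ?orbT.
have [B [t [nsBH ntB _ tB pr_t]]] := solvable_minnormal (solvableS sHG solG) ntH.
have /andP[sBH nBH] := nsBH.
have sBG := subset_trans sBH sHG.
have: t \in pred2 p q.
  have [_ t_B _] := pgroup_pdiv tB ntB.
  by apply: (pnatPpi (pHall_pgroup hallH)); rewrite mem_primes pr_t cardG_gt0 (dvdn_trans t_B) ?cardSg.
have nA_ x : x \in H -> x \in 'N(A) by move=> Hx; apply/(subsetP nAG)/(subsetP sHG).
case/pred2P=> def_t; rewrite {}def_t in tB.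
  have [y Hy oy] := Cauchy pr_q qH.
  have := adj_chain pr_q pr_p pr_r _ neq_qr neq_pr sAG sBG (subsetP sHG y Hy) abA rA ntA tB ntB oy.
  rewrite eq_sym neq_pq adjC orbCA => /(_ isT); rewrite orbC -orbA orbCA [X in _ || X]orbC; apply.
  - exact: nA_.
  - exact: (subsetP nBH).
  - by apply/subsetP=> x /(subsetP sBH); apply: nA_.
have [y Hy oy] := Cauchy pr_p pH.
apply: (adj_chain pr_p pr_q pr_r neq_pq neq_pr neq_qr sAG sBG (subsetP sHG y Hy) abA rA ntA tB ntB oy).
- exact: nA_.
- exact: (subsetP nBH).
- by apply/subsetP=> x /(subsetP sBH); apply: nA_.
Qed.

(** In a Hall subgroup for the three primes a minimal normal subgroup belongs to one of them, which
    plays the role of [r] in [adj_pair]. *)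
Lemma solvable_adj3 G p q r : prime p -> prime q -> prime r ->
    p != q -> p != r -> q != r -> solvable G ->
    p %| #|G| -> q %| #|G| -> r %| #|G| ->
  [|| adj G p q, adj G q r | adj G p r].
Proof.
move=> pr_p pr_q pr_r neq_pq neq_pr neq_qr solG p_G q_G r_G.
have [H hallH] := Hall_exists (pred3 p q r) solG.
have sHG := pHall_sub hallH.
have pH : p %| #|H| by rewrite (dvdn_Hall hallH) // !inE eqxx.
have qH : q %| #|H| by rewrite (dvdn_Hall hallH) // !inE eqxx orbT.
have rH : r %| #|H| by rewrite (dvdn_Hall hallH) // !inE eqxx !orbT.
have ntH : H :!=: 1 by apply: contraTneq pH => ->; rewrite cards1 dvdn1 neq_ltn prime_gt1 ?orbT.
have solH := solvableS sHG solG.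
have [A [t [nsAH ntA abA tA pr_t]]] := solvable_minnormal solH ntH.
have: t \in pred3 p q r.
  have [_ t_A _] := pgroup_pdiv tA ntA.
  by apply: (pnatPpi (pHall_pgroup hallH)); rewrite mem_primes pr_t cardG_gt0 (dvdn_trans t_A) ?cardSg ?normal_sub.
case/or3P=> /eqP def_t; rewrite {}def_t in tA pr_t.
- have := adj_pair pr_q pr_r pr_p neq_qr _ _ solH nsAH abA tA ntA qH rH.
  rewrite 2!(eq_sym _ p) neq_pq neq_pr => /(_ isT isT)/or3P[] /(adjS sHG) a; apply/or3P;
  [constructor 2 | constructor 3; rewrite adjC | constructor 1; rewrite adjC]; exact: a.
- have := adj_pair pr_p pr_r pr_q neq_pr neq_pq _ solH nsAH abA tA ntA pH rH.
  rewrite (eq_sym r q) neq_qr => /(_ isT)/or3P[] /(adjS sHG) a; apply/or3P;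
  [constructor 3 | constructor 2; rewrite adjC | constructor 1]; exact: a.
have := adj_pair pr_p pr_q pr_r neq_pq neq_pr neq_qr solH nsAH abA tA ntA pH qH.
by case/or3P=> /(adjS sHG) a; apply/or3P; [constructor 1 | constructor 2 | constructor 3].
Qed.

(** A noncyclic abelian [p]-group contains an elementary abelian group of rank two, whose nontrivial
    elements cannot all act without fixed points; the centre of [A] provides the abelian group that
    [regular_noncyclic] needs. *)
Lemma adj_noncyclic G E A p q : prime p -> prime q -> p != q ->
    E \subset G -> A \subset G -> E \subset 'N(A) ->
    abelian E -> p.-group E -> ~~ cyclic E -> q.-group A -> A :!=: 1 -> adj G p q.
Proof.
move=> pr_p pr_q neq_pq sEG sAG nAE abE pE ncE qA ntA.
have sZA := center_sub A.
have [E0 /pnElemP[sE0E abelE0 logE0]] : exists E0, E0 \in 'E_p^2(E).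
  by apply/p_rank_geP; rewrite -rank_pgroup // ltnNge -abelian_rank1_cyclic.
have [pE0 abE0 expE0] := and3P abelE0; have {}expE0 := exponentP expE0.
have ncE0 : ~~ cyclic E0 by rewrite (abelem_cyclic abelE0) logE0.
have ntE0 : E0 :!=: 1 by apply: contraNneq ncE0 => ->; apply: cyclic1.
have [y E0y nty] := trivgPn _ ntE0.
have oy : #[y] = p by apply: (abelem_order_p abelE0).
have sYE : <[y]> \subset E0 by rewrite cycle_subG.
have /properP[_ [x E0x notYx]] : <[y]> \proper E0.
  by rewrite properEneq sYE andbT; apply: contraNneq ncE0 => <-; apply: cycle_cyclic.
have cxy : commute x y by apply: (centsP abE0).
have ntZ : 'Z(A) != 1 by rewrite (center_nil_eq1 (pgroup_nil qA)).
have nZ z : z \in E0 -> z \in 'N('Z(A)).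
  exact/subsetP/(char_norm_trans (center_char A))/(subset_trans sE0E).
have qZ := pgroupS sZA qA; have sZG := subset_trans sZA sAG.
have coZ : coprime p #|'Z(A)| by rewrite coprime_sym (pnat_coprime qZ) // pnatE // !inE eq_sym.
have step z : z \in E0 -> z != 1 -> 'C_('Z(A))[z] != 1 -> adj G p q.
  move=> E0z ntz; rewrite adjC; apply: (adj_cent pr_q pr_p _ sZG qZ).
  - by rewrite eq_sym.
  - exact/(subsetP sEG)/(subsetP sE0E).
  by rewrite (abelem_order_p abelE0).
have [regy | /step->//] := eqVneq 'C_('Z(A))[y] 1.
apply: contraNT ntZ => nadj; apply/eqP.
apply: (regular_noncyclic (center_abelian A) pr_p coZ cxy _ _ _ _ regy); rewrite ?expE0 ?nZ // => k.
apply/eqP; apply: contraNT nadj; apply: step; first by rewrite groupM ?groupX.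
by apply: contraNneq notYx => /eqP; rewrite -eq_invg_mul => /eqP E1; rewrite -groupV E1 mem_cycle.
Qed.

(** In a Hall subgroup for [p] and [q], a minimal normal subgroup belongs to one prime and is acted
    on by a group of rank two of the other. *)
Lemma adj_rank2 G p q : prime p -> prime q -> p != q -> solvable G ->
  1 < 'r_p(G) -> 1 < 'r_q(G) -> adj G p q.
Proof.
move=> pr_p pr_q neq_pq solG rp rq.
have [H hallH] := Hall_exists (pred2 p q) solG.
have sHG := pHall_sub hallH; apply: (adjS sHG).
rewrite -(p_rank_Hall hallH) ?inE ?eqxx // in rp.
rewrite -(p_rank_Hall hallH) ?inE ?eqxx ?orbT // in rq.
have /p_rank_geP[E Ep] := rp; have /p_rank_geP[F Fq] := rq.
have ntH : H :!=: 1.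
  by apply: contraTneq rp => ->; rewrite p_rank1.
have [A [t [nsAH ntA abA tA pr_t]]] := solvable_minnormal (solvableS sHG solG) ntH.
have /andP[sAH nAH] := nsAH.
have gen r s B : prime r -> prime s -> r != s -> B \in 'E_r^2(H) -> s.-group A -> adj H r s.
  move=> pr_r pr_s neq_rs /pnElemP[sBH abelB logB] sA.
  have [rB abB _] := and3P abelB.
  apply: (adj_noncyclic pr_r pr_s neq_rs sBH sAH (subset_trans sBH nAH) abB rB _ sA ntA).
  by rewrite (abelem_cyclic abelB) logB.
have: t \in pred2 p q.
  have [_ t_A _] := pgroup_pdiv tA ntA.
  by apply: (pnatPpi (pHall_pgroup hallH)); rewrite mem_primes pr_t cardG_gt0 (dvdn_trans t_A) ?cardSg ?normal_sub.
case/pred2P=> def_t; rewrite {}def_t in tA pr_t.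
  by rewrite adjC; apply: gen Fq tA; rewrite // eq_sym.
exact: gen Ep tA.
Qed.

(** The automorphism group of a cyclic group is abelian. *)
Lemma der1_cent_cyclic A Q : cyclic A -> Q \subset 'N(A) -> Q^`(1) \subset 'C(A).
Proof.
move=> cycA nAQ; have abQ : abelian (conj_aut A @* Q).
  exact: abelianS (subset_trans (morphimS _ (subxx _)) (Aut_conj_aut _ _)) (Aut_cyclic_abelian cycA).
rewrite -ker_conj_aut -sub_morphim_pre ?(subset_trans (der_sub 1 Q)) //.
by rewrite morphim_der // (derG1P abQ).
Qed.

Definition cyclicSylow G p := [exists P : {group gT}, p.-Sylow(G) P && cyclic P].

Lemma cyclicSylowS G p P : cyclicSylow G p -> P \subset G -> p.-group P -> cyclic P.
Proof.
case/existsP=> Q /andP[sylQ cycQ] sPG pP.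
have [x Gx sPQ] := Sylow_subJ sylQ sPG pP.
by rewrite (cyclicS sPQ) ?cyclicJ.
Qed.

(** A minimal normal subgroup [A] of a Hall subgroup for 2 and [p] is cyclic. If it is a 2-group,
    its only involution is fixed by every element of order [p]; if it is a [p]-group, it is
    centralised by the derived subgroup of a Sylow 2-subgroup, nontrivial because an abelian 2-group
    of rank one would be cyclic. *)
Lemma adj_quaternion G p : prime p -> p != 2 -> solvable G ->
    2 %| #|G| -> p %| #|G| ->
    'r_2(G) <= 1 -> ~~ cyclicSylow G 2 -> cyclicSylow G p -> adj G 2 p.
Proof.
move=> pr_p odd_p solG G2 Gp r2 ncyc2 cycp.
have [H hallH] := Hall_exists (pred2 2 p) solG.
have sHG := pHall_sub hallH; apply: (adjS sHG).
have pH : p %| #|H| by rewrite (dvdn_Hall hallH) // !inE eqxx orbT.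
have H2 : 2 %| #|H| by rewrite (dvdn_Hall hallH) // !inE eqxx.
have ntH : H :!=: 1 by apply: contraTneq pH => ->; rewrite cards1 dvdn1 neq_ltn prime_gt1 ?orbT.
have [A [t [nsAH ntA abA tA pr_t]]] := solvable_minnormal (solvableS sHG solG) ntH.
have /andP[sAH nAH] := nsAH.
have: t \in pred2 2 p.
  have [_ t_A _] := pgroup_pdiv tA ntA.
  by apply: (pnatPpi (pHall_pgroup hallH)); rewrite mem_primes pr_t cardG_gt0 (dvdn_trans t_A) ?cardSg ?normal_sub.
case/pred2P=> def_t; rewrite {}def_t in tA pr_t.
  have [y Hy oy] := Cauchy pr_p pH.
  have cycA : cyclic A.
    rewrite abelian_rank1_cyclic // (rank_pgroup tA).
    by rewrite (leq_trans _ r2) // p_rankS // (subset_trans sAH).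
  have nAy : y \in 'N('Ohm_1(A)) by apply: (subsetP (char_norm_trans (Ohm_char 1 A) nAH)).
  have o1 := Ohm1_cyclic_pgroup_prime cycA tA ntA.
  have /cyclicP[z defZ] : cyclic 'Ohm_1(A) := cyclicS (Ohm_sub 1 A) cycA.
  have sZA : <[z]> \subset A by rewrite -defZ Ohm_sub.
  have oz : #[z] = 2 by rewrite orderE -defZ.
  have Hz : z \in H by rewrite (subsetP sAH) // (subsetP sZA) ?cycle_id.
  apply: (adj_commute (x := z) (y := y)); rewrite ?oz ?oy ?(eq_sym 2) //.
  have : z ^ y \in <[z]> by rewrite -defZ memJ_norm // defZ cycle_id.
  rewrite cycle2g // !inE -{1}(conj1g y) (inj_eq (conjg_inj y)) -order_eq1 oz /=.
  by move/eqP/conjg_fixP/commgP.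
have [Q sylQ] := Sylow_exists 2 H.
have sQH := pHall_sub sylQ; have p2Q := pHall_pgroup sylQ.
have sylQG : 2.-Sylow(G) Q by apply: subHall_Sylow hallH _ sylQ; rewrite !inE.
have cycA : cyclic A by apply: cyclicSylowS cycp _ tA; apply: subset_trans sHG.
have cQ' := der1_cent_cyclic cycA (subset_trans sQH nAH).
have ntQ' : Q^`(1) != 1.
  apply: contra ncyc2 => /eqP/derG1P abQ; apply/existsP; exists Q; rewrite sylQG.
  by rewrite abelian_rank1_cyclic // (rank_pgroup p2Q) (p_rank_Sylow sylQG).
have [x Q'x ntx] := trivgPn _ ntQ'.
have Hx : x \in H by rewrite (subsetP sQH) // (subsetP (der_sub 1 Q)).
rewrite adjC; apply: (adj_cent pr_p _ odd_p sAH tA Hx) => //.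
  have p2x : 2.-elt x by rewrite (mem_p_elt p2Q) // (subsetP (der_sub 1 Q)).
  by rewrite -(pdiv_p_elt p2x ntx) pdiv_dvd.
by rewrite (setIidPl _) // sub_cent1 (subsetP cQ').
Qed.

(** Otherwise a minimal normal subgroup of the quotient below the image of the centraliser lifts to
    a group [B] that is abelian modulo the central subgroup ['F(G)], hence nilpotent, hence inside
    ['F(G)]. *)
Lemma cent_sub_cyclic_Fitting G : solvable G -> cyclic 'F(G) -> 'C_G('F(G)) \subset 'F(G).
Proof.
move=> solG cycF; have nsFG := Fitting_normal G; have /andP[sFG nFG] := nsFG.
have nsCG : 'C_G('F(G)) <| G by rewrite /normal subsetIl normsI ?normG ?norms_cent.
have nFC : 'C_G('F(G)) \subset 'N('F(G)) by rewrite subIset // nFG.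
rewrite -quotient_sub1 //; apply/trivgP/eqP; apply: contraT => ntC.
have solC : solvable ('C_G('F(G)) / 'F(G)) by rewrite quotient_sol // (solvableS _ solG) ?subsetIl.
have [M [sMC nsMG ntM /and3P[_ abM _]]] := solvable_norm_abelem solC (quotient_normal _ nsCG) ntC.
have [B defM sFB nsBG] := inv_quotientN nsFG nsMG.
have nFB : B \subset 'N('F(G)) := subset_trans (normal_sub nsBG) nFG.
have cFB : B \subset 'C('F(G)).
  rewrite defM quotientSK // in sMC.
  by apply: subset_trans sMC _; rewrite mulSGid ?subsetIr // subsetI sFG; apply: cyclic_abelian.
have nilB : nilpotent B.
  rewrite -quotient_center_nil abelian_nil // sub_der1_abelian //.
  apply: subset_trans (_ : 'F(G) \subset _); last by rewrite subsetI sFB centsC.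
  by rewrite der1_min // -defM.
have sBF := Fitting_max nsBG nilB.
by case/eqP: ntM; apply/trivgP; rewrite defM quotient_sub1.
Qed.

(** Both ['F(G)] and [G / 'F(G)] are abelian: the first is a nilpotent Z-group, hence cyclic, and so
    the derived subgroup of [G] centralises it and lies in it. Two primes on the same side commute
    there. *)
Lemma Zgroup_Fitting_adj G p q : solvable G -> Zgroup G -> prime p -> prime q -> p != q ->
    p %| #|G| -> q %| #|G| -> (p %| #|'F(G)|) = (q %| #|'F(G)|) -> adj G p q.
Proof.
move=> solG ZG pr_p pr_q neq_pq Gp Gq eqF.
have nilF := Fitting_nil G; have sFG := Fitting_sub G; have nsFG := Fitting_normal G.
have cycF : cyclic 'F(G).
  by apply: nil_Zgroup_cyclic nilF; apply: ZgroupS sFG ZG.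
have [Fp | F'p] := boolP (p %| #|'F(G)|).
  have [x Fx ox] := Cauchy pr_p Fp; rewrite Fp in eqF.
  have [y Fy oy] := Cauchy pr_q (esym eqF).
  apply: (adj_commute (x := x) (y := y)); rewrite ?ox ?oy ?(subsetP sFG) //.
  exact: (centsP (cyclic_abelian cycF)).
rewrite (negPf F'p) in eqF.
have abQ : abelian (G / 'F(G)).
  rewrite sub_der1_abelian //; apply: subset_trans (cent_sub_cyclic_Fitting solG cycF).
  by rewrite subsetI der_sub der1_cent_cyclic ?normal_norm.
have dvQ r : prime r -> r %| #|G| -> ~~ (r %| #|'F(G)|) -> r %| #|G / 'F(G)|.
  move=> pr_r; rewrite card_quotient ?normal_norm // -(Lagrange sFG) Euclid_dvdM //.
  by case/orP=> // ->.
apply: (adj_quo nsFG).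
have [x Gx ox] := Cauchy pr_p (dvQ p pr_p Gp F'p).
have [y Gy oy] := Cauchy pr_q (dvQ q pr_q Gq (negbT (esym eqF))).
apply: (adj_commute (x := x) (y := y)); rewrite ?ox ?oy //.
exact: (centsP abQ).
Qed.

(* Colour [0] for the primes of rank at least two; the primes with cyclic Sylow
   subgroups are split by the Fitting subgroup of the corresponding Hall
   subgroup, and [2] is adjacent to all the other primes of rank one if its
   Sylow subgroups are generalized quaternion. *)
Lemma solvable_coloring G : solvable G -> exists col : nat -> 'I_3,
  (forall p, 1 < 'r_p(G) -> col p = ord0) /\
  (forall p q, prime p -> prime q -> p != q -> p %| #|G| -> q %| #|G| ->
     ~~ adj G p q -> col p != col q).
Proof.
move=> solG; pose X : nat_pred := [pred p | cyclicSylow G p].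
have [H hallH] := Hall_exists X solG.
have sHG := pHall_sub hallH; have solH := solvableS sHG solG.
(* The value [inord 1] also covers the prime 2 when its Sylow subgroup is noncyclic of rank one. *)
pose col p : 'I_3 := if 1 < 'r_p(G) then ord0 else
  if cyclicSylow G p && ~~ (p %| #|'F(H)|) then inord 2 else inord 1.
have v1 : nat_of_ord (inord 1 : 'I_3) = 1%N by rewrite inordK.
have v2 : nat_of_ord (inord 2 : 'I_3) = 2%N by rewrite inordK.
exists col; split=> [p rp | p q pr_p pr_q neq_pq Gp Gq]; first by rewrite /col rp.
apply: contraNneq => /(congr1 (@nat_of_ord 3)).
have ZH : Zgroup H.
  apply/forall_inP=> V /SylowP[r pr_r sylV].
  have sVH := pHall_sub sylV; have rV := pHall_pgroup sylV.
  have [r_V | r'V] := boolP (r %| #|V|).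
    apply: (cyclicSylowS (p := r)) (subset_trans sVH sHG) rV.
    by apply: (pnatPpi (pHall_pgroup hallH)); rewrite mem_primes pr_r cardG_gt0 (dvdn_trans r_V) ?cardSg.
  have [-> | ntV] := eqVneq V 1%G; first exact: cyclic1.
  by case/pgroup_pdiv: rV r'V => // _ ->.
have cyc_odd r : prime r -> r != 2 -> 'r_r(G) <= 1 -> cyclicSylow G r.
  move=> pr_r odd_r rr; have [P sylP] := Sylow_exists r G.
  have rP := pHall_pgroup sylP.
  apply/existsP; exists P; rewrite sylP (odd_pgroup_rank1_cyclic rP) ?(p_rank_Sylow sylP) //.
  by apply: odd_pgroup_odd rP; have [|//] := even_prime pr_r; move/eqP; rewrite (negPf odd_r).
have cyc_adj : cyclicSylow G p -> cyclicSylow G q -> (p %| #|'F(H)|) = (q %| #|'F(H)|) -> adj G p q.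
  move=> cp cq eqF; apply: (adjS sHG).
  by apply: Zgroup_Fitting_adj eqF => //; apply: (dvdn_Hall hallH).
rewrite /col; case: ltnP => rp; case: ltnP => rq; try by case: ifP => _; rewrite ?v1 ?v2.
  by move=> _; apply: adj_rank2.
case: (boolP (cyclicSylow G p)) => cp; case: (boolP (cyclicSylow G q)) => cq /=.
- case: (boolP (p %| _)) => Fp; case: (boolP (q %| _)) => Fq; rewrite ?v1 ?v2 // => _;
  by apply: cyc_adj; rewrite ?(negPf Fp) ?(negPf Fq) ?Fp ?Fq.
- move=> _; have q2 : q = 2 by apply: contraNeq cq => /cyc_odd; apply.
  by move: neq_pq Gq rq cq; rewrite q2 adjC => *; apply: adj_quaternion.
- move=> _; have p2 : p = 2 by apply: contraNeq cp => /cyc_odd; apply.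
  by move: neq_pq Gp rp cp; rewrite p2 eq_sym => *; apply: adj_quaternion.
have p2 : p = 2 by apply: contraNeq cp => /cyc_odd; apply.
have q2 : q = 2 by apply: contraNeq cq => /cyc_odd; apply.
by rewrite p2 q2 in neq_pq.
Qed.

End Solvable.

(** * Composition factors and Hall subgroups of odd order *)

(** Quantifying over subnormal subgroups rather than composition series makes the property visibly
    hereditary and avoids the representatives chosen by [mkfactors]; [pseudo_goodP] shows that the
    two notions agree. *)
Definition good (gT : finGroupType) (G : {group gT}) :=
  forall H M : {group gT}, H <|<| G -> maxnormal M H H ->
  abelian (H / M) \/ H / M \isog PSL27.

Section Good.

Variable gT : finGroupType.
Implicit Types G H K M N : {group gT}.

Local Notation compo := [rel x y : {set gT} | maxnormal y x x].

Lemma subnormal_compo G H : H <|<| G -> exists2 s : seq {group gT}, compo.-series G s & last G s = H.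
Proof.
have [n] := ubnP #|G|; elim: n G => // n IHn G /ltnSE-leGn snHG.
have [/val_inj <- | [K [snHK nsKG prKG]]] := subnormalEr snHG; first by exists [::].
have [M maxM sKM] : {M : {group gT} | maxnormal M G G & K \subset M}.
  by apply: maxgroup_exists; rewrite prKG normal_norm.
have [||s Ms lastM] := IHn M.
- by rewrite (leq_trans _ leGn) // proper_card // (maxnormal_proper maxM).
- have snHM := setI_subnormal (maxnormal_sub maxM) snHG.
  by rewrite (setIidPl (subset_trans (subnormal_sub snHK) sKM)) in snHM.
by exists (M :: s); rewrite //= Ms andbT.
Qed.

Lemma pseudo_goodP G : pseudo_PSL27_solvable G <-> good G.
Proof.
split=> [psG H M snHG maxM | goodG s].
  have [s Gs lastH] := subnormal_compo snHG; have [t Mt] := exists_comps M.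
  (* A composition series in which [M] directly follows [H], so that [H / M] occurs among its
     factors. *)
  have cst : comps G (s ++ M :: t).
    case/andP: Mt => /eqP lastM Mt.
    by rewrite /comps last_cat /= lastM eqxx cat_path Gs lastH /= maxM.
  have := psG _ cst (section_repr (mkSec H M)).
  rewrite /mkfactors pairmap_cat lastH map_cat mem_cat /= inE eqxx orbT => /(_ isT).
  have iso := section_reprP (mkSec H M).
  case=> [ab | iso27]; [left | right]; first by rewrite -(isog_abelian iso).
  by apply: isog_trans iso27; rewrite isog_sym.
have [n] := ubnP (size s); elim: n s G goodG => // n IHn [|M s] G goodG //=.
move=> /ltnSE-les cs F; rewrite inE => /predU1P[-> | Fs].
  case/andP: cs => _ /= /andP[maxM _].
  have iso := section_reprP (mkSec G M).
  case: (goodG G M (subnormal_refl G) maxM) => [ab | iso27].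
    by left; rewrite (isog_abelian iso).
  by right; apply: isog_trans iso27.
apply: IHn (comps_cons cs) _ Fs => // H L snHM.
apply: goodG; apply: subnormal_trans snHM _; apply: normal_subnormal.
by case/andP: cs => _ /= /andP[/maxnormal_normal].
Qed.

Lemma good_subnormal G H : good G -> H <|<| G -> good H.
Proof. by move=> goodG snHG K M snKH; apply: goodG; apply: subnormal_trans snHG. Qed.

End Good.

(** Conjugacy is part of the property because the extension step needs a Frattini argument in the
    normal subgroup. *)
Definition hall_odd (gT : finGroupType) (G : {group gT}) :=
  exists H : {group gT}, [/\ 2^'.-Hall(G) H, solvable H &
    forall K : {group gT}, 2^'.-Hall(G) K -> exists2 x, x \in G & K :=: H :^ x].

Lemma hall_odd_solvable (gT : finGroupType) (G : {group gT}) : solvable G -> hall_odd G.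
Proof.
move=> solG; have [H hallH] := Hall_exists 2^' solG.
exists H; split=> // [|K hallK]; first exact: solvableS (pHall_sub hallH) solG.
exact: Hall_trans hallK hallH.
Qed.

Lemma hall_odd_isog (gT rT : finGroupType) (G : {group gT}) (L : {group rT}) :
  G \isog L -> hall_odd G -> hall_odd L.
Proof.
case/isogP=> f injf defL [H [hallH solH conjH]]; have sHG := pHall_sub hallH.
exists (f @* H)%G; split=> [||K].
- by rewrite -defL morphim_pHall.
- exact: morphim_sol.
rewrite -defL => hallK; have sKL := pHall_sub hallK.
have [|x Gx defK] := conjH (f @*^-1 K)%G.
  by rewrite -(injm_pHall injf) ?subsetIl ?morphpreK // subsetIl.
by exists (f x); rewrite ?mem_morphim // -morphimJ // -defK morphpreK.
Qed.

(** Conjugacy in [N] gives [G = N * 'N_G(H)], so inside ['N_G(H)] there is a group [B] covering [A]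
    and meeting [N] in ['N_N(H)]. The latter is [H] extended by a 2-group, so [B] is solvable and
    Hall's theorem applies to it. *)
Lemma hall_odd_ext (gT : finGroupType) (G N : {group gT}) :
  N <| G -> hall_odd N -> hall_odd (G / N) -> hall_odd G.
Proof.
move=> nsNG [H [hallH solH conjH]] [A [hallA solA conjA]].
have /andP[sNG nNG] := nsNG.
have sHN := pHall_sub hallH.
have nNX : 'N_G(H) \subset 'N(N) by rewrite subIset // nNG.
have defG : N * 'N_G(H) = G.
  apply/eqP; rewrite eqEsubset mul_subG ?subsetIl //=; apply/subsetP=> g Gg.
  have [|x Nx eqH] := conjH (H :^ g)%G; first by rewrite pHallJnorm // (subsetP nNG).
  rewrite -(normC nNX) -(mulgKV x g) mem_mulg // inE groupM ?groupV ?(subsetP sNG x) //=.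
  by apply/normP; rewrite conjsgM -[X in _ = X](conjsgK x) -eqH.
have [A0 defA sNA sA0G] := inv_quotientS nsNG (pHall_sub hallA).
pose B := (A0 :&: 'N_G(H))%G.
have sBG : B \subset G by rewrite subIset // sA0G.
have nNB : B \subset 'N(N) := subset_trans sBG nNG.
have defBN : B / N = A.
  rewrite defA -quotientMidl /= setIC group_modl // defG.
  by rewrite (setIidPr sA0G).
have YB : N :&: B = 'N_N(H) by rewrite /= setIA (setIidPl sNA) setIA (setIidPl sNG).
have sHNN : H \subset 'N_N(H) by rewrite subsetI sHN normG.
have solY : solvable 'N_N(H).
  rewrite (series_sol (normalSG sHN)) solH.
  apply: (pgroup_sol (p := 2)).
  rewrite /pgroup card_quotient ?subsetIr //.
  have /and3P[_ _] := pHall_subl sHNN (subsetIl _ _) hallH.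
  by rewrite pnatNK.
have solB : solvable B.
  have nsYB : N :&: B <| B by rewrite /normal subsetIr normsI ?normG // (subset_trans sBG).
  rewrite (series_sol nsYB); apply/andP; split; first by move: solY; rewrite -YB.
  by move: solA; rewrite -defBN -(isog_sol (second_isog nNB)).
have [K hallK] := Hall_exists 2^' solB.
have sKB := pHall_sub hallK.
have cardB : (#|B|`_2^' = #|G|`_2^')%N.
  rewrite -(LagrangeI B N) setIC YB -(Lagrange sNG) -(card_quotient nNB) -(card_quotient nNG).
  rewrite !partnM ?cardG_gt0 //.
  rewrite defBN; congr (_ * _)%N.
    by rewrite -(card_Hall hallH) (card_Hall (pHall_subl sHNN (subsetIl _ _) hallH)).
  by rewrite -(card_Hall hallA) (part_pnat_id (pHall_pgroup hallA)).
exists K; split; last 1 first.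
(* Two conjugations bring [L] into [B]: one in [N] makes its intersection with [N] equal to [H], and
   one in ['N_G(H)], which preserves this, makes its image equal to [A]. *)
- move=> L hallL; have sLG := pHall_sub hallL.
  have [|x Nx defLN] := conjH (L :&: N)%G.
    exact: Hall_setI_normal nsNG hallL.
  pose L1 := (L :^ x^-1)%G.
  have Gx := subsetP sNG x Nx.
  have hallL1 : 2^'.-Hall(G) L1 by rewrite pHallJ // groupV.
  have L1N : L1 :&: N = H.
    by rewrite -(normsP (normG N) x^-1) ?groupV //= -conjIg defLN conjsgK.
  have nHL1 : L1 \subset 'N_G(H).
    rewrite subsetI (pHall_sub hallL1) -L1N normsI ?normG //.
    exact: subset_trans (pHall_sub hallL1) nNG.
  have [|yb] := conjA (L1 / N)%G.
    by apply: (quotient_pHall _ hallL1); apply: subset_trans (pHall_sub hallL1) nNG.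
  have defQ : G / N = 'N_G(H) / N by rewrite -[RHS]quotientMidl defG.
  rewrite /= defQ => /morphimP[y Ny Yy ->{yb}] defL1.
  have Gy : y \in G by case/setIP: Yy.
  pose L2 := (L1 :^ y^-1)%G.
  have hallL2 : 2^'.-Hall(G) L2 by rewrite pHallJ // groupV.
  have L2N : L2 / N = A by rewrite quotientJ ?groupV //= defL1 morphV // conjsgK.
  have sL2B : L2 \subset B.
    have nHL2 : L2 \subset 'N_G(H).
      by rewrite -(normsP (normG 'N_G(H)) y^-1) ?groupV // conjSg.
    rewrite subsetI nHL2 andbT -(mulSGid sNA) -quotientSK ?L2N ?defA //.
    by apply: subset_trans (pHall_sub hallL2) nNG.
  have [|b Bb defL2] := Hall_trans solB (_ : 2^'.-Hall(B) L2) hallK.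
    exact: pHall_subl sL2B sBG hallL2.
  exists (b * y * x); first by rewrite !groupM // (subsetP sBG).
  by rewrite !conjsgM -defL2 !conjsgKV.
- by rewrite pHallE (subset_trans sKB sBG) -cardB (card_Hall hallK) eqxx.
exact: solvableS sKB solB.
Qed.

Lemma hall_odd_good (gT : finGroupType) (G : {group gT}) : hall_odd PSL27 -> good G -> hall_odd G.
Proof.
move=> hK; have [n] := ubnP #|G|; elim: n G => // n IHn G /ltnSE-leGn goodG.
have [-> | ntG] := eqVneq G 1%G; first exact/hall_odd_solvable/solvable1.
have [N maxN] := ex_maxnormal_ntrivg ntG.
have nsNG := maxnormal_normal maxN.
apply: (hall_odd_ext nsNG).
  apply: IHn; first by rewrite (leq_trans _ leGn) // proper_card // (maxnormal_proper maxN).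
  exact: good_subnormal goodG (normal_subnormal nsNG).
case: (goodG G N (subnormal_refl G) maxN) => [abQ | isoQ].
  exact/hall_odd_solvable/abelian_sol.
by apply: hall_odd_isog hK; rewrite isog_sym.
Qed.

(** * Computations in SL(2,7) and PSL(2,7) *)

(** A 2 by 2 matrix over ['F_7] as its entries, row by row, reduced modulo 7; in this form
    statements about [SL(2,7)] are decided by running through its 336 elements with [vm_compute]. *)
Definition quad := (nat * nat * nat * nat)%type.

Definition quad_mul (x y : quad) : quad :=
  let: (a, b, c, d) := x in let: (e, f, g, h) := y in
  ((a * e + b * g) %% 7, (a * f + b * h) %% 7,
   (c * e + d * g) %% 7, (c * f + d * h) %% 7)%N.

Definition quad_one : quad := (1, 0, 0, 1)%N.
Definition quad_opp : quad := (6, 0, 0, 6)%N.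
Definition quad_exp (x : quad) n := iter n (quad_mul x) quad_one.
Definition quad_central (x : quad) := (x == quad_one) || (x == quad_opp).
(** The equation is written without subtraction because the entries are natural numbers. *)
Definition quad_det1 (x : quad) :=
  let: (a, b, c, d) := x in (a * d == b * c + 1 %[mod 7])%N.
Definition pairs7 := allpairs pair (iota 0 7) (iota 0 7).
Definition quad_SL : seq quad :=
  [seq x <- [seq (u.1, u.2, v.1, v.2) | u <- pairs7, v <- pairs7] | quad_det1 x].

(* The quaternion group generated by [0, -1; 1, 0] and [2, 3; 3, -2] *)
Definition quad_Q8 : seq quad :=
  [:: (0, 1, 6, 0); (0, 6, 1, 0); (1, 0, 0, 1); (2, 3, 3, 5);
      (3, 5, 5, 4); (4, 2, 2, 3); (5, 4, 4, 2); (6, 0, 0, 6)]%N.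
(** The equation [z x = x w] says that [w] is the conjugate of [z] by [x], without computing an
    inverse. *)
Definition quad_normQ8 (x : quad) :=
  all (fun z => has (fun w => quad_mul z x == quad_mul x w) quad_Q8) quad_Q8.

Local Notation SL := (SLgroup 2 'F_7).

Definition coord (u : {'GL_2['F_7]}) : quad :=
  let: A := GLval u in (val (A ord0 ord0), val (A ord0 ord_max), val (A ord_max ord0), val (A ord_max ord_max)).

Lemma card_quad_SL : size quad_SL = 336.
Proof. by vm_compute. Qed.
Lemma uniq_quad_SL : uniq quad_SL.
Proof. by vm_compute. Qed.

Lemma mulmx2E (R : GRing.PzRing.type) (A B : 'M[R]_2) i j :
  ((A *m B) i j = A i ord0 * B ord0 j + A i ord_max * B ord_max j)%R.
Proof.
by rewrite mxE big_ord_recr /= big_ord1; congr (A _ _ * B _ _ + _)%R; apply: val_inj.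
Qed.

Lemma matrix2P (R : Type) (A B : 'M[R]_2) :
  A ord0 ord0 = B ord0 ord0 -> A ord0 ord_max = B ord0 ord_max ->
  A ord_max ord0 = B ord_max ord0 -> A ord_max ord_max = B ord_max ord_max -> A = B.
Proof.
have E (i : 'I_2) : i = ord0 \/ i = ord_max.
  by case: i => [[|[]]]// ?; [left | right]; apply: val_inj.
by move=> e00 e01 e10 e11; apply/matrixP=> i j; case: (E i) => ->; case: (E j) => ->.
Qed.

Lemma det2E (R : comNzRingType) (A : 'M[R]_2) :
  (\det A = A ord0 ord0 * A ord_max ord_max - A ord0 ord_max * A ord_max ord0)%R.
Proof.
rewrite (expand_det_row _ ord0) big_ord_recr /= big_ord1.
rewrite /cofactor !det_mx11 !mxE /= GRing.expr0 GRing.mul1r GRing.expr1 GRing.mulN1r GRing.mulrN.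
by congr (A _ _ * A _ _ - A _ _ * A _ _)%R; apply: val_inj.
Qed.

Lemma val_F7D (a b : 'F_7) : val (a + b)%R = ((val a + val b) %% 7)%N.
Proof. by []. Qed.

Lemma val_F7M (a b : 'F_7) : val (a * b)%R = ((val a * val b) %% 7)%N.
Proof. by []. Qed.

Lemma coordM u v : coord (u * v) = quad_mul (coord u) (coord v).
Proof.
rewrite /coord GL_MxE /quad_mul !mulmx2E !val_F7D !val_F7M.
by rewrite !modnDm.
Qed.

Lemma coord_inj : injective coord.
Proof.
move=> u v [e00 e01 e10 e11].
by apply/val_inj/matrix2P; apply: val_inj.
Qed.

Lemma mem_iota7 (a : 'F_7) : val a \in iota 0 7.
Proof. by rewrite mem_iota; have := ltn_ord a. Qed.

Lemma det1_quad u : (\det (GLval u) == 1)%R = quad_det1 (coord u).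
Proof.
rewrite det2E /quad_det1 /coord GRing.subr_eq -(inj_eq val_inj) val_F7D !val_F7M.
by rewrite modnDmr addnC.
Qed.

Lemma mem_SL u : (u \in SL) = (coord u \in quad_SL).
Proof.
rewrite inE det1_quad mem_filter andb_idr // => _.
have pairs (a b : 'F_7) : (val a, val b) \in pairs7.
  by apply: allpairs_f; apply: mem_iota7.
exact: (allpairs_f (fun u v : nat * nat => (u.1, u.2, v.1, v.2)) (pairs _ _) (pairs _ _)).
Qed.

Lemma quad_SL_coord x : x \in quad_SL -> exists2 u, u \in SL & coord u = x.
Proof.
rewrite mem_filter => /andP[det_x].
have pairsP u : u \in pairs7 -> u.1 < 7 /\ u.2 < 7.
  by case/allpairsP=> ab []; rewrite !mem_iota => lt1 lt2 ->.
case/allpairsP=> -[[a b] [c d]] [/pairsP[/= Ia Ib] /pairsP[/= Ic Id] def_x].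
pose F a (Ia : a < 7) : 'F_7 := Ordinal Ia.
pose A : 'M['F_7]_2 := (\matrix_(i, j) (if i == ord0 then if j == ord0 then F a Ia else F b Ib
  else if j == ord0 then F c Ic else F d Id))%R.
have detA : (\det A = 1)%R.
  rewrite det2E !mxE /=; apply/eqP; rewrite GRing.subr_eq -(inj_eq val_inj) val_F7D !val_F7M.
  by rewrite modnDmr addnC; rewrite def_x in det_x.
have uA : A \is a GRing.unit by rewrite unitmxE detA GRing.unitr1.
pose u0 : {'GL_2['F_7]} := FinRing.Unit uA.
have eq_u0 : GLval u0 = A by [].
exists u0; first by rewrite inE eq_u0 detA.
by rewrite def_x /coord eq_u0 !mxE.
Qed.

Lemma card_SL (P : pred quad) : #|[set u in SL | P (coord u)]| = count P quad_SL.
Proof.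
rewrite -size_filter cardE -(size_map coord); apply/perm_size/uniq_perm.
- by rewrite map_inj_in_uniq ?enum_uniq // => u v _ _ /coord_inj.
- by rewrite filter_uniq ?uniq_quad_SL.
move=> x; rewrite mem_filter; apply/mapP/andP=> [[u]|[Px /quad_SL_coord[u SLu def_x]]].
  by rewrite mem_enum inE mem_SL => /andP[? ?] ->.
by exists u; rewrite // mem_enum inE SLu def_x.
Qed.

Lemma all_SL (P : pred quad) u : all P quad_SL -> u \in SL -> P (coord u).
Proof. by move=> /allP allP SLu; apply: allP; rewrite -mem_SL. Qed.

Lemma coord1 : coord 1 = quad_one.
Proof. by rewrite /coord GL_1E !mxE. Qed.

Lemma coordX u n : coord (u ^+ n) = quad_exp (coord u) n.
Proof. by elim: n => [|n IHn]; rewrite ?coord1 // expgS coordM IHn. Qed.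

Lemma center_SL u : u \in SL -> (u \in 'Z(SL)) = quad_central (coord u).
Proof.
move=> SLu; apply/centerP/idP=> [[_ cu] | cen_u].
  (* Commuting with the two elementary unipotent matrices already forces a matrix of determinant 1
     to be 1 or -1. *)
  have [|e SLe ce] := @quad_SL_coord (1, 1, 0, 1)%N; first by vm_compute.
  have [|f SLf cf] := @quad_SL_coord (1, 0, 1, 1)%N; first by vm_compute.
  pose P x := ((quad_mul x (1, 1, 0, 1) == quad_mul (1, 1, 0, 1) x)
    ==> (quad_mul x (1, 0, 1, 1) == quad_mul (1, 0, 1, 1) x) ==> quad_central x)%N.
  have eq_e : quad_mul (coord u) (coord e) = quad_mul (coord e) (coord u).
    by rewrite -coordM -coordM (cu e SLe).
  have eq_f : quad_mul (coord u) (coord f) = quad_mul (coord f) (coord u).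
    by rewrite -coordM -coordM (cu f SLf).
  rewrite ce in eq_e; rewrite cf in eq_f.
  have hP : P (coord u) by apply: all_SL SLu; vm_compute.
  exact: implyP (implyP hP (introT eqP eq_e)) (introT eqP eq_f).
split=> // v SLv; apply: coord_inj; rewrite !coordM.
pose P x := all (fun z => quad_mul z x == quad_mul x z) [:: quad_one; quad_opp].
have /allP/(_ (coord u)) h : P (coord v) by apply: all_SL SLv; vm_compute.
by apply/eqP/h; move: cen_u; rewrite !inE.
Qed.

(** What is read off from matrices; the other properties used are deduced from it, so they hold for
    every isomorphic copy. The elements [a] and [b] span a Klein four-group; since [a * c] has order
    3, a subgroup containing all involutions has order divisible by 3; the subgroup of order 24
    serves to build a module. *)
Definition PSL27_facts (gT : finGroupType) (K : {group gT}) :=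
  [/\ #|K| = 168,
      {in K, forall x, [|| x ^+ 2 == 1, x ^+ 3 == 1, x ^+ 4 == 1 | x ^+ 7 == 1]},
      exists a b c, [/\ [/\ a \in K, b \in K & c \in K], [/\ #[a] = 2, #[b] = 2 & #[c] = 2],
        #[a * b] = 2 & #[a * c] = 3] &
      exists S : {group gT}, S \subset K /\ #|S| = 24].

Lemma PSL27_factsP : PSL27_facts PSL27.
Proof.
have cardSL : #|SL| = 336.
  have := card_SL xpredT; rewrite count_predT card_quad_SL => <-.
  by apply: eq_card => u; rewrite !inE andbT.
have cardZ : #|'Z(SL)| = 2.
  transitivity #|[set u in SL | quad_central (coord u)]|; last by rewrite card_SL; vm_compute.
  apply: eq_card => u; rewrite [in RHS]inE.
  have [SLu | notSLu] := boolP (u \in SL); first by rewrite center_SL.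
  by apply: contraNF notSLu => /(subsetP (center_sub _)).
have nZSL : SL \subset 'N('Z(SL)) := normal_norm (center_normal _).
have ordq u n : u \in SL -> (coset 'Z(SL) u ^+ n == 1) = quad_central (quad_exp (coord u) n).
  move=> SLu; have Nu := subsetP nZSL u SLu.
  rewrite -coordX -(center_SL (groupX n SLu)) -(@morphX _ _ _ (coset_morphism 'Z(SL)) n u Nu).
  apply/idP/idP=> [/eqP | Zun]; first exact: coset_idr (groupX n Nu).
  by apply/eqP/coset_id.
have ordp u p : prime p -> u \in SL -> quad_central (quad_exp (coord u) p) ->
    ~~ quad_central (coord u) -> #[coset 'Z(SL) u] = p.
  move=> pr_p SLu up u1; apply: nt_prime_order => //; first by apply/eqP; rewrite ordq.
  apply: contra u1 => /eqP; rewrite -center_SL //.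
  exact: coset_idr (subsetP nZSL u SLu).
have mem_K u : u \in SL -> coset 'Z(SL) u \in PSL27 by apply: mem_quotient.
split.
- by rewrite card_quotient // -divgS ?center_sub // cardSL cardZ.
- move=> _ /morphimP[u Nu SLu ->]; rewrite !ordq //.
  pose P x := [|| quad_central (quad_exp x 2), quad_central (quad_exp x 3),
    quad_central (quad_exp x 4) | quad_central (quad_exp x 7)].
  by apply: (@all_SL P) SLu; vm_compute.
(* All three matrices have trace 0 and determinant 1, so their squares are -1. The product of the
   first two has trace 0 as well, and that of the first and third is diagonal with entries 4 and 2,
   of order 3. *)
- have [|a SLa def_a] := @quad_SL_coord (0, 6, 1, 0)%N; first by vm_compute.
  have [|b SLb def_b] := @quad_SL_coord (2, 3, 3, 5)%N; first by vm_compute.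
  have [|c SLc def_c] := @quad_SL_coord (0, 2, 3, 0)%N; first by vm_compute.
  have N_ u : u \in SL -> u \in 'N('Z(SL)) by move/(subsetP nZSL).
  exists (coset _ a), (coset _ b), (coset _ c); split.
  + by rewrite !mem_K.
  + by split; apply: ordp; rewrite ?def_a ?def_b ?def_c //; vm_compute.
  + by rewrite -morphM ?N_ //; apply: ordp; rewrite ?groupM // coordM def_a def_b; vm_compute.
  by rewrite -morphM ?N_ //; apply: ordp; rewrite ?groupM // coordM def_a def_c; vm_compute.
(* The normaliser of the quaternion group has order 48 and contains the centre; its image is the
   required subgroup of order 24. *)
pose A := [set u in SL | coord u \in quad_Q8].
have Q8_SL : {subset quad_Q8 <= quad_SL} by apply/allP; vm_compute.
have defN : 'N_SL(A) = [set u in SL | quad_normQ8 (coord u)].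
  apply/setP=> u; rewrite [in RHS]inE inE; apply: andb_id2l => SLu.
  apply/idP/allP=> [nAu z Qz | nQu].
    have [v SLv def_v] := quad_SL_coord (Q8_SL z Qz).
    have Av : v \in A by rewrite inE SLv def_v.
    move: Av; rewrite -(memJ_norm v nAu).
    rewrite inE => /andP[_ Qvu]; apply/hasP; exists (coord (v ^ u)); first exact: Qvu.
    by rewrite -def_v -!coordM -conjgC.
  rewrite inE; apply/subsetP=> _ /imsetP[v /setIdP[SLv Qv] ->].
  have /hasP[w Qw /eqP] := nQu _ Qv.
  have [z SLz def_z] := quad_SL_coord (Q8_SL w Qw).
  rewrite -def_z -!coordM => /coord_inj; rewrite conjgC => /mulgI->.
  by rewrite inE SLz def_z.
exists ('N_SL(A) / 'Z(SL))%G; split; first by rewrite quotientS ?subsetIl.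
have sZN : 'Z(SL) \subset 'N_SL(A).
  rewrite subsetI center_sub /=; apply: subset_trans (subsetIr _ _) _.
  apply: subset_trans (cent_sub A); apply: centS.
  by apply/subsetP=> u /setIdP[].
have card48 : #|'N_SL(A)| = 48 by rewrite defN card_SL; vm_compute.
have nZN : 'N_SL(A) \subset 'N('Z(SL)) := subset_trans (subsetIl _ _) nZSL.
by rewrite (card_quotient nZN) -(divgS sZN) cardZ card48.
Qed.

Lemma PSL27_facts_isog (gT rT : finGroupType) (K : {group gT}) (L : {group rT}) :
  K \isog L -> PSL27_facts K -> PSL27_facts L.
Proof.
case/isogP=> f injf defL [cardK ordK [a [b [c [[Ka Kb Kc] [oa ob oc] oab oac]]]] [S [sSK cardS]]].
split.
- by rewrite -defL card_injm.
- move=> z; rewrite -defL => /morphimP[x _ Kx ->{z}]; rewrite -!morphX //; have := ordK x Kx.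
  by case/or4P=> /eqP->; rewrite morph1 eqxx ?orbT.
- exists (f a), (f b), (f c).
  by rewrite -defL !mem_morphim // -!morphM // !order_injm ?groupM.
exists (f @* S)%G; rewrite -defL; split; first by apply: morphimS.
by rewrite card_injm.
Qed.

(** * Sylow subgroups, simplicity and Hall subgroups of [PSL(2,7)] *)

Section Facts.

Variables (gT : finGroupType) (K : {group gT}).
Hypothesis factsK : PSL27_facts K.
Implicit Types P H S : {group gT}.

Lemma card_K : #|K| = 168. Proof. by case: factsK. Qed.

Lemma dvdn_K p : prime p -> (p %| #|K|) = (p \in [:: 2; 3; 7]).
Proof.
move=> pr_p; rewrite card_K -[168]/(2 ^ 3 * 3 * 7)%N !Euclid_dvdM //.
by rewrite !dvdn_prime2 // !inE; do 3!case: (p == _).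
Qed.

Lemma K_nadj p q : prime p -> prime q -> p %| #|K| -> q %| #|K| -> p != q -> ~~ adj K p q.
Proof.
move=> pr_p pr_q; rewrite !dvdn_K // => Kp Kq neq_pq.
apply/exists_inP=> -[x Kx /eqP ox]; case: factsK => _ /(_ x Kx) + _ _.
rewrite -!order_dvdn ox.
by move: Kp Kq neq_pq; rewrite !inE => /or3P[]/eqP-> /or3P[]/eqP->.
Qed.

Let K2 : 2 %| #|K|. Proof. by rewrite card_K. Qed.
Let K3 : 3 %| #|K|. Proof. by rewrite card_K. Qed.
Let K7 : 7 %| #|K|. Proof. by rewrite card_K. Qed.

Lemma K_klein : exists E : {group gT}, [/\ E \subset K, abelian E, 2.-group E & ~~ cyclic E].
Proof.
case: factsK => _ _ [a [b [_ [[Ka Kb _] [oa ob _] oab _]]]] _.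
have va (x : gT) : #[x] = 2 -> x^-1 = x.
  by move=> ox; apply/eqP; rewrite eq_invg_mul -expg2 -order_dvdn ox.
have cab : commute a b by rewrite /commute -{1}(va _ oab) invMg (va _ ob) (va _ oa).
have sAB : <[b]> \subset 'C(<[a]>) by rewrite cycle_subG /= cent_cycle; apply/cent1P.
have tiAB : <[a]> :&: <[b]> = 1.
  apply: prime_TIg; rewrite -?orderE ?oa // cycle_subG; apply/negP.
  rewrite /= cycle2g // !inE => /orP[/eqP a1 | /eqP ab]; first by rewrite a1 order1 in oa.
  by move: oab; rewrite ab -expg2 -ob expg_order order1 ob.
have defE : <[a]> \x <[b]> = <[a]> <*> <[b]> by rewrite dprodEY.
exists (<[a]> <*> <[b]>)%G; split.
- by rewrite join_subG !cycle_subG Ka.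
- by rewrite -(dprodWY defE) (dprodWY defE) -(dprodW defE) abelianM !cycle_abelian.
- by rewrite -(dprodW defE) pgroupM /pgroup -!orderE oa ob.
by rewrite (cyclic_dprod defE) ?cycle_cyclic // -!orderE oa ob.
Qed.

(** The number of Sylow 7-subgroups divides 24 and is 1 modulo 7. It is not 1, since a Klein
    four-group acting on a normal [P] would produce an element of order 14. *)
Lemma card_norm_Sylow7 P : 7.-Sylow(K) P -> #|'N_K(P)| = 21.
Proof.
move=> sylP; have sPK := pHall_sub sylP.
have oP : #|P| = 7 by rewrite (card_Hall sylP) card_K p_part.
have sPN : P \subset 'N_K(P) by rewrite subsetI sPK normG.
have := card_Syl_mod K (isT : prime 7); rewrite (card_Syl sylP).
have := Lagrange (subsetIl K 'N(P)); have := Lagrange sPN.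
rewrite oP card_K; set m := #|_ : P|; set n := #|_ : _| => <- mn168 n7.
have n24 : n %| 24 by apply/dvdnP; exists m; apply/eqP; rewrite -(eqn_pmul2l (isT : 0 < 7)) mulnA mn168.
have : n \in [:: 1; 8]%N.
  have chk k : k < 25 -> k %| 24 -> k %% 7 = 1%N -> k \in [:: 1; 8]%N.
    by do 25! [case: k => [|k] //].
  by apply: (chk n _ n24 n7); rewrite ltnS dvdn_leq.
rewrite !inE => /orP[] /eqP n_val; last first.
  by apply/eqP; rewrite -(eqn_pmul2r (isT : 0 < 8)) -{1}n_val mn168.
have nPK : K \subset 'N(P).
  by have: #|K : 'N_K(P)| == 1%N by [apply/eqP]; rewrite indexg_eq1 subsetI subxx.
have [E [sEK abE E2 ncE]] := K_klein.
have /negP[] := @K_nadj 2 7 isT isT K2 K7 isT.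
apply: (adj_noncyclic _ _ _ sEK sPK (subset_trans sEK nPK) abE E2 ncE (pHall_pgroup sylP)) => //.
by apply: contra_eq_neq oP => ->; rewrite cards1.
Qed.

(** If 7 divides [#|H|], the Frattini argument makes the index of [H] odd, so [H] contains [a] and
    [c], and 3 divides its order; but a proper [H] would have order 56. Otherwise elements of order
    7 act on [H] without fixed points, so [#|H|] divides 24 and is 1 modulo 7; a normal subgroup of
    order 8 would again contain [a] and [c]. *)
Lemma K_simple : simple K.
Proof.
have [_ _ [a [_ [c [[Ka _ Kc] [oa _ oc] _ oac]]]] _] := factsK.
apply/simpleP; split=> [|H nsHK]; first by apply: contra_eq_neq card_K => ->; rewrite cards1.
have /andP[sHK nHK] := nsHK.
have notac : ~~ (3 %| #|H|) -> ~~ ((a \in H) && (c \in H)).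
  by apply: contra => /andP[Ha Hc]; rewrite -oac order_dvdG ?groupM.
have [H1 | ntH] := eqVneq (gval H) 1; [by left | right].
have [P sylP] := Sylow_exists 7 K; have sPK := pHall_sub sylP.
have oP : #|P| = 7 by rewrite (card_Hall sylP) card_K p_part.
have [H7 | H7'] := boolP (7 %| #|H|).
  have sPH : P \subset H.
    apply: contraLR H7 => nsPH; have ti : P :&: H = 1 by rewrite prime_TIg ?oP.
    have := card_Hall (Hall_setI_normal nsHK sylP); rewrite /= ti cards1.
    by move/esym/eqP; rewrite p_part_eq1 mem_primes cardG_gt0.
  have odd_idx : #|K / H| %| 21.
    have defQ : K / H = 'N_K(P) / H.
      by rewrite -[RHS]quotientMidl (Frattini_arg nsHK (pHall_subl sPH sHK sylP)).
    by rewrite defQ -(card_norm_Sylow7 sylP) dvdn_quotient.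
  have memH x : x \in K -> #[x] = 2 -> x \in H.
    move=> Kx ox; have Nx := subsetP nHK x Kx; apply: coset_idr => //; apply/eqP.
    rewrite -order_eq1 -dvdn1 -[1%N]/(gcdn 2 21) dvdn_gcd -{1}ox morph_order //=.
    by apply: dvdn_trans odd_idx; rewrite order_dvdG // mem_quotient.
  apply/eqP; rewrite eqEsubset sHK /=; apply: contraT; rewrite -indexg_eq1 => idx1.
  have idx : #|K : H| %| 3.
    rewrite -[3]/(gcdn 24 21) dvdn_gcd -(card_quotient nHK) odd_idx andbT card_quotient //.
    have -> : 24 = #|K : P| by rewrite -divgS // card_K oP.
    exact: indexgS.
  have /eqP idx3 : #|K : H| == 3 by have /primeP[_ /(_ _ idx)] : prime 3 := isT; rewrite (negPf idx1).
  have oH : #|H| = 56 by apply/eqP; rewrite -(eqn_pmul2r (isT : 0 < 3)) -{1}idx3 Lagrange ?card_K.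
  by have /negP[] : ~~ ((a \in H) && (c \in H)); [apply: notac; rewrite oH | rewrite !memH].
have regP : semiregular H P.
  move=> x /setD1P[ntx Px]; apply/eqP; apply: contraT => /trivgPn[z /setIP[Hz /cent1P cxz] ntz].
  have ox : #[x] = 7 by apply: nt_prime_order => //; apply/eqP; rewrite -order_dvdn -oP order_dvdG.
  have [r pr_r rz] : exists2 r, prime r & r %| #[z] by exists (pdiv #[z]); rewrite ?pdiv_dvd ?pdiv_prime ?order_gt1.
  have rH : r %| #|H| by apply: dvdn_trans rz (order_dvdG Hz).
  have r7 : r != 7 by apply: contraNneq H7' => <-.
  have /negP[] := @K_nadj r 7 pr_r isT (dvdn_trans rH (cardSg sHK)) K7 r7.
  by apply: (adj_commute pr_r _ r7 (subsetP sHK z Hz) (subsetP sPK x Px)); rewrite ?ox.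
have := regular_norm_dvd_pred (subset_trans sPK nHK) regP; rewrite oP => H7.
have H24 : #|H| %| 24.
  by have := cardSg sHK; rewrite card_K -[168]/(7 * 24)%N Gauss_dvdr // coprime_sym prime_coprime.
have chk k : 0 < k < 25 -> k %| 24 -> 7 %| k.-1 -> k \in [:: 1; 8]%N.
  by do 25! [case: k => [|k] //].
have : #|H| \in [:: 1; 8]%N by apply: chk H7; rewrite // cardG_gt0 ltnS dvdn_leq.
rewrite !inE -trivg_card1 (negPf ntH) /= => /eqP oH.
have sylH : 2.-Sylow(K) H by rewrite pHallE sHK oH card_K p_part.
have memH x : x \in K -> #[x] = 2 -> x \in H.
  by move=> Kx ox; rewrite (mem_normal_Hall sylH) // /p_elt ox.
by have /negP[] : ~~ ((a \in H) && (c \in H)); [apply: notac; rewrite oH | rewrite !memH].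
Qed.

Let part168 : (168`_2^' = 21)%N.
Proof.
rewrite -[168]/(8 * 21)%N partnM // part_p'nat ?mul1n; last by rewrite pnatNK.
by rewrite part_pnat_id.
Qed.

(** By Sylow counting, a subgroup of order 21 normalises its Sylow 7-subgroup, so conjugacy reduces
    to that of Sylow subgroups. *)
Lemma K_hall_odd : hall_odd K.
Proof.
have [P sylP] := Sylow_exists 7 K; have sPK := pHall_sub sylP.
have oP : #|P| = 7 by rewrite (card_Hall sylP) card_K p_part.
have oN := card_norm_Sylow7 sylP.
exists 'N_K(P)%G; split.
- by rewrite pHallE subsetIl oN card_K part168.
- rewrite (series_sol (normalSG sPK)) (abelian_sol (cyclic_abelian _)); last by rewrite prime_cyclic ?oP.
  apply/abelian_sol/cyclic_abelian/prime_cyclic.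
  rewrite card_quotient ?subsetIr // -divgS ?oN ?oP //.
  by rewrite subsetI sPK normG.
move=> L hallL; have sLK := pHall_sub hallL.
have oL : #|L| = 21 by rewrite (card_Hall hallL) card_K part168.
have [Q sylQ] := Sylow_exists 7 L; have sQL := pHall_sub sylQ.
have oQ : #|Q| = 7 by rewrite (card_Hall sylQ) oL p_part.
have sylQK : 7.-Sylow(K) Q by rewrite pHallE (subset_trans sQL sLK) oQ card_K p_part.
have nQL : L \subset 'N(Q).
  have := card_Syl_mod L (isT : prime 7); rewrite (card_Syl sylQ) => modL.
  have : #|L : 'N_L(Q)| %| 21 by rewrite -oL dvdn_indexg.
  rewrite -[21]/(7 * 3)%N Gauss_dvdr; last first.
    by rewrite coprime_sym prime_coprime // /dvdn modL.
  have /primeP[_ p3] : prime 3 := isT.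
  case/p3/orP=> /eqP idx; last by rewrite idx in modL.
  by have: #|L : 'N_L(Q)| == 1%N by [apply/eqP]; rewrite indexg_eq1 subsetI subxx.
have [x Kx defQ] := Sylow_trans sylP sylQK.
exists x => //; apply/eqP; rewrite eqEcard cardJg oL oN leqnn andbT.
by rewrite /= conjIg conjGid // -normJ -defQ subsetI sLK.
Qed.

Lemma K_frobenius21 : exists u y, [/\ u \in K /\ y \in K, #[u] = 7, #[y] = 3, y \in 'N(<[u]>) & 'C_<[u]>[y] = 1].
Proof.
have [P sylP] := Sylow_exists 7 K; have sPK := pHall_sub sylP.
have oP : #|P| = 7 by rewrite (card_Hall sylP) card_K p_part.
have [|y /setIP[Ky nPy] oy] := @Cauchy _ 3 'N_K(P) isT.
  by rewrite card_norm_Sylow7.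
have [u defP] : exists u, P :=: <[u]>.
  by apply/cyclicP/prime_cyclic; rewrite oP.
have ou : #[u] = 7 by rewrite orderE -defP.
have Ku : u \in K by rewrite (subsetP sPK) // defP cycle_id.
exists u, y; split; rewrite -?defP //; apply/eqP.
apply: contraT => ntC; have /negP[] := @K_nadj 7 3 isT isT K7 K3 isT.
by apply: (adj_cent _ _ _ sPK (pHall_pgroup sylP) Ky _ ntC); rewrite ?oy.
Qed.

Lemma K_center1 : 'Z(K) = 1.
Proof.
have [_ minK] := simpleP _ K_simple.
case: (minK _ (center_normal K)) => // ZK.
have abK : abelian K by rewrite -ZK center_abelian.
have [x Kx ox] := Cauchy (isT : prime 2) K2; have [y Ky oy] := Cauchy (isT : prime 3) K3.
have /negP[] := @K_nadj 2 3 isT isT K2 K3 isT.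
by apply: (adj_commute (x := x) (y := y)); rewrite ?ox ?oy //; apply: (centsP abK).
Qed.

End Facts.

(** Two distinct simple normal subgroups of [M] of the same order meet trivially, hence commute. *)
Lemma simple_conj_cent (gT : finGroupType) (K M : {group gT}) (g : gT) : simple K -> K <| M -> g \in 'N(M) ->
  K :^ g = K \/ K :^ g \subset 'C(K).
Proof.
move=> simK nsKM nMg; have [/eqP-> | neqK] := boolP (K :^ g == K); [by left | right].
have [ntK minK] := simpleP _ simK.
have /andP[sKM nKM] := nsKM.
have nsKgM : K :^ g <| M by rewrite -(normP nMg) normalJ.
have /andP[sKgM nKgM] := nsKgM.
have ti : K :&: K :^ g = 1.
  have [|//|eqK] := minK (K :&: K :^ g)%G.
    by rewrite /normal subsetIl normsI ?normG // (subset_trans sKM).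
  case/negP: neqK; rewrite eq_sym eqEcard cardJg leqnn andbT.
  by apply/setIidPl.
rewrite centsC; apply/commG1P/trivgP; rewrite -ti commg_subI // subsetI subxx.
  exact: subset_trans nKgM.
exact: subset_trans nKM.
Qed.

(** * The solvable radical *)

Section Radical.

Variables (gT : finGroupType).
Implicit Types G H K L M N P : {group gT}.

Lemma radical_exists G : exists N : {group gT}, [/\ N <| G, solvable N &
  forall M : {group coset_of N}, M <| G / N -> solvable M -> M :=: 1].
Proof.
have [N /maxgroupP[/andP[solN nsNG] maxN] _] :
    {N : {group gT} | [max N | solvable N & N <| G] & 1%G \subset N}.
  by apply: maxgroup_exists; rewrite solvable1 normal1.
exists N; split=> // M nsMG solM; have [L defM sNL nsLG] := inv_quotientN nsNG nsMG.
have nsNL : N <| L := normalS sNL (normal_sub nsLG) nsNG.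
rewrite defM (maxN L) ?trivg_quotient // (series_sol nsNL) nsLG solN -defM solM.
by [].
Qed.

(** A simple direct factor [K] of a minimal normal subgroup of [G / N] is a composition factor of
    [G]. An abelian one would lie in a nontrivial solvable normal subgroup of [G / N], against the
    maximality of [N]. *)
Lemma good_simple_factor G : good G -> ~~ solvable G ->
  exists (N : {group gT}) (K : {group coset_of N}),
  [/\ N <| G, solvable N, K \subset G / N, PSL27_facts K &
      {in G / N, forall g, K :^ g = K \/ K :^ g \subset 'C(K)}].
Proof.
move=> goodG nsolG; have [N [nsNG solN radN]] := radical_exists G.
have ntGN : G / N != 1.
  apply: contra nsolG => /eqP GN1; rewrite (series_sol nsNG) solN /=.
  by rewrite GN1 solvable1.
have [M minM sMG] := minnormal_exists ntGN (normG _).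
have nsMG : M <| G / N by rewrite /normal sMG; have /mingroupp/andP[] := minM.
have ntM : M :!=: 1 by have /mingroupp/andP[] := minM.
have [K0 [sK0M simK0 [I sIA defM]]] := charsimple_dprod (minnormal_charsimple minM).
have nsolM : ~~ solvable M by apply: contra ntM => /(radN M nsMG)->.
have [f If] : exists f, f \in I.
  by apply/set0Pn; apply: contraNneq ntM => I0; rewrite -defM I0 big_set0.
have Af := subsetP sIA f If.
pose K := (autm Af @* K0)%G.
have defK : K :=: f @: K0.
  by rewrite /= morphimEsub //; apply: eq_imset => x; rewrite autmE.
have isoK : K0 \isog K by rewrite sub_isog ?injm_autm.
have simK : simple K by rewrite -(isog_simple isoK).
have nsKM : K <| M.
  by move: defM; rewrite (bigD1 f If) /= -defK => /dprod_normal2[].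
have sKM := normal_sub nsKM.
have [L defL sNL nsLG] := inv_quotientN nsNG nsMG.
have sKGN : K \subset L / N by rewrite -defL.
have [H defH sNH sHL] := inv_quotientS (normalS sNL (normal_sub nsLG) nsNG) sKGN.
exists N, K; split=> //.
- exact: subset_trans sKM sMG.
- have nsNH : N <| H := normalS sNH (subset_trans sHL (normal_sub nsLG)) nsNG.
  have maxN : maxnormal N H H by rewrite -quotient_simple // -defH.
  have nsHL : H <| L.
    by rewrite -(quotientGK nsNH) -(quotientGK (normalS sNL (normal_sub nsLG) nsNG)) -defH -defL cosetpre_normal.
  have snHG : H <|<| G := subnormal_trans (normal_subnormal nsHL) (normal_subnormal nsLG).
  have := goodG H N snHG maxN; rewrite -defH => -[abK | isoK27].
    have nilK := abelian_nil abK.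
    have sKF := Fitting_max nsKM nilK.
    have F1 : 'F(M) = 1.
      apply: radN; last exact/nilpotent_sol/Fitting_nil.
      exact: char_normal_trans (Fitting_char M) nsMG.
    have [ntK _] := simpleP _ simK; case/eqP: ntK.
    by apply/trivgP; rewrite -F1.
  by apply: PSL27_facts_isog PSL27_factsP; rewrite isog_sym.
move=> g Gg; have nMg := subsetP (normal_norm nsMG) g Gg.
exact: (simple_conj_cent simK nsKM nMg).
Qed.

(** Either [x] normalises [K], and coprime action yields an invariant Sylow [r]-subgroup, or the
    conjugates of [K] under [<[x]>] commute with one another, and so do those of an element of order
    [r]. In both cases [x] has a fixed point. *)
Lemma adj_simple_factor G K p r (x : gT) : PSL27_facts K -> prime p -> prime r ->
    K \subset G -> x \in G -> #[x] = p -> r %| #|K| -> ~~ (p %| #|K|) ->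
    {in G, forall g, K :^ g = K \/ K :^ g \subset 'C(K)} -> adj G r p.
Proof.
move=> factsK pr_p pr_r sKG Gx ox rK p'K dichK.
have neq_rp : r != p by apply: contraNneq p'K => <-.
have coKp : coprime #|K| p by rewrite coprime_sym prime_coprime.
case: (dichK x Gx) => [nKx | cKx].
  have nKX : <[x]> \subset 'N(K) by rewrite cycle_subG; apply/normP.
  have [R sylR nRX] : exists2 R : {group gT}, r.-Sylow(K) R & <[x]> \subset 'N(R).
    apply: sol_coprime_Sylow_exists nKX _; first exact/abelian_sol/cycle_abelian.
    by rewrite -orderE ox.
  have sRG := subset_trans (pHall_sub sylR) sKG; have rR := pHall_pgroup sylR.
  have ox' : p %| #[x] by rewrite ox.
  apply: (adj_cent pr_r pr_p neq_rp sRG rR Gx ox').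
  apply: contraNneq p'K => regR.
  have pX : p.-group <[x]> by rewrite /pgroup -orderE ox pnat_id.
  have := pgroup_fix_mod pX (_ : [acts <[x]>, on R | 'J]).
  rewrite afixJ cent_cycle regR cards1 astabsJ => /(_ nRX)/eqP.
  (* Without fixed points [p] would divide [#|R| - 1], which is 7, 2 or 6 for [r] equal to 2, 3 or
     7, and hence would divide 168. *)
  rewrite eqn_mod_dvd ?cardG_gt0 // (card_Hall sylR) (card_K factsK) p_part => R1.
  have: r \in [:: 2; 3; 7] by rewrite -(dvdn_K factsK).
  rewrite -(card_K factsK) (dvdn_K factsK) // !inE => /or3P[] /eqP r_val; move: R1; rewrite r_val.
  - by rewrite (_ : 2 ^ _ - 1 = 7)%N // dvdn_prime2 // => ->; rewrite !orbT.
  - by rewrite (_ : 3 ^ _ - 1 = 2)%N // dvdn_prime2 // => ->.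
  rewrite (_ : 7 ^ _ - 1 = 2 * 3)%N // Euclid_dvdM // !dvdn_prime2 // => /orP[] -> //.
  by rewrite orbT.
have simK := K_simple factsK.
have [t Kt ot] := Cauchy pr_r rK.
have cKX c : c \in <[x]> -> c != 1 -> K :^ c \subset 'C(K).
  move=> Xc ntc; have Gc : c \in G by apply: subsetP Xc; rewrite cycle_subG.
  case: (dichK c Gc) => // nKc.
  have : <[c]> \subset 'N(K) by rewrite cycle_subG; apply/normP.
  suff -> : <[c]> = <[x]> by rewrite cycle_subG nKc => /normP eqKx; rewrite -{1}eqKx.
  have oc : #[c] = p.
    by apply: nt_prime_order => //; apply/eqP; rewrite -order_dvdn -ox order_dvdG.
  by apply/eqP; rewrite eqEcard cycle_subG Xc -!orderE ox oc leqnn.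
pose B := t ^: <[x]>; pose A := <<B>>%G.
have Xx := cycle_id x.
have BA a : a \in <[x]> -> t ^ a \in A by move=> Xa; rewrite mem_gen ?memJ_class.
have abA : abelian A.
  rewrite abelian_gen; apply/centsP=> _ /imsetP[a Xa ->] _ /imsetP[b Xb ->].
  have [-> // | neq_ab] := eqVneq a b.
  have ntc : b * a^-1 != 1 by rewrite -eq_mulgV1 eq_sym.
  have Xc : b * a^-1 \in <[x]> by rewrite groupM ?groupV.
  have := subsetP (cKX _ Xc ntc) (t ^ (b * a^-1)).
  rewrite memJ_conjg => /(_ Kt)/centP/(_ t Kt)/(congr1 (fun z => z ^ a)).
  by rewrite /= (conjMg _ t) (conjMg t) conjgM conjgKV => /esym.
have rA : r.-group A.
  suff -> : A = 'O_r(A)%G by apply: pcore_pgroup.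
  apply/eqP; rewrite -val_eqE eqEsubset pcore_sub andbT gen_subG.
  apply/subsetP=> _ /imsetP[a Xa ->].
  rewrite (mem_normal_Hall (nilpotent_pcore_Hall r (abelian_nil abA)) (pcore_normal _ _)) ?BA //.
  by rewrite /p_elt orderJ ot pnat_id.
have sAG : A \subset G.
  rewrite gen_subG; apply/subsetP=> _ /imsetP[a Xa ->].
  have sXG : <[x]> \subset G by rewrite cycle_subG.
  by rewrite groupJ ?(subsetP sKG t) ?(subsetP sXG a).
have nAx : x \in 'N(A) by apply: (subsetP (norms_gen (class_norm t <[x]>))).
have At : t \in A by rewrite -(conjg1 t) BA.
have ox' : p %| #[x] by rewrite ox.
apply: (adj_cent pr_r pr_p neq_rp sAG rA Gx ox'); apply: contraTneq isT => regA.
have p_gt0 := prime_gt0 pr_p.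
have xp1 : x ^+ p = 1 by rewrite -ox expg_order.
(* If [x] fixed nothing, the product of the conjugates of [t] would be 1, so [t] would be a product
   of elements centralising [K], and central in [K]. *)
have := sum_regular (fmod abA t) p_gt0 nAx xp1 regA.
rewrite (bigD1 (Ordinal p_gt0)) //= => /eqP; rewrite addr_eq0 expg0 actr1 -GRing.sumrN => /eqP eq_t.
have : t \in 'Z(K).
  rewrite inE Kt -(fmodK abA At) eq_t.
  elim/big_ind: _ => [|u v cu cv|i nz_i]; first by rewrite fmval0 group1.
    by rewrite fmvalA groupM.
  rewrite fmvalN groupV fmvalJ ?groupX //= fmodK //.
  apply: (subsetP (cKX (x ^+ i) _ _)); rewrite ?mem_cycle ?memJ_conjg //.
  by rewrite -order_dvdn ox gtnNdvd // lt0n.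
by rewrite (K_center1 factsK) inE -order_eq1 ot => /eqP r1; rewrite r1 in pr_r.
Qed.

End Radical.

(** By the Frattini argument ['N_G(P)] covers [G / N]; the part of it above [X] splits over its
    intersection with [N] by the Schur-Zassenhaus theorem. *)
Lemma Sylow_norm_lift (gT : finGroupType) (G N P : {group gT}) (X : {group coset_of N}) p :
    N <| G -> p.-Sylow(N) P -> X \subset G / N -> coprime #|N| #|X| ->
  exists T : {group gT}, [/\ T \subset 'N_G(P), N :&: T = 1 & T / N = X].
Proof.
move=> nsNG sylP sXGN coNX; have /andP[sNG nNG] := nsNG.
have defG := Frattini_arg nsNG sylP.
have [H defX sNH sHG] := inv_quotientS nsNG sXGN.
pose E := (H :&: 'N_G(P))%G.
have sEG : E \subset G by rewrite subIset // sHG.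
have nNE : E \subset 'N(N) := subset_trans sEG nNG.
have defEX : E / N = X.
  rewrite defX -quotientMidl /= setIC group_modl // defG.
  by rewrite (setIidPr sHG).
have nsNE : N :&: E <| E by rewrite /normal subsetIr normsI ?normG.
have hallNE : Hall E (N :&: E).
  rewrite /Hall subsetIr -card_quotient ?normal_norm //.
  have -> : #|E / (N :&: E)| = #|X| by rewrite (card_isog (second_isog nNE)) -defEX.
  by apply: coprime_dvdl coNX; apply: cardSg (subsetIl _ _).
have /splitsP[T /complP[tiT defE]] := SchurZassenhaus_split hallNE nsNE.
have sTE : T \subset E by rewrite -defE mulG_subr.
exists T; split.
- by apply: subset_trans sTE _; rewrite subsetIr.
- by rewrite -(setIidPr sTE) setIA.
have nNT := subset_trans sTE nNE.
rewrite -defEX -defE quotientMr //.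
by rewrite (quotientS1 (subsetIl N E)) mul1g.
Qed.

(** The lift of [E] normalising a Sylow [p]-subgroup of [N] is still noncyclic, so it cannot act
    there without fixed points. *)
Lemma adj_klein_lift (gT : finGroupType) (G N : {group gT}) (E : {group coset_of N}) p :
    N <| G -> odd #|N| -> prime p -> p != 2 -> p %| #|N| -> E \subset G / N ->
    abelian E -> 2.-group E -> ~~ cyclic E -> adj G 2 p.
Proof.
move=> nsNG oddN pr_p p_odd Np sEG abE E2 ncE.
have [P sylP] := Sylow_exists p N.
have coNE : coprime #|N| #|E|.
  by rewrite coprime_sym (pnat_coprime E2) // /pgroup -odd_2'nat.
have [T [sTL tiNT defT]] := Sylow_norm_lift nsNG sylP sEG coNE.
have nNT : T \subset 'N(N).
  by apply: subset_trans (normal_norm nsNG); apply: subset_trans sTL (subsetIl _ _).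
have isoT : T \isog E by rewrite -defT quotient_isog.
have sTG : T \subset G := subset_trans sTL (subsetIl _ _).
have nPT : T \subset 'N(P) := subset_trans sTL (subsetIr _ _).
apply: (adj_noncyclic _ pr_p _ sTG _ nPT _ _ _ (pHall_pgroup sylP)) => //.
- by rewrite eq_sym.
- exact: subset_trans (pHall_sub sylP) (normal_sub nsNG).
- by rewrite (isog_abelian isoT).
- by rewrite /pgroup (card_isog isoT).
- by rewrite (isog_cyclic isoT).
apply: contraTneq Np => P1; have := card_Hall sylP; rewrite P1 cards1 => /esym/eqP.
by rewrite p_part_eq1 mem_primes pr_p cardG_gt0.
Qed.

(** * Action of the Frobenius group of order 21 on the radical *)

Section SevenThree.

Variables (gT : finGroupType) (G N P : {group gT}) (K : {group coset_of N}) (p : nat).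
Hypotheses (nsNG : N <| G) (sylP : p.-Sylow(N) P) (sKG : K \subset G / N).
Hypotheses (factsK : PSL27_facts K) (pr_p : prime p) (Np : p %| #|N|) (coN : coprime #|N| 168).
Hypothesis nadj73 : ~~ adj G 7 3.

Let sNG := normal_sub nsNG.
Let nNG := normal_norm nsNG.
Let sPN := pHall_sub sylP.
Let pP := pHall_pgroup sylP.

Let p7 : p != 7.
Proof. by apply: contraTneq (coprime_dvdl Np coN) => ->. Qed.
Let p3 : p != 3.
Proof. by apply: contraTneq (coprime_dvdl Np coN) => ->. Qed.
Let sPG : P \subset G := subset_trans sPN sNG.
Let ntP : P :!=: 1.
Proof.
apply: contraTneq Np => P1; have := card_Hall sylP; rewrite P1 cards1 => /esym/eqP.
by rewrite p_part_eq1 mem_primes pr_p cardG_gt0.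
Qed.

(** The relations of [7 : 3] survive in the lift because it meets [N] trivially. *)
Let lift : exists u y, [/\ u \in 'N_G(P) /\ y \in 'N_G(P), #[u] = 7 /\ #[y] = 3,
   y \in 'N(<[u]>), coset N u \in K & coset N y \in K].
Proof.
have [u0 [y0 [[Ku0 Ky0] ou0 oy0 nuy0 regu0]]] := K_frobenius21 factsK.
pose X := (<[u0]> <*> <[y0]>)%G.
have sXK : X \subset K by rewrite join_subG !cycle_subG Ku0.
have coX : coprime #|N| #|X|.
  by apply: coprime_dvdr coN; rewrite -(card_K factsK) cardSg.
have [T [sTL tiNT defT]] := Sylow_norm_lift nsNG sylP (subset_trans sXK sKG) coX.
have sTG : T \subset G := subset_trans sTL (subsetIl _ _).
have nNT := subset_trans sTG nNG.
have inj1 a : a \in T -> coset N a = 1 -> a = 1.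
  move=> Ta /(coset_idr (subsetP nNT a Ta)) Na.
  by apply/set1P; rewrite -[[set 1]]tiNT inE Na.
have Xu0 : u0 \in X by rewrite mem_gen // inE cycle_id.
have Xy0 : y0 \in X by rewrite mem_gen // inE cycle_id orbT.
have /morphimP[u Nu Tu def_u] : u0 \in T / N by rewrite defT.
have /morphimP[y Ny Ty def_y] : y0 \in T / N by rewrite defT.
have ord z z0 r : prime r -> z \in 'N(N) -> z \in T -> z0 = coset N z -> #[z0] = r -> #[z] = r.
  move=> pr_r Nz Tz def_z oz0; apply: nt_prime_order => //.
    by rewrite def_z in oz0; apply: inj1; rewrite ?groupX // morphX // -[r]oz0 expg_order.
  by apply: contraTneq pr_r => z1; rewrite -oz0 def_z z1 morph1 order1.
exists u, y; rewrite -def_u -def_y; split; rewrite ?(subsetP sTL) //.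
  by split; [apply: ord def_u ou0 | apply: ord def_y oy0].
rewrite inE -cycleJ cycle_subG.
have : u0 ^ y0 \in <[u0]> by rewrite memJ_norm ?cycle_id.
case/cycleP=> k uy; apply/cycleP; exists k; apply/eqP; rewrite eq_mulgV1; apply/eqP.
apply: inj1; first by rewrite groupM ?groupV ?groupJ ?groupX.
by rewrite morphM ?groupV ?groupJ ?groupX // morphV ?groupX // morphJ // morphX // -def_u -def_y uy mulgV.
Qed.

(** If [y] has no fixed point on ['Z(P)], it has none on [<[u]>] either, because 7 and 3 are not
    adjacent, so [u] centralises ['Z(P)]. The centraliser of ['Z(P)] in ['N_G(P)] then has a normal
    image in [G / N] that meets the simple group [K] nontrivially, hence contains it, and this
    provides an element of order 3 centralising ['Z(P)]. *)
Lemma adj3_radical : adj G 3 p.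
Proof.
have [u [y [[Lu Ly] [ou oy] nuy Ku Ky]]] := lift.
have [[Gu nPu] [Gy nPy]] := (setIP Lu, setIP Ly).
have sZG : 'Z(P) \subset G := subset_trans (center_sub P) sPG.
have pZ : p.-group 'Z(P) := pgroupS (center_sub P) pP.
have ntZ : 'Z(P) != 1 by rewrite (center_nil_eq1 (pgroup_nil pP)).
have nZL : 'N(P) \subset 'N('Z(P)) := char_norm_trans (center_char P) (subxx _).
have u7 : 7.-group <[u]> by rewrite /pgroup -orderE ou.
have regu : 'C_<[u]>[y] = 1.
  apply/eqP; apply: contraNT nadj73 => ntC.
  by apply: (adj_cent _ _ _ _ u7 Gy _ ntC); rewrite ?oy ?cycle_subG.
have [regZ | ntCZ] := eqVneq 'C_('Z(P))[y] 1; last first.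
  by rewrite adjC; apply: (adj_cent pr_p _ p3 sZG pZ Gy _ ntCZ); rewrite ?oy.
have co7 : coprime #|<[u]>| #|'Z(P)|.
  by rewrite -orderE ou coprime_sym (pnat_coprime pZ) // pnatE // !inE eq_sym.
have cuZ : <[u]> \subset 'C('Z(P)).
  apply: (regular_cent (center_abelian P) _ nuy _ _ co7 regu regZ); rewrite ?oy //.
    exact: (subsetP nZL).
  by rewrite cycle_subG (subsetP nZL).
pose C := 'C_('N_G(P))('Z(P))%G.
have nsCL : C <| 'N_G(P).
  rewrite /normal subsetIl normsI ?normG // norms_cent //.
  by rewrite subIset // nZL orbT.
have defGN : G / N = 'N_G(P) / N by rewrite -[RHS]quotientMidl (Frattini_arg nsNG sylP).
have nsCGN : C / N <| G / N by rewrite defGN quotient_normal.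
have Cu : coset N u \in C / N.
  by rewrite mem_quotient // inE Lu -cycle_subG.
have nsCK : (C / N) :&: K <| K.
  by rewrite /normal subsetIr normsI ?normG // (subset_trans sKG) ?normal_norm.
have [_ minK] := simpleP _ (K_simple factsK).
have ntu : coset N u != 1.
  apply: contraNneq p7 => /(coset_idr (subsetP nNG u Gu)) Nu.
  have := coprime_dvdl (order_dvdG Nu) coN; rewrite ou. by [].
have sKC : K \subset C / N.
  case: (minK _ nsCK) => [CK1 | <-]; last exact: subsetIl.
  case/eqP: ntu; apply/set1P; rewrite -[[set 1]]CK1 inE Cu Ku. by [].
have C3 : 3 %| #|C|.
  apply: dvdn_trans (_ : #|C / N| %| _); last exact: dvdn_quotient.
  by apply: dvdn_trans (cardSg sKC); rewrite (card_K factsK).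
have [c Cc oc] := Cauchy (isT : prime 3) C3.
have [/setIP[Gc _] cZc] := setIP Cc.
rewrite adjC; apply: (adj_cent pr_p _ p3 sZG pZ Gc); rewrite ?oc //.
by rewrite (setIidPl _) // sub_cent1.
Qed.

(** If [P] is cyclic, it is centralised by the commutator of [u] and [y], a nontrivial element of
    [<[u]>] as 7 and 3 are not adjacent; so 7 and [p] would be adjacent. *)
Lemma rank_radical : ~~ adj G 7 p -> 1 < 'r_p(P).
Proof.
move=> nadj; have [u [y [[Lu Ly] [ou oy] nuy Ku Ky]]] := lift.
have [[Gu nPu] [Gy nPy]] := (setIP Lu, setIP Ly).
have p_odd : odd #|P|.
  rewrite (odd_pgroup_odd _ pP) //; have [|//] := even_prime pr_p.
  by move=> p2; have := coprime_dvdl Np coN; rewrite p2.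
rewrite ltnNge -(odd_pgroup_rank1_cyclic pP p_odd); apply: contra nadj => cycP.
have nPX : <[u]> <*> <[y]> \subset 'N(P) by rewrite join_subG !cycle_subG nPu.
have cXP := der1_cent_cyclic cycP nPX.
have uy_u : [~ u, y] \in <[u]> by rewrite commgEl groupM ?groupV ?memJ_norm ?cycle_id.
have nt_uy : [~ u, y] != 1.
  apply: contraNneq nadj73 => /eqP/commgP cuy.
  by apply: (adj_commute (x := u) (y := y)); rewrite ?ou ?oy.
have G_uy : [~ u, y] \in G by rewrite groupR.
rewrite adjC; apply: (adj_cent pr_p _ p7 sPG pP G_uy) => //.
  have u7 : 7.-group <[u]> by rewrite /pgroup -orderE ou.
  by rewrite -(pdiv_p_elt (mem_p_elt u7 uy_u) nt_uy) pdiv_dvd.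
rewrite (setIidPl _) // sub_cent1 (subsetP cXP) // mem_commg // mem_gen // inE cycle_id ?orbT //.
Qed.

End SevenThree.

(** * Prime graphs of pseudo PSL(2,7)-solvable groups *)

Section PrimeGraph.

Variable gT : finGroupType.
Implicit Types (G H N P : {group gT}) (p q r : nat).

(** The complement of the prime graph on plain numbers: membership in [primes #|G|] replaces the
    vertex type. *)
Definition nadj G p q := [&& p \in primes #|G|, q \in primes #|G|, p != q & ~~ adj G p q].

Definition nadj3 G p q r := [&& nadj G p q, nadj G q r & nadj G p r].

Definition proper_col G (col : nat -> 'I_3) := forall p q, nadj G p q -> col p != col q.

Lemma nadjC G p q : nadj G p q = nadj G q p.
Proof. by rewrite /nadj adjC eq_sym andbCA. Qed.

Lemma nadj_sub G H p q : H \subset G -> nadj G p q ->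
  p %| #|H| -> q %| #|H| -> nadj H p q.
Proof.
move=> sHG /and4P[]; rewrite /nadj !mem_primes !cardG_gt0 /= => /andP[-> _] /andP[-> _] -> nGpq -> ->.
by apply: contra nGpq => /(adjS sHG).
Qed.

Lemma solvable_nadj3 G p q r : solvable G -> ~~ nadj3 G p q r.
Proof.
move=> solG; apply/negP=> /and3P[].
rewrite /nadj !mem_primes !cardG_gt0 /=.
case/and4P=> /andP[pr_p Gp] /andP[pr_q Gq] neq_pq npq.
case/and4P=> _ /andP[pr_r Gr] neq_qr nqr /and4P[_ _ neq_pr npr].
have := solvable_adj3 pr_p pr_q pr_r neq_pq neq_pr neq_qr solG Gp Gq Gr.
by rewrite (negPf npq) (negPf nqr) (negPf npr).
Qed.

Lemma solvable_proper_col G : solvable G -> exists col,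
  (forall p, 1 < 'r_p(G) -> col p = ord0) /\ proper_col G col.
Proof.
move=> solG; have [col [col0 colP]] := solvable_coloring solG.
exists col; split=> // p q; rewrite /nadj !mem_primes !cardG_gt0 /=.
by case/and4P=> /andP[pr_p Gp] /andP[pr_q Gq] neq_pq npq; apply: colP.
Qed.

Definition sparse G := (forall p q r, ~~ nadj3 G p q r) /\ exists col, proper_col G col.

(** The vertices [a], [b], [c] are 2, 3, 7, and the common colour of the other neighbours of 7 is
    normalised to [ord0], the colour of the primes of rank at least two. *)
Definition one_triangle G := [/\ nadj3 G 2 3 7,
  (forall p q r, nadj3 G p q r -> [/\ p \in [:: 2; 3; 7], q \in [:: 2; 3; 7] & r \in [:: 2; 3; 7]]),
  (forall p, p \notin [:: 2; 3; 7] -> ~~ nadj G 2 p /\ ~~ nadj G 3 p) &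
  exists2 col, proper_col G col & forall p, p \notin [:: 2; 3; 7] -> nadj G 7 p -> col p = ord0].

Lemma sparse_solvable_sub G H : H \subset G -> solvable H ->
  {subset primes #|G| <= primes #|H|} -> sparse G.
Proof.
move=> sHG solH sGH.
have sub p q : nadj G p q -> nadj H p q.
  move=> n; apply: (nadj_sub sHG n); case/and4P: n => /sGH + /sGH + _ _;
  by rewrite !mem_primes => /and3P[? ? ?] /and3P[].
split=> [p q r |].
  apply: contra (solvable_nadj3 p q r solH) => /and3P[/sub npq /sub nqr /sub npr].
  exact/and3P.
by have [col [_ colP]] := solvable_proper_col solH; exists col => p q /sub/colP.
Qed.

Lemma third_colour (i j : 'I_3) : exists k : 'I_3, (k != i) && (k != j).
Proof.
have : 0 < #|~: [set i; j]| by rewrite cardsCs setCK card_ord subn_gt0 (leq_ltn_trans (leq_card_setU _ _)) // !cards1.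
by case/card_gt0P=> k; rewrite !inE negb_or; exists k.
Qed.

Lemma good_prime_graph G : good G -> sparse G \/ one_triangle G.
Proof.
move=> goodG; have [solG | nsolG] := boolP (solvable G).
  by left; apply: sparse_solvable_sub (subxx G) solG _.
have [N [K [nsNG solN sKGN factsK dichK]]] := good_simple_factor goodG nsolG.
have /andP[sNG nNG] := nsNG.
have [H0 [hallH0 solH0 _]] := hall_odd_good (K_hall_odd PSL27_factsP) goodG.
have sH0G := pHall_sub hallH0.
pose H := (H0 <*> N)%G.
have sHG : H \subset G by rewrite join_subG sH0G.
have nNH0 := subset_trans sH0G nNG.
have sNH : N \subset H by apply: joing_subr.
have solH : solvable H.
  rewrite (series_sol (normalS sNH sHG nsNG)) solN /= norm_joinEl //.
  by rewrite quotientMidr quotient_sol.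
have oddH p : p \in primes #|G| -> p != 2 -> p %| #|H|.
  rewrite mem_primes => /and3P[pr_p _ Gp] p_odd.
  by apply: dvdn_trans (cardSg (joing_subl _ _)); apply: (dvdn_Hall hallH0).
have [N2 | oddN] := boolP (2 %| #|N|).
  left; apply: (sparse_solvable_sub sHG solH) => p Gp.
  have pr_p : prime p by move: Gp; rewrite mem_primes => /and3P[].
  rewrite mem_primes pr_p cardG_gt0 /=; have [-> | ] := eqVneq p 2; last exact: oddH.
  by apply: dvdn_trans N2 (cardSg sNH).
have oddN' : odd #|N| by move: oddN; rewrite dvdn2 negbK.
have [E [sEK abE E2 ncE]] := K_klein factsK.
have adj2N p : prime p -> p %| #|N| -> adj G 2 p.
  move=> pr_p Np; have p_odd : p != 2 by apply: contraNneq oddN => <-.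
  exact: (adj_klein_lift nsNG oddN' pr_p p_odd Np (subset_trans sEK sKGN) abE E2 ncE).
have adjQ p r : p \in primes #|G| -> p \notin [:: 2; 3; 7] -> ~~ (p %| #|N|) -> r \in [:: 2; 3; 7] -> adj G r p.
  rewrite mem_primes => /and3P[pr_p _ Gp] p237 Np r237.
  have pr_r : prime r by move: r237; rewrite !inE => /or3P[]/eqP->.
  apply: (adj_quo nsNG).
  have GNp : p %| #|G / N|.
    by rewrite card_quotient //; move: Gp; rewrite -(Lagrange sNG) Euclid_dvdM // (negPf Np).
  have [x GNx ox] := Cauchy pr_p GNp.
  by apply: (adj_simple_factor factsK pr_p pr_r sKGN GNx ox) => //; rewrite (dvdn_K factsK).
have nadj2 p : nadj G 2 p -> p \in [:: 3; 7].
  case/and4P=> _ Gp p_odd; apply: contraR => p37.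
  have p237 : p \notin [:: 2; 3; 7] by rewrite inE negb_or eq_sym p_odd.
  have [Np | Np] := boolP (p %| #|N|); last exact: adjQ.
  by apply: adj2N Np; move: Gp; rewrite mem_primes => /and3P[].
have [col [col0 colP]] := solvable_proper_col solH.
(* The order of [H] is odd, so its colouring says nothing about 2; since 2 can only be nonadjacent
   to 3 and 7, a colour is left for it. *)
have [k /andP[k3 k7]] := third_colour (col 3) (col 7).
pose col' p := if p == 2 then k else col p.
have subH p q : p != 2 -> q != 2 -> nadj G p q -> nadj H p q.
  by move=> p2 q2 npq; have /and4P[? ? _ _] := npq; apply: (nadj_sub sHG npq); apply: oddH.
have col'P : proper_col G col'.
  have col2 q : nadj G 2 q -> k != col q.
    by move/nadj2; rewrite !inE => /orP[] /eqP->.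
  move=> p q npq; have /and4P[_ _ neq_pq _] := npq; rewrite /col'.
  case: (eqVneq p 2) => [p2 | p2]; case: (eqVneq q 2) => [q2 | q2].
  - by rewrite p2 q2 in neq_pq.
  - by apply: col2; rewrite -p2.
  - by rewrite eq_sym; apply: col2; rewrite -q2 nadjC.
  by apply: colP; apply: subH.
have tri2 q r : nadj3 G 2 q r -> (q \in [:: 2; 3; 7]) && (r \in [:: 2; 3; 7]).
  by case/and3P=> /nadj2 + _ /nadj2; rewrite !inE => -> ->; rewrite !orbT.
have tri p q r : nadj3 G p q r -> [/\ p \in [:: 2; 3; 7], q \in [:: 2; 3; 7] & r \in [:: 2; 3; 7]].
  move=> t; have /and3P[npq nqr npr] := t.
  have [p2 | p2] := eqVneq p 2; first by rewrite p2 in t *; have /andP[-> ->] := tri2 _ _ t.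
  have [q2 | q2] := eqVneq q 2.
    have /andP[-> ->] : (p \in [:: 2; 3; 7]) && (r \in [:: 2; 3; 7]); last by rewrite q2.
    by apply: tri2; rewrite /nadj3 -q2 nadjC npq npr nqr.
  have [r2 | r2] := eqVneq r 2.
    have /andP[-> ->] : (p \in [:: 2; 3; 7]) && (q \in [:: 2; 3; 7]); last by rewrite r2.
    by apply: tri2; rewrite /nadj3 -r2 nadjC npr npq nadjC nqr.
  by case/negP: (solvable_nadj3 p q r solH); apply/and3P; split; apply: subH.
have [t237 | nt237] := boolP (nadj3 G 2 3 7); last first.
  left; split=> [p q r |]; last by exists col'.
  apply: contra nt237 => t; have [+ + +] := tri p q r t; have /and3P[npq nqr npr] := t.
  have /and4P[_ _ neq_pq _] := npq; have /and4P[_ _ neq_qr _] := nqr.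
  have /and4P[_ _ neq_pr _] := npr.
  rewrite !inE => /or3P[] /eqP p_ /or3P[] /eqP q_ /or3P[] /eqP r_;
    move: neq_pq neq_qr neq_pr npq nqr npr; rewrite p_ q_ r_ // /nadj3 => _ _ _;
    rewrite ?[nadj G 3 2]nadjC ?[nadj G 7 2]nadjC ?[nadj G 7 3]nadjC => -> -> -> //.
right; have /and3P[n23 n37 n27] := t237.
have N'r r : prime r -> r \in [:: 3; 7] -> ~~ (r %| #|N|).
  move=> pr_r r37; apply/negP=> /(adj2N r pr_r) a; move: r37 a; rewrite !inE => /orP[]/eqP-> a.
    by move: n23; rewrite /nadj a !andbF.
  by move: n27; rewrite /nadj a !andbF.
have coN : coprime #|N| 168.
  have co r : prime r -> ~~ (r %| #|N|) -> coprime #|N| r.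
    by move=> pr_r N'r'; rewrite coprime_sym prime_coprime.
  have -> : 168 = (2 * (2 * (2 * (3 * 7))))%N by [].
  by rewrite !coprimeMr (co 2) ?(co 3) ?(co 7) ?(N'r 3) ?(N'r 7).
have nadj73 : ~~ adj G 7 3 by rewrite adjC; case/and4P: n37.
split=> // [p p237 |].
  split; apply/negP=> n.
    by have := nadj2 p n; move: p237; rewrite !inE negb_or => /andP[_ /negPf->].
  have /and4P[_ Gp _ /negP[]] := n.
  have pr_p : prime p by move: Gp; rewrite mem_primes => /and3P[].
  have [Np | Np] := boolP (p %| #|N|); last by apply: adjQ.
  have [P sylP] := Sylow_exists p N.
  exact: (adj3_radical nsNG sylP sKGN factsK pr_p Np coN nadj73).
exists col' => // p p237 n.
have /and4P[_ Gp _ n7p] := n.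
have pr_p : prime p by move: Gp; rewrite mem_primes => /and3P[].
have p2 : p != 2 by apply: contraNneq p237 => ->.
rewrite /col' (negPf p2); apply: col0.
have [Np | Np] := boolP (p %| #|N|); last by case/negP: n7p; apply: adjQ.
have [P sylP] := Sylow_exists p N.
apply: leq_trans (p_rankS p (subset_trans (pHall_sub sylP) sNH)).
exact: (rank_radical nsNG sylP sKGN factsK pr_p Np coN nadj73 n7p).
Qed.

End PrimeGraph.

Lemma simple_solvable_abelian (gT : finGroupType) (G : {group gT}) :
  simple G -> solvable G -> abelian G.
Proof.
case/simpleP=> ntG minG solG; apply/derG1P.
case: (minG G^`(1)%G (der_normal 1 G)) => // G'G.
by have := sol_der1_proper solG (subxx G) ntG; rewrite /= G'G properxx.
Qed.

Lemma good_simple (gT : finGroupType) (G : {group gT}) : simple G -> G \isog PSL27 -> good G.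
Proof.
move=> simG isoG H M snHG maxM; right.
have [ntG minG] := simpleP _ simG.
have ntH : H :!=: 1.
  by apply: contraTneq (maxnormal_proper maxM) => ->; rewrite /proper sub1G andbF.
have defH : H :=: G.
  have [// | [K [snHK nsKG prKG]]] := subnormalEr snHG.
  case: (minG K nsKG) => KE; last by rewrite KE properxx in prKG.
  by case/eqP: ntH; apply/trivgP; rewrite -KE subnormal_sub.
have defM : M :=: 1.
  have nsMG : M <| G by rewrite -defH maxnormal_normal.
  case: (minG M nsMG) => // MG.
  by have := maxnormal_proper maxM; rewrite MG defH properxx.
by rewrite defH defM; apply: isog_trans isoG; rewrite isog_sym quotient1_isog.
Qed.

(** For a simple quotient [H / M], either the kernel in [H] is not contained in [M], and then it
    covers the quotient, which is solvable; or the quotient is isomorphic to one in the image of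
    [f]. *)
Lemma good_ext (aT rT : finGroupType) (D G : {group aT}) (f : {morphism D >-> rT}) :
  G \subset D -> solvable ('ker_G f) -> good (f @* G)%G -> good G.
Proof.
move=> sGD solk goodfG H M snHG maxM.
have sHG := subnormal_sub snHG; have sHD := subset_trans sHG sGD.
have nsMH := maxnormal_normal maxM.
have simHM : simple (H / M) by rewrite quotient_simple.
have nsKH : 'ker_H f <| H by apply: normalGI (ker_normal f).
have [sKM | nsKM] := boolP ('ker_H f \subset M); last first.
  left; apply: (simple_solvable_abelian simHM).
  have [_ minHM] := simpleP _ simHM.
  have solK : solvable ('ker_H f / M) by rewrite quotient_sol // (solvableS _ solk) // setSI.
  case: (minHM ('ker_H f / M)%G (quotient_normal _ nsKH)) => [K1 | <-]; last exact: solK.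
  case/negP: nsKM; rewrite -quotient_sub1 ?K1 //.
  by rewrite (subset_trans (normal_sub nsKH)) ?normal_norm.
pose g := restrm_morphism sHD f.
have kerg : 'ker g \subset M by rewrite ker_restrm.
have gH : g @* H = f @* H by rewrite morphim_restrm setIid.
have iso : H / M \isog g @* H / g @* M.
  apply/isogP; exists (quotm_morphism g nsMH); last by rewrite morphim_quotm.
  rewrite ker_quotm; apply/trivgP/eqP; rewrite -subG1 quotient_sub1 //.
  by rewrite (subset_trans kerg) // normG.
have nsfM : g @* M <| g @* H := morphim_normal g nsMH.
have maxfM : maxnormal (g @* M) (g @* H) (g @* H).
  by rewrite -quotient_simple // -(isog_simple iso).
have snfH : g @* H <|<| f @* G.
  rewrite gH; have := morphim_subnormal (restrm_morphism sGD f) snHG.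
  by rewrite !morphim_restrm setIid (setIidPr sHG).
case: (goodfG (g @* H)%G (g @* M)%G snfH maxfM) => [ab | iso27].
  by left; rewrite (isog_abelian iso).
by right; apply: isog_trans iso iso27.
Qed.

Lemma good_solvable (gT : finGroupType) (G : {group gT}) : solvable G -> good G.
Proof.
move=> solG H M snHG maxM; left; apply: simple_solvable_abelian.
  by rewrite quotient_simple ?maxnormal_normal.
by rewrite quotient_sol // (solvableS (subnormal_sub snHG)).
Qed.

(** * Adding modules *)

Section Wreath.

Variables (gT lT : finGroupType) (phi : {morphism [set: gT] >-> lT}) (r : nat).

(** The ambient semidirect product with the regular module of [lT], on which [gT] acts through
    [phi]. The type has [phi] as an argument so that its group structure can refer to it; the
    submodule and the acting subgroup are cut out by [wreath_set]. *)
Definition wreath_of of {morphism [set: gT] >-> lT} := ({ffun lT -> 'F_r} * gT)%type.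
Local Notation wreath := (wreath_of phi).
HB.instance Definition _ := Finite.on wreath.

Definition ftrans (g : lT) (f : {ffun lT -> 'F_r}) : {ffun lT -> 'F_r} := [ffun x => f (x * g)].

Lemma ftrans1 f : ftrans 1 f = f.
Proof. by apply/ffunP=> x; rewrite ffunE mulg1. Qed.

Lemma ftransM g h f : ftrans g (ftrans h f) = ftrans (g * h) f.
Proof. by apply/ffunP=> x; rewrite !ffunE mulgA. Qed.

Definition wreath_mul (u v : wreath) : wreath := ((u.1 + ftrans (phi u.2) v.1)%R, u.2 * v.2).
Definition wreath_one : wreath := (0%R, 1).
Definition wreath_inv (u : wreath) : wreath := ((- ftrans (phi (u.2^-1)%g) u.1)%R, u.2^-1).

Fact wreath_mulA : associative wreath_mul.
Proof.
move=> [a x] [b y] [c z]; rewrite /wreath_mul /= mulgA; congr (_, _).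
by apply/ffunP=> t; rewrite !ffunE morphM ?inE // mulgA GRing.addrA.
Qed.

Fact wreath_mul1 : left_id wreath_one wreath_mul.
Proof.
move=> [a x]; rewrite /wreath_mul /= mul1g; congr (_, _).
by apply/ffunP=> t; rewrite !ffunE morph1 mulg1 GRing.add0r.
Qed.

Fact wreath_mulV : left_inverse wreath_one wreath_inv wreath_mul.
Proof.
move=> [a x]; rewrite /wreath_mul /= mulVg; congr (_, _).
by apply/ffunP=> t; rewrite !ffunE GRing.addNr.
Qed.

HB.instance Definition _ := Finite_isGroup.Build wreath wreath_mulA wreath_mul1 wreath_mulV.

Lemma wreathM (u v : wreath) : u * v = ((u.1 + ftrans (phi u.2) v.1)%R, u.2 * v.2) :> wreath.
Proof. by []. Qed.

Definition wreath_top (u : wreath) : gT := u.2.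
Lemma wreath_topM : {in [set: wreath] &, {morph wreath_top : u v / u * v}}.
Proof. by []. Qed.
Canonical wreath_top_morphism := Morphism wreath_topM.

Definition wreath_in (g : gT) : wreath := (0%R, g).
Lemma wreath_inM : {in [set: gT] &, {morph wreath_in : u v / u * v}}.
Proof.
move=> u v _ _; rewrite /wreath_in wreathM /=; congr (_, _).
by apply/ffunP=> t; rewrite !ffunE GRing.addr0.
Qed.
Canonical wreath_in_morphism := Morphism wreath_inM.

Definition wreath_base (f : {ffun lT -> 'F_r}) : wreath := (f, 1).

Lemma wreath_baseX f n : wreath_base f ^+ n = wreath_base (f *+ n)%R.
Proof.
elim: n => [|n IHn]; first by rewrite GRing.mulr0n.
rewrite expgS IHn GRing.mulrS wreathM /= mulg1; congr (_, _).
by apply/ffunP=> t; rewrite !ffunE morph1 mulg1.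
Qed.

Variables (G : {group gT}) (V : {set {ffun lT -> 'F_r}}).
Hypotheses (pr_r : prime r) (V0 : 0%R \in V) (VD : {in V &, forall f h, (f + h)%R \in V}).
Hypothesis VG : {in G & V, forall g f, ftrans (phi g) f \in V}.

Definition wreath_set := [set u : wreath | (u.1 \in V) && (u.2 \in G)].

Fact wreath_group_set : group_set wreath_set.
Proof.
apply/group_setP; split; first by rewrite inE /= V0 group1.
move=> u v; rewrite !inE => /andP[Vu Gu] /andP[Vv Gv].
by rewrite wreathM /= groupM // andbT VD // VG.
Qed.
Definition wreath_group := Group wreath_group_set.
Local Notation W := wreath_group.

Lemma card_wreath : #|W| = (#|V| * #|G|)%N.
Proof. by rewrite -cardsX; apply: eq_card => u; rewrite !inE. Qed.

Lemma wreath_base_exp f : wreath_base f ^+ r = 1.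
Proof.
rewrite wreath_baseX; congr (_, _); apply/ffunP=> t; rewrite ffunMnE ffunE.
exact: GRing.mulrn_pchar (pchar_Fp pr_r) _.
Qed.

Lemma wreath_ker_elt u : u \in W -> u.2 = 1 -> u ^+ r = 1.
Proof. by case: u => f g _ /= ->; apply: wreath_base_exp. Qed.

Lemma wreath_topW : wreath_top @* W = G.
Proof.
rewrite morphimEsub ?subsetT //; apply/setP=> g; apply/imsetP/idP=> [[u] | Gg].
  by rewrite inE => /andP[_ Gu] ->.
by exists ((0%R, g) : wreath); rewrite ?inE ?V0.
Qed.

Lemma ker_wreath_top : 'ker_W wreath_top = wreath_base @: V.
Proof.
apply/setP=> u; rewrite !inE; apply/andP/imsetP=> [[/andP[Vu _] /andP[_ /eqP u1]] | [f Vf ->]].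
  by exists u.1 => //; rewrite [LHS]surjective_pairing [u.2]u1.
by rewrite /= Vf group1 /wreath_top /=.
Qed.

Lemma wreath_ker_pgroup : r.-group ('ker_W wreath_top).
Proof.
apply/pgroupP=> q pr_q /(Cauchy pr_q)[u]; rewrite inE => /andP[Wu /kerP u1] ou.
have u21 : u.2 = 1 by apply: u1; rewrite inE.
have /eqP := wreath_ker_elt Wu u21; rewrite -order_dvdn ou dvdn_prime2 //.
Qed.

Lemma card_wreath_base : r.-nat #|V|.
Proof.
have := wreath_ker_pgroup; rewrite /pgroup ker_wreath_top card_imset //.
by move=> f h [].
Qed.

Lemma wreath_solvable_ker : solvable ('ker_W wreath_top).
Proof. exact: pgroup_sol wreath_ker_pgroup. Qed.

Lemma good_wreath : good G -> good W.
Proof.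
move=> goodG; apply: (good_ext (subsetT _) wreath_solvable_ker).
by rewrite (_ : (_ @* _)%G = G) //; apply/val_inj/wreath_topW.
Qed.

Lemma order_top u t : u \in W -> prime t -> t != r -> #[u] = t -> #[wreath_top u] = t.
Proof.
move=> Wu pr_t neq_tr ou; apply: nt_prime_order => //.
  by rewrite -morphX ?inE // -ou expg_order morph1.
apply: contraNneq neq_tr => u1; have /eqP := wreath_ker_elt Wu u1.
by rewrite -order_dvdn ou dvdn_prime2.
Qed.

Lemma injm_wreath_in : 'injm wreath_in.
Proof. by apply/injmP=> u v _ _ []. Qed.

Lemma wreath_in_sub : wreath_in @* G \subset W.
Proof. by apply/subsetP=> _ /morphimP[g _ Gg ->]; rewrite inE V0. Qed.

(** The kernel of the projection has exponent dividing [r], so elements of order [t] keep their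
    order in [G]; conversely [G] embeds as a complement. *)
Lemma adj_wreath t t' : prime t -> prime t' -> t != r -> t' != r -> t != t' -> adj W t t' = adj G t t'.
Proof.
move=> pr_t pr_t' tr t'r neq_t; apply/idP/idP=> [/adjP|].
  case=> // x [y [Wx Wy cxy ox oy]].
  have G_ z : z \in W -> wreath_top z \in G by rewrite inE => /andP[].
  apply: (adj_commute pr_t pr_t' neq_t (G_ _ Wx) (G_ _ Wy)).
  - by rewrite /commute -!morphM ?inE // cxy.
  - by rewrite (order_top Wx pr_t tr ox).
  by rewrite (order_top Wy pr_t' t'r oy).
rewrite -(adj_injm _ _ injm_wreath_in (subsetT G)); exact: adjS wreath_in_sub.
Qed.

(** As [r] does not divide [#|G|], an element of order [r] lies in the base, and commuting with it
    means fixing its vector. *)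
Lemma adj_wreath_base t : prime t -> t != r -> ~~ (r %| #|G|) ->
  reflect (exists g f, [/\ g \in G, f \in V, #[g] = t, f != 0%R & ftrans (phi g) f = f]) (adj W r t).
Proof.
move=> pr_t tr r'G; apply: (iffP idP) => [/adjP|].
  case=> // x [y [Wx Wy cxy ox oy]].
  have /andP[Vx Gx] : (x.1 \in V) && (x.2 \in G) by move: Wx; rewrite inE.
  have /andP[Vy Gy] : (y.1 \in V) && (y.2 \in G) by move: Wy; rewrite inE.
  have x2 : x.2 = 1.
    apply/eqP; rewrite -order_eq1; have : #[x.2] %| r.
      by rewrite order_dvdn -[x.2]/(wreath_top x) -morphX ?inE // -ox expg_order morph1.
    have /primeP[_ pr] := pr_r; case/pr/orP => // /eqP o2; case/negP: r'G.
    by rewrite -o2 order_dvdG.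
  exists y.2, x.1; split=> //; first exact: (order_top Wy pr_t tr oy).
    apply: contraTneq pr_r => x1; rewrite -ox (_ : x = 1) ?order1 //.
    by rewrite [LHS]surjective_pairing x1 x2.
  have := congr1 (fun u : wreath => u.1) cxy; rewrite !wreathM /= x2 morph1 ftrans1.
  by rewrite GRing.addrC => /GRing.addrI.
case=> g [f [Gg Vf og nzf fix_f]].
have Wf : wreath_base f \in W by rewrite inE /= Vf group1.
have Wg : wreath_in g \in W by rewrite inE /= V0.
have oF : #[wreath_base f] = r.
  apply: nt_prime_order => //; first exact: wreath_base_exp.
  by apply: contra nzf => /eqP[->].
apply: (adj_commute pr_r pr_t _ Wf Wg); rewrite ?oF ?(order_injm injm_wreath_in) ?inE ?og // 1?eq_sym //.
rewrite /commute !wreathM /= mulg1 mul1g; congr (_, _).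
by rewrite fix_f; apply/ffunP=> x; rewrite !ffunE GRing.addr0 GRing.add0r.
Qed.

End Wreath.

(** * Successive extensions by modules over different primes *)

Section Sinks.

Variables (lT : finGroupType) (L : {group lT}).

(* [S t] says that no element of order [t] of [L] has a nonzero fixed vector. *)
Definition has_module (r : nat) (S : pred nat) := exists V : {set {ffun lT -> 'F_r}},
  [/\ 0%R \in V, {in V &, forall f h, (f + h)%R \in V}, {in L & V, forall g f, ftrans g f \in V},
      (exists2 f, f \in V & f != 0%R) &
      forall t, prime t -> t %| #|L| ->
        ((exists g f, [/\ g \in L, f \in V, #[g] = t, f != 0%R & ftrans g f = f]) <-> ~~ S t)].

(** Each new module is acted on through [phi]. Elements whose order is an earlier prime of [rs] lie
    in the kernel of [phi] and fix all its vectors, which makes the primes of [rs] pairwise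
    adjacent. *)
Lemma add_sinks (rs : seq nat) (S : nat -> pred nat) : good L -> uniq rs ->
    (forall r, r \in rs -> [/\ prime r, ~~ (r %| #|L|) & has_module r (S r)]) ->
  exists (gT : finGroupType) (G : {group gT}) (phi : {morphism [set: gT] >-> lT}),
  [/\ phi @* G = L /\ good G,
      exists2 m, #|G| = (#|L| * m)%N & forall p, prime p -> (p %| m) = (p \in rs),
      forall t t', prime t -> prime t' -> t != t' -> t %| #|L| -> t' %| #|L| -> adj G t t' = adj L t t',
      forall r r', r \in rs -> r' \in rs -> r != r' -> adj G r r' &
      forall r t, r \in rs -> prime t -> t %| #|L| -> adj G r t = ~~ S r t].
Proof.
move=> goodL; elim: rs => [_ _ | r rs IH /= /andP[rs'r /IH{}IH] rsP].
  exists lT, L, (idm_morphism [set: lT]); split=> //.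
    by rewrite morphim_idm ?subsetT.
  exists 1%N; first by rewrite muln1.
  by move=> p pr_p; rewrite dvdn1 in_nil eqn_leq [p <= 1]leqNgt prime_gt1.
have [|gT [G [phi [[defL goodG] [m oG mP] adjL adj_rs adj_S]]]] := IH.
  by move=> r' r'rs; apply: rsP; rewrite inE r'rs orbT.
have [pr_r r'L [V [V0 VD VL [f0 Vf0 nzf0] fixV]]] := rsP r (mem_head _ _).
have phiG g : g \in G -> phi g \in L by move=> Gg; rewrite -defL mem_morphim ?inE.
have VG : {in G & V, forall g f, ftrans (phi g) f \in V}.
  by move=> g f Gg Vf; apply: VL; rewrite ?phiG.
have r'G : ~~ (r %| #|G|) by rewrite oG Euclid_dvdM // negb_or r'L mP.
pose W := wreath_group V0 VD VG.
pose psi (u : wreath_of r phi) := phi u.2.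
have psiM : {in [set: wreath_of r phi] &, {morph psi : u v / u * v}}.
  by move=> u v _ _; rewrite /psi wreathM morphM ?inE.
have defW : #|W| = (#|L| * (m * #|V|))%N by rewrite card_wreath oG mulnC mulnA.
have rV : r %| #|V|.
  have : r.-nat #|V| := card_wreath_base pr_r V0 VD VG.
  have : 1 < #|V| by apply/card_gt1P; exists f0, 0%R.
  move=> V1 /p_natP[] [|n] oV; first by rewrite oV in V1.
  by rewrite oV expnS dvdn_mulr.
have psi_rs s : prime s -> s \in rs -> ~~ (s %| #|L|).
  by move=> pr_s s_rs; have [|_ ->] := rsP s; rewrite ?inE ?s_rs ?orbT.
have ker_m t g : prime t -> t %| #|L| -> g \in G -> #[g] = t -> #[phi g] = t.
  move=> pr_t Lt Gg og; apply: nt_prime_order => //.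
    by rewrite -morphX ?inE // -og expg_order morph1.
  apply: contraL Lt => /eqP g1; apply: psi_rs => //; rewrite -mP //.
  have Kg : g \in 'ker_G phi by rewrite inE Gg; apply/kerP; rewrite ?inE.
  have := order_dvdG Kg; rewrite og; congr (t %| _); apply/eqP.
  rewrite -(eqn_pmul2l (cardG_gt0 L)) -oG -(LagrangeI G ('ker phi)) mulnC.
  by rewrite -defL card_morphim setTI.
have rs_ker s g : prime s -> s \in rs -> g \in G -> #[g] = s -> phi g = 1.
  move=> pr_s s_rs Gg og; apply/eqP; rewrite -order_eq1.
  have : #[phi g] %| s by rewrite order_dvdn -morphX ?inE // -og expg_order morph1.
  have /primeP[_ P] := pr_s; case/P/orP => // /eqP os.
  by case/negP: (psi_rs s pr_s s_rs); rewrite -os order_dvdG ?phiG.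
have pr_rs s : s \in rs -> prime s by move=> s_rs; have [] := rsP s; rewrite ?inE ?s_rs ?orbT.
have rs_r s : s \in rs -> s != r by apply: contraTneq => ->.
have G_rs s : s \in rs -> s %| #|G| by move=> s_rs; rewrite oG dvdn_mull // mP ?pr_rs.
have L_r s : s %| #|L| -> s != r by apply: contraTneq => ->.
have adj_r s : s \in rs -> adj W r s.
  move=> s_rs; have pr_s := pr_rs s s_rs; apply/adj_wreath_base => //; first exact: rs_r.
  have [g Gg og] := Cauchy pr_s (G_rs s s_rs).
  by exists g, f0; rewrite (rs_ker s g) // ftrans1.
have ftransX g f n : ftrans g f = f -> ftrans (g ^+ n) f = f.
  by move=> fg; elim: n => [|n IHn]; rewrite ?ftrans1 // expgS -ftransM IHn.
exists (wreath_of r phi : finGroupType), W, (Morphism psiM); split.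
- split; last exact: good_wreath.
  apply/setP=> l; rewrite -defL; apply/morphimP/morphimP=> [[u _ Wu ->] | [g _ Gg ->]].
    by exists u.2; rewrite ?inE //; move: Wu; rewrite inE => /andP[].
  by exists (wreath_in phi r g); rewrite ?inE ?V0.
- exists (m * #|V|)%N => // p pr_p.
  rewrite Euclid_dvdM // mP // inE orbC; congr (_ || _).
  apply/idP/eqP=> [pV | -> //].
  have : p.-nat p by rewrite pnatE ?inE.
  have := pnat_dvd pV (card_wreath_base pr_r V0 VD VG).
  by rewrite pnatE // !inE => /eqP.
- move=> t t' pr_t pr_t' neq_t Lt Lt'.
  by rewrite adj_wreath ?L_r // adjL.
- move=> r1 r2; rewrite !inE => /predU1P[-> | rs1] /predU1P[-> | rs2] neq.
  + by rewrite eqxx in neq.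
  + exact: adj_r.
  + by rewrite adjC adj_r.
  by rewrite (adj_wreath pr_r V0 VD VG (pr_rs _ rs1) (pr_rs _ rs2) (rs_r _ rs1) (rs_r _ rs2) neq) adj_rs.
move=> r1 t; rewrite inE => /predU1P[-> | rs1] pr_t Lt; last first.
  have neq_t : r1 != t by apply: contraTneq Lt => <-; apply: psi_rs; rewrite ?pr_rs.
  by rewrite (adj_wreath pr_r V0 VD VG (pr_rs _ rs1) pr_t (rs_r _ rs1) (L_r _ Lt) neq_t) adj_S.
apply/adj_wreath_base/idP => //; first exact: L_r.
  case=> g [f [Gg Vf og nzf fix_f]]; apply/fixV => //.
  by exists (phi g), f; rewrite phiG // (ker_m t).
case/fixV=> // g' [f [Lg' Vf og' nzf fix_f]].
have /morphimP[g0 _ Gg0 def_g'] : g' \in phi @* G by rewrite defL.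
have /dvdnP[k og0] : t %| #[g0] by rewrite -og' def_g' morph_order ?inE.
have k_gt0 : 0 < k by case: k og0 (order_gt0 g0) => // ->.
(* The image of [g0 ^+ k] is only a power of [g'], but it still fixes [f]. *)
exists (g0 ^+ k), f; split; rewrite ?groupX //.
  by rewrite orderXdiv og0 ?dvdn_mulr // mulKn.
by rewrite morphX ?inE // -def_g' ftransX.
Qed.

End Sinks.

(** * Metacyclic groups *)

Lemma chinese_seq (qs : seq nat) (f : nat -> nat) : pairwise coprime qs ->
  exists u, {in qs, forall q, u = f q %[mod q]}.
Proof.
elim: qs => [_ | q qs IH /= /andP[coq /IH[u uP]]]; first by exists 0%N.
have co : coprime q (\prod_(i <- qs) i).
  elim: (qs) coq => [|i s IHs] /=; rewrite ?big_nil ?coprimen1 // big_cons coprimeMr.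
  by case/andP=> -> /IHs.
exists (chinese q (\prod_(i <- qs) i) (f q) u) => q'; rewrite inE => /predU1P[-> | qs_q'].
  by rewrite chinese_modl.
rewrite -uP //.
have d : q' %| \prod_(i <- qs) i by rewrite (big_rem q') //= dvdn_mulr.
by rewrite -(modn_dvdm _ d) chinese_modr // modn_dvdm.
Qed.

Lemma mulrn_modn (n : nat) (x : 'I_n.+1) k : (x *+ (k %% n.+1) = x *+ k)%R.
Proof.
by apply: val_inj; rewrite !Zp_mulrn /= modnMmr.
Qed.

Section Metacyclic.

Variables (n m u : nat).
Hypothesis um1 : (u ^ m.+1 = 1 %[mod n.+1])%N.

(** The semidirect product of cyclic groups of orders [n.+1] and [m.+1], a generator of the second
    acting as multiplication by [u]. The congruence is a parameter of the type because the group
    axioms rest on it. *)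
Definition metacyclic_type of (u ^ m.+1 = 1 %[mod n.+1])%N := ('I_n.+1 * 'I_m.+1)%type.
Local Notation J := (metacyclic_type um1).
HB.instance Definition _ := Finite.on J.

Definition act_exp (y : nat) (x : 'I_n.+1) := (x *+ (u ^ y))%R.

Lemma act_expD y z x : act_exp (y + z) x = act_exp y (act_exp z x).
Proof. by rewrite /act_exp expnD mulnC mulrnA. Qed.

Lemma act_exp_add y (x x' : 'I_n.+1) : (act_exp y (x + x') = act_exp y x + act_exp y x')%R.
Proof. exact: mulrnDl. Qed.

Lemma act_exp_mod y x : act_exp (y %% m.+1) x = act_exp y x.
Proof.
have e1 (z : 'I_n.+1) k : act_exp (k * m.+1) z = z.
  rewrite /act_exp -mulrn_modn mulnC expnM -modnXm um1 modnXm exp1n mulrn_modn.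
  exact: mulr1n.
by rewrite [in RHS](divn_eq y m.+1) act_expD e1.
Qed.

Definition meta_mul (a b : J) : J := ((a.1 + act_exp a.2 b.1)%R, (a.2 + b.2)%R).
Definition meta_one : J := (0%R, 0%R).
Definition meta_inv (a : J) : J := ((- act_exp (- a.2)%R a.1)%R, (- a.2)%R).

Fact meta_mulA : associative meta_mul.
Proof.
move=> [x y] [x' y'] [x'' y'']; rewrite /meta_mul /= addrA; congr (_, _).
by rewrite act_exp_mod act_exp_add addrA act_expD.
Qed.

Fact meta_mul1 : left_id meta_one meta_mul.
Proof. by move=> [x y]; rewrite /meta_mul /= !add0r. Qed.

Fact meta_mulV : left_inverse meta_one meta_inv meta_mul.
Proof. by move=> [x y]; rewrite /meta_mul /= !addNr. Qed.

HB.instance Definition _ := Finite_isGroup.Build J meta_mulA meta_mul1 meta_mulV.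

Lemma metaM (a b : J) : a * b = ((a.1 + act_exp a.2 b.1)%R, (a.2 + b.2)%R) :> J.
Proof. by []. Qed.

Lemma metaV (a : J) : a^-1 = ((- act_exp (- a.2)%R a.1)%R, (- a.2)%R) :> J.
Proof. by []. Qed.

Lemma meta_base_exp x k : ((x, 0%R) : J) ^+ k = ((x *+ k)%R, 0%R).
Proof.
elim: k => [|k IHk]; first by rewrite mulr0n.
by rewrite expgS IHk metaM /= addr0 mulrS.
Qed.

Lemma meta_snd_exp (a : J) k : (a ^+ k).2 = (a.2 *+ k)%R.
Proof. by elim: k => [|k IHk]; rewrite ?mulr0n // expgS metaM /= IHk mulrS. Qed.

Lemma meta_top_exp y k : ((0%R, y) : J) ^+ k = (0%R, (y *+ k)%R).
Proof.
elim: k => [|k IHk]; first by rewrite mulr0n.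
by rewrite expgS IHk metaM /= mulrS /act_exp mul0rn addr0.
Qed.

Lemma meta_snd_conj (a b : J) : (a ^ b).2 = a.2.
Proof. by rewrite conjgE !metaM metaV /= addrC addrK. Qed.

Lemma card_meta : #|[set: J]| = (n.+1 * m.+1)%N.
Proof. by rewrite cardsT card_prod !card_ord. Qed.

Lemma meta_solvable : solvable [set: J].
Proof.
pose f (a : J) : 'I_m.+1 := a.2.
have fM : {in [set: J] &, {morph f : a b / a * b}} by [].
pose fm := Morphism fM.
rewrite (series_sol (ker_normal fm)); apply/andP; split.
  have ker2 (a : J) : a \in 'ker fm -> a.2 = 0%R by move/(kerP _ (in_setT a)).
  apply: abelian_sol; apply/centsP=> a /ker2 a2 b /ker2 b2; rewrite /commute !metaM.
  by rewrite a2 b2 /act_exp expn0 !mulr1n addrC.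
rewrite (isog_sol (first_isog fm)); apply: abelian_sol; exact: abelianS (subsetT _) (Zp_abelian m).
Qed.

End Metacyclic.

(** * Modules with prescribed fixed points *)

Section Module.

Variables (jT kT : finGroupType) (r : nat) (C : {group jT}) (lam : jT -> 'F_r).
Variables (S SK : pred nat).
Local Notation lT := (jT * kT)%type.

Hypotheses (pr_r : prime r) (r'J : ~~ (r %| #|[set: jT]|)) (r'K : ~~ (r %| #|[set: kT]|)).
Hypothesis coJK : coprime #|[set: jT]| #|[set: kT]|.
Hypotheses (lam1 : lam 1 = 1%R) (lamM : {in C &, forall c d, lam (c * d)%g = (lam c * lam d)%R}).
Hypothesis lam_reg : forall t, prime t -> t %| #|[set: jT]| -> S t ->
  forall g, #[g] = t -> forall x, g ^ x \in C /\ lam (g ^ x) != 1%R.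
Hypothesis lam_fix : forall t, prime t -> t %| #|[set: jT]| -> ~~ S t ->
  exists2 g, #[g] = t & {in C :&: <[g]>, forall c, lam c = 1%R}.
Hypothesis K_fix : forall t, prime t -> t %| #|[set: kT]| -> ~~ SK t ->
  exists (g : kT) (w : kT -> 'F_r), [/\ #[g] = t, exists z, w z != 0%R, forall y, w (y * g) = w y &
    forall v, SK #[v] -> forall y, (\sum_(i < #[v]) w (y * v ^+ i)%g)%R = 0%R].
Hypothesis K_nt : exists w : kT -> 'F_r, (exists z, w z != 0%R) /\
    forall v, SK #[v] -> forall y, (\sum_(i < #[v]) w (y * v ^+ i)%g)%R = 0%R.

(* The functions on [J * K] that transform by [lam] under [C] (the module induced
   from [lam]) and whose second argument lies in the largest submodule of the
   regular module of [K] where the [v] with [SK #[v]] have no fixed vector. *)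
Let V := [set f : {ffun lT -> 'F_r} |
  [forall c in C, forall x : lT, f ((c * x.1)%g, x.2) == (lam c * f x)%R] &&
  [forall (v | SK #[v]), forall x : lT, \sum_(i < #[v]) f (x.1, (x.2 * v ^+ i)%g) == 0]%R].

Let VP (f : {ffun lT -> 'F_r}) : reflect ((forall c x y, c \in C -> f (c * x, y) = (lam c * f (x, y))%R) /\
    (forall v x y, SK #[v] -> (\sum_(i < #[v]) f (x, (y * v ^+ i)%g) = 0)%R)) (f \in V).
Proof.
rewrite inE; apply: (iffP andP) => [[/forall_inP f1 /forall_inP f2] | [f1 f2]]; split.
- by move=> c x y Cc; have /forallP/(_ (x, y))/eqP := f1 c Cc.
- by move=> v x y Sv; have /forallP/(_ (x, y))/eqP := f2 v Sv.
- by apply/forall_inP=> c Cc; apply/forallP=> -[x y]; apply/eqP/f1.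
by apply/forall_inP=> v Sv; apply/forallP=> -[x y]; apply/eqP/f2.
Qed.

Let lamV c : c \in C -> (lam c * lam (c^-1)%g)%R = 1%R.
Proof. by move=> Cc; rewrite -lamM ?groupV // mulgV. Qed.

(** The delta function at 1, averaged by [lam] over [C] on the left and over [<[g]>] on the right.
    If [lam] is trivial on [C :&: <[g]>], its value at 1 is the order of this group, nonzero modulo
    [r]. *)
Let F (g : jT) (x : jT) : 'F_r := (\sum_(c in C) \sum_(h in <[g]> | (c * x * h)%g == 1%g) lam (c^-1)%g)%R.

Let F_lam g c x : c \in C -> F g (c * x) = (lam c * F g x)%R.
Proof.
move=> Cc; rewrite /F mulr_sumr [RHS](reindex_inj (mulIg c)) /=.
apply: eq_big => [d | d Cd]; first by rewrite groupMr.
rewrite mulr_sumr; apply: eq_big => [h | h _]; first by rewrite !mulgA.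
by rewrite invMg lamM ?groupV // mulrA lamV // mul1r.
Qed.

Let F_fix g x : F g (x * g) = F g x.
Proof.
rewrite /F; apply: eq_bigr => c Cc; rewrite [RHS](reindex_inj (mulgI g)) /=.
apply: eq_bigl => h; by rewrite groupMl ?cycle_id // !mulgA.
Qed.

Let F_nz g : {in C :&: <[g]>, forall c, lam c = 1%R} -> F g 1 != 0%R.
Proof.
move=> lam_g.
have -> : F g 1 = (#|C :&: <[g]>|%:R)%R.
  rewrite /F -sumr_const big_mkcond [RHS]big_mkcond /=; apply: eq_bigr => c _.
  rewrite inE; have [Cc | //] := boolP (c \in C).
  have E h : (c * 1 * h == 1) = (h == c^-1) by rewrite mulg1 -eq_invg_mul eq_sym.
  under eq_bigl => h do rewrite E.
  rewrite big_mkcond /= -big_mkcondr.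
  have [gc | g'c] := boolP (c \in <[g]>).
    rewrite (big_pred1 c^-1) ?lam_g ?groupV // ?inE ?groupV ?Cc //.
    by move=> h /=; case: eqP => [-> | _]; rewrite ?andbF // groupV gc.
  by rewrite big_pred0 // => h; case: (h =P c^-1) => [-> | _]; rewrite ?andbF // groupV (negPf g'c).
rewrite -(dvdn_pcharf (pchar_Fp pr_r)); apply: contra r'J => rC.
by apply: dvdn_trans rC (cardSg (subsetT _)).
Qed.

Let tensor g (w : kT -> 'F_r) : {ffun lT -> 'F_r} := [ffun x : lT => (F g x.1 * w x.2)%R].

Let tensorV g w : (forall v, SK #[v] -> forall y, (\sum_(i < #[v]) w (y * v ^+ i)%g)%R = 0%R) ->
  tensor g w \in V.
Proof.
move=> w0; apply/VP; split=> [c x y Cc | v x y Sv].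
  by rewrite !ffunE /= F_lam // mulrA.
under eq_bigr => i _ do rewrite ffunE /=.
by rewrite -mulr_sumr w0 // mulr0.
Qed.

Let pairM (x a : jT) (y b : kT) : ((x, y) : lT) * ((a, b) : lT) = (x * a, y * b).
Proof. by []. Qed.

(** When [S t] holds, an element of order [t] has all its conjugates in [C] with [lam] different
    from 1; moving it from the right to the left of the argument multiplies a fixed function by such
    a scalar. When the condition fails, a function [tensor] is a nonzero fixed vector. *)
Lemma module_exists : has_module [set: lT] r (fun t => if t %| #|[set: jT]| then S t else SK t).
Proof.
have cardL : #|[set: lT]| = (#|[set: jT]| * #|[set: kT]|)%N by rewrite !cardsT card_prod.
exists V; split.
- by apply/VP; split=> *; rewrite ?big1 // => *; rewrite !ffunE ?mulr0.
- move=> f h /VP[f1 f2] /VP[h1 h2]; apply/VP; split=> [c x y Cc | v x y Sv].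
    by rewrite !ffunE f1 // h1 // mulrDr.
  by under eq_bigr => i _ do rewrite ffunE; rewrite big_split /= f2 // h2 // addr0.
- move=> [a b] f _ /VP[f1 f2]; apply/VP; split=> [c x y Cc | v x y Sv].
    by rewrite !ffunE !pairM -mulgA f1.
  under eq_bigr => i _ do rewrite ffunE pairM.
  have := f2 (v ^ b) (x * a) (y * b); rewrite orderJ => /(_ Sv) sum0.
  rewrite -[RHS]sum0; apply: eq_bigr => i _; congr (f (_, _)).
  by rewrite -conjXg -!mulgA -conjgC.
- have [w [[z wz] w0]] := K_nt; exists (tensor 1 w); first exact: tensorV.
  apply/eqP=> /ffunP/(_ (1, z)); rewrite !ffunE /= => /eqP; rewrite mulf_eq0 (negPf wz) orbF.
  apply/negP/F_nz => c; rewrite inE => /andP[_ /cycleP[i ->]]; by rewrite expg1n.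
move=> t pr_t; rewrite cardL Euclid_dvdM // => Lt; split.
  case=> -[a b] [f [_ /VP[f1 f2] oab nzf fix_f]].
  have Dab k : ((a, b) : lT) ^+ k = (a ^+ k, b ^+ k) by elim: k => // k IHk; rewrite !expgS IHk.
  have [at1 bt1] : a ^+ t = 1 /\ b ^+ t = 1.
    by have := expg_order ((a, b) : lT); rewrite oab Dab => -[].
  have fixf x y : f (x * a, y * b) = f (x, y) by move/ffunP/(_ (x, y)): fix_f; rewrite ffunE pairM.
  case: ifP => [Jt | J't]; apply: contra nzf => St; apply/eqP/ffunP=> -[x y]; rewrite [RHS]ffunE.
    have b1 : b = 1.
      apply/eqP; rewrite -order_eq1; have : #[b] %| t by rewrite order_dvdn bt1.
      have /primeP[_ P] := pr_t; case/P/orP=> // /eqP ob.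
      have := coprime_dvdl Jt coJK; rewrite prime_coprime // -ob order_dvdG ?inE //.
    have oa : #[a] = t.
      apply: nt_prime_order => //; apply: contraTneq pr_t => a1.
      by rewrite -oab a1 b1 (_ : (1, 1) = 1 :> lT) // order1.
    have [Ca lam_a] := lam_reg pr_t Jt St oa x^-1.
    have := fixf x y; rewrite b1 mulg1 (_ : x * a = a ^ x^-1 * x); last by rewrite conjgE invgK -!mulgA mulVg mulg1.
    rewrite f1 // => /eqP; rewrite -subr_eq0 -[X in (_ - X)%R]mul1r -mulrBl mulf_eq0 subr_eq0.
    by rewrite (negPf lam_a) => /eqP.
  rewrite J't /= in Lt.
  have a1 : a = 1.
    apply/eqP; rewrite -order_eq1; have : #[a] %| t by rewrite order_dvdn at1.
    have /primeP[_ P] := pr_t; case/P/orP=> // /eqP oa.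
    by rewrite -oa order_dvdG ?inE in J't.
  have ob : #[b] = t.
    apply: nt_prime_order => //; apply: contraTneq pr_t => b1.
    by rewrite -oab a1 b1 (_ : (1, 1) = 1 :> lT) // order1.
  (* A fixed [f] is constant along the orbit of [b], so the vanishing sum is [t] times its value,
     and [t] differs from [r]. *)
  have := f2 b x y; rewrite ob => /(_ St); under eq_bigr => i _.
    have -> : f (x, y * b ^+ i) = f (x, y).
      elim: (nat_of_ord i) => [|k IHk]; first by rewrite mulg1.
      by rewrite expgSr mulgA -IHk -[in RHS](fixf x) a1 mulg1.
    over.
  rewrite sumr_const card_ord => /eqP; rewrite -mulr_natr mulf_eq0 => /orP[/eqP // | ].
  rewrite -(dvdn_pcharf (pchar_Fp pr_r)) dvdn_prime2 // => /eqP rt.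
  by case/negP: r'K; rewrite rt.
case: ifP => [Jt nSt | J't nSt].
  have [g og lam_g] := lam_fix pr_t Jt nSt; have [w [[z wz] w0]] := K_nt.
  exists (g, 1), (tensor g w); split; [by rewrite inE | exact: tensorV | | | ].
  - rewrite -og; apply: (order_injm (injm_pairg1 _ _)); exact: in_setT.
  - apply/eqP=> /ffunP/(_ (1, z)); rewrite !ffunE /= => /eqP.
    by rewrite mulf_eq0 (negPf wz) orbF; apply/negP/F_nz.
  by apply/ffunP=> -[x y]; rewrite !ffunE pairM /= mulg1 F_fix.
rewrite J't /= in Lt.
have [g [w [og [z wz] fixw w0]]] := K_fix pr_t Lt nSt.
exists (1, g), (tensor 1 w); split; [by rewrite inE | exact: tensorV | | | ].
- rewrite -og; apply: (order_injm (injm_pair1g _ _)); exact: in_setT.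
- apply/eqP=> /ffunP/(_ (1, z)); rewrite !ffunE /= => /eqP; rewrite mulf_eq0 (negPf wz) orbF.
  by apply/negP/F_nz => c; rewrite inE => /andP[_ /cycleP[i ->]]; rewrite expg1n.
by apply/ffunP=> -[x y]; rewrite !ffunE pairM /= mulg1 fixw.
Qed.

End Module.

(** * Prescribed Frobenius actions *)

Lemma Fp_prim_root r e : prime r -> e %| r.-1 -> exists z : 'F_r, (e.-primitive_root z)%R.
Proof.
move=> pr_r e_r; have r1 : 0 < r.-1 by rewrite -subn1 subn_gt0 prime_gt1.
have cardF : #|'F_r| = r.-1.+1 by rewrite card_Fp // prednK ?prime_gt0.
pose rs := enum (predC1 (0 : 'F_r)%R).
have : has (r.-1.-primitive_root)%R rs.
  apply: has_prim_root => //.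
  - apply/allP=> x; rewrite mem_enum /= => nz_x; rewrite unity_rootE.
    have := expf_card x; rewrite cardF exprS => /eqP.
    by rewrite -subr_eq0 -[X in (_ - X)%R]mulr1 -mulrBr mulf_eq0 (negPf nz_x) subr_eq0.
  - exact: enum_uniq.
  by rewrite -cardE cardC1 cardF.
case/hasP=> z _ prim_z; exists (z ^+ (r.-1 %/ e))%R.
exact: dvdn_prim_root.
Qed.

Section Squarefree.

Variable s : seq nat.
Hypotheses (pr_s : all prime s) (us : uniq s).

Lemma dvdn_prod_primes (P : pred nat) p : prime p ->
  (p %| \prod_(i <- s | P i) i) = (p \in s) && P p.
Proof.
move=> pr_p; elim: s pr_s => [_ | q t IH /= /andP[pr_q /IH{}IH]].
  by rewrite big_nil dvdn1 in_nil eqn_leq [p <= 1]leqNgt prime_gt1.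
rewrite big_cons inE; case: ifP => Pq; rewrite ?Euclid_dvdM // IH ?dvdn_prime2 //.
  by case: eqP => [-> | //]; rewrite Pq.
by case: eqP => [-> | //]; rewrite Pq andbF.
Qed.

Lemma prod_primes_dvdn (P : pred nat) x :
  (\prod_(i <- s | P i) i %| x) = all (fun i => P i ==> (i %| x)) s.
Proof.
elim: s pr_s us => [_ _ | q t IH /= /andP[pr_q prt] /andP[t'q ut]]; first by rewrite big_nil dvd1n.
have pt : all prime t by [].
rewrite big_cons; case: ifP => Pq; last by rewrite IH.
rewrite Gauss_dvd ?IH //= prime_coprime //.
apply: contra t'q; elim: (t) prt => [_ | q' t' IH' /= /andP[pr_q' prt']].
  by rewrite big_nil dvdn1 => /eqP q1; rewrite q1 in pr_q.
rewrite big_cons inE; case: ifP => _; last by move/(IH' prt')->; rewrite orbT.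
by rewrite Euclid_dvdM // dvdn_prime2 // => /orP[-> // | /(IH' prt')->]; rewrite orbT.
Qed.

Lemma prod_primes_gt0 (P : pred nat) : 0 < \prod_(i <- s | P i) i.
Proof.
rewrite big_seq_cond; apply: prodn_cond_gt0 => i /andP[si _].
exact/prime_gt0/(allP pr_s).
Qed.

Lemma prod_primesD1 p : p \in s -> (\prod_(i <- s) i = p * \prod_(i <- s | i != p) i)%N.
Proof. by move=> sp; rewrite (bigD1_seq p). Qed.

End Squarefree.

Section Frobenius.

Variables (ps qs : seq nat) (E : rel nat).
Hypotheses (pr_ps : all prime ps) (ups : uniq ps) (pr_qs : all prime qs) (uqs : uniq qs).
Hypotheses (ps'q : forall q, q \in qs -> q \notin ps)
           (q1 : forall q, q \in qs -> \prod_(p <- ps) p %| q.-1).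

Let n := (\prod_(q <- qs) q)%N.-1.
Let m := (\prod_(p <- ps) p)%N.-1.
Let nE : (n.+1 = \prod_(q <- qs) q)%N. Proof. exact/prednK/prod_primes_gt0. Qed.
Let mE : (m.+1 = \prod_(p <- ps) p)%N. Proof. exact/prednK/prod_primes_gt0. Qed.
(** The order of the action to be realised on the subgroup of order [q]: its prime divisors are the
    primes that must not commute with that subgroup. *)
Let e q := (\prod_(p <- ps | E p q) p)%N.

Let pr_p p : p \in ps -> prime p. Proof. exact: (allP pr_ps). Qed.
Let pr_q q : q \in qs -> prime q. Proof. exact: (allP pr_qs). Qed.

Let dvd_m x : (m.+1 %| x) = all (fun p => p %| x) ps.
Proof. by rewrite mE prod_primes_dvdn. Qed.
Let dvd_n x : (n.+1 %| x) = all (fun q => q %| x) qs.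
Proof. by rewrite nE prod_primes_dvdn. Qed.

Let e_m q : e q %| m.+1.
Proof.
by rewrite prod_primes_dvdn //; apply/allP=> p ps_p; apply/implyP=> _; rewrite mE dvdn_prod_primes ?pr_p // ps_p.
Qed.

(** Since [e q] divides [q.-1], there is an element of order [e q] modulo [q]; the residues are
    combined by the Chinese remainder theorem. *)
Lemma power_exists : exists u, forall q, q \in qs -> forall k, (u ^ k == 1 %[mod q])%N = (e q %| k).
Proof.
pose z q : 'F_q := odflt 1%R [pick z : 'F_q | ((e q).-primitive_root z)%R].
have zP q : q \in qs -> ((e q).-primitive_root (z q))%R.
  move=> qs_q; rewrite /z; case: pickP => //= no_z.
  have [|x prim_x] := @Fp_prim_root q (e q) (pr_q qs_q); last by rewrite no_z in prim_x.
  by apply: dvdn_trans (e_m q) _; rewrite mE q1.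
have pw : pairwise coprime qs.
  elim: (qs) pr_qs uqs => //= q s IH /andP[prq prs] /andP[s'q us]; rewrite IH // andbT.
  apply/allP=> q' s_q'; rewrite prime_coprime // dvdn_prime2 ?(allP prs q') //.
  by apply: contraNneq s'q => ->.
have [u uP] := chinese_seq (fun q => nat_of_ord (z q)) pw.
exists u => q qs_q k; have prq := pr_q qs_q.
rewrite (prim_order_dvd (zP q qs_q)).
have zu : (u%:R : 'F_q)%R = z q.
  apply: val_inj; rewrite /= val_Fp_nat // uP // modn_small //.
  by have := ltn_ord (z q); rewrite {2}Fp_cast.
have E1 a b : ((a%:R == b%:R :> 'F_q)%R) = (a == b %[mod q])%N by rewrite -(inj_eq val_inj) /= !val_Fp_nat.
by rewrite -E1 natrX zu.
Qed.

Section WithExponent.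

Variable u : nat.
Hypothesis uP : forall q, q \in qs -> forall k, (u ^ k == 1 %[mod q])%N = (e q %| k).

Let u_gt0 q : q \in qs -> 0 < u.
Proof.
move=> qs_q; rewrite lt0n; apply: contraTneq (e_m q) => u0; rewrite -uP // u0 exp0n //.
by rewrite mod0n modn_small ?prime_gt1 ?pr_q.
Qed.

Lemma power_order1 : (u ^ m.+1 = 1 %[mod n.+1])%N.
Proof.
have [qs0 | [q qs_q]] : qs = [::] \/ exists q, q \in qs.
  by case: (qs) => [|q s]; [left | right; exists q; rewrite mem_head].
  by have := nE; rewrite qs0 big_nil => ->; rewrite !modn1.
apply/eqP; rewrite eqn_mod_dvd ?expn_gt0 ?(u_gt0 qs_q) // dvd_n.
apply/allP=> q' qs_q'; rewrite -eqn_mod_dvd ?expn_gt0 ?(u_gt0 qs_q) //.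
by rewrite uP // e_m.
Qed.

Local Notation J := (metacyclic_type power_order1).

Let mulrn0 k (x : 'I_k.+1) i : (x *+ i == 0)%R = (k.+1 %| x * i)%N.
Proof. by rewrite -(inj_eq val_inj) Zp_mulrn. Qed.

Let mulrn_in k a i : ((inZp a : 'I_k.+1) *+ i == 0)%R = (k.+1 %| a * i)%N.
Proof. by rewrite mulrn0 /= /dvdn modnMml. Qed.

Let mulrn_fix k (x : 'I_k.+1) i : 0 < i -> (x *+ i == x)%R = (k.+1 %| x * (i - 1))%N.
Proof.
move=> i_gt0; rewrite -mulrn0 -{1}(subnK i_gt0) mulrnDr mulr1n.
by rewrite -subr_eq0 addrK.
Qed.

Let ord_eq0 k (x : 'I_k.+1) : k.+1 %| x -> x = 0%R.
Proof. by move=> kx; apply: val_inj; rewrite /= -[LHS](modn_small (ltn_ord x)); apply/eqP. Qed.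

Let co_mn q : q \in qs -> coprime m.+1 q.
Proof.
move=> qs_q; rewrite coprime_sym prime_coprime ?pr_q // mE dvdn_prod_primes ?pr_q //.
by rewrite (negPf (ps'q qs_q)).
Qed.

Let co_np p : p \in ps -> coprime n.+1 p.
Proof.
move=> ps_p; rewrite coprime_sym prime_coprime ?pr_p // nE dvdn_prod_primes ?pr_p //.
by rewrite andbT; apply: contraL ps_p => /ps'q.
Qed.

Let Np q := (\prod_(i <- qs | i != q) i)%N.
Let Mp p := (\prod_(i <- ps | i != p) i)%N.

Let nM q : q \in qs -> (n.+1 = q * Np q)%N.
Proof. by move=> qs_q; rewrite nE (prod_primesD1 uqs qs_q). Qed.
Let mM p : p \in ps -> (m.+1 = p * Mp p)%N.
Proof. by move=> ps_p; rewrite mE (prod_primesD1 ups ps_p). Qed.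

Lemma meta_order_base (g : J) q : q \in qs -> #[g] = q ->
  [/\ g.2 = 0%R, Np q %| g.1 & ~~ (q %| g.1)].
Proof.
move=> qs_q og; have gq : g ^+ q = 1 by rewrite -og expg_order.
have g2 : g.2 = 0%R.
  have /eqP := congr1 (fun h : J => h.2) gq; rewrite meta_snd_exp mulrn0.
  by rewrite Gauss_dvdl ?co_mn //; apply: ord_eq0.
have g_pair : g = (g.1, 0%R) by rewrite [LHS]surjective_pairing g2.
have dv : Np q %| g.1.
  have /eqP := congr1 (fun h : J => h.1) gq; rewrite g_pair meta_base_exp /= mulrn0.
  by move: (nat_of_ord g.1) => z; rewrite (nM qs_q) mulnC dvdn_pmul2r ?prime_gt0 ?pr_q.
split=> //; apply: contraTN (pr_q qs_q) => q_g.
have : n.+1 %| g.1.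
  rewrite dvd_n; apply/allP=> q' qs_q'; have [-> // | neq] := eqVneq q' q.
  by apply: dvdn_trans dv; rewrite dvdn_prod_primes ?pr_q // qs_q'.
by move/ord_eq0=> g1; rewrite -og g_pair g1 order1.
Qed.

(** An element of order [p] need not lie in the top cyclic subgroup, so only its second coordinate
    is described. *)
Lemma meta_order_top (g : J) p : p \in ps -> #[g] = p -> Mp p %| g.2 /\ ~~ (p %| g.2).
Proof.
move=> ps_p og; have gp : g ^+ p = 1 by rewrite -og expg_order.
have dv : Mp p %| g.2.
  have /eqP := congr1 (fun h : J => h.2) gp; rewrite meta_snd_exp mulrn0.
  by move: (nat_of_ord g.2) => z; rewrite (mM ps_p) mulnC dvdn_pmul2r ?prime_gt0 ?pr_p.
split=> //; apply: contraTN (pr_p ps_p) => p_g.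
have m_g : m.+1 %| g.2.
  rewrite dvd_m; apply/allP=> p' ps_p'; have [-> // | neq] := eqVneq p' p.
  by apply: dvdn_trans dv; rewrite dvdn_prod_primes ?pr_p // ps_p'.
have g2 : g.2 = 0%R by apply: ord_eq0.
have g_pair : g = (g.1, 0%R) by rewrite [LHS]surjective_pairing g2.
have /eqP := congr1 (fun h : J => h.1) gp; rewrite g_pair meta_base_exp /= mulrn0.
rewrite Gauss_dvdl ?co_np // => n_g.
have g1 : g.1 = 0%R by apply: ord_eq0.
by rewrite -og g_pair g1 order1.
Qed.

Definition meta_base q : J := (inZp (Np q), 0%R).
Definition meta_top p : J := (0%R, inZp (Mp p)).

Lemma order_meta_base q : q \in qs -> #[meta_base q] = q.
Proof.
move=> qs_q; apply: nt_prime_order; first exact: pr_q.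
  by rewrite meta_base_exp; congr (_, _); apply/eqP; rewrite mulrn_in (nM qs_q) mulnC.
apply/eqP=> /(congr1 (fun a : J => a.1)) /= e1; have := mulrn_in n (Np q) 1.
rewrite e1 mul0rn eqxx muln1 dvd_n => /esym/allP/(_ q qs_q).
by rewrite dvdn_prod_primes ?pr_q // eqxx andbF.
Qed.

Lemma order_meta_top p : p \in ps -> #[meta_top p] = p.
Proof.
move=> ps_p; apply: nt_prime_order; first exact: pr_p.
  by rewrite meta_top_exp; congr (_, _); apply/eqP; rewrite mulrn_in (mM ps_p) mulnC.
apply/eqP=> /(congr1 (fun a : J => a.2)) /= e1; have := mulrn_in m (Mp p) 1.
rewrite e1 mul0rn eqxx muln1 dvd_m => /esym/allP/(_ p ps_p).
by rewrite dvdn_prod_primes ?pr_p // eqxx andbF.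
Qed.

Lemma adj_meta_base q q' : q \in qs -> q' \in qs -> q != q' -> adj [set: J] q q'.
Proof.
move=> qs_q qs_q' neq; apply: (adj_commute (x := meta_base q) (y := meta_base q')) => //; rewrite ?pr_q ?inE //.
- by rewrite /commute !metaM /= /act_exp !expn0 !mulr1n addrC.
- by rewrite order_meta_base.
by rewrite order_meta_base.
Qed.

Lemma adj_meta_top p p' : p \in ps -> p' \in ps -> p != p' -> adj [set: J] p p'.
Proof.
move=> ps_p ps_p' neq; apply: (adj_commute (x := meta_top p) (y := meta_top p')) => //; rewrite ?pr_p ?inE //.
- by rewrite /commute !metaM /= /act_exp !mul0rn !addr0 addrC.
- by rewrite order_meta_top.
by rewrite order_meta_top.
Qed.

(** Elements of orders [p] and [q] commute only if [e q] divides the second coordinate of the first,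
    which is divisible by all primes of [ps] other than [p] but not by [p]. *)
Lemma adj_meta p q : p \in ps -> q \in qs -> adj [set: J] p q = ~~ E p q.
Proof.
move=> ps_p qs_q.
have neq : p != q by apply: contraTneq ps_p => ->; apply: ps'q.
have [prp prq] := (pr_p ps_p, pr_q qs_q).
have mod1 k : (u ^ k == 1 %[mod q])%N = (q %| u ^ k - 1).
  by rewrite eqn_mod_dvd // expn_gt0 (u_gt0 qs_q).
apply/idP/idP=> [/adjP[] // g [h [_ _ cgh og oh]] | nE_pq].
  have [g_p p'g] := meta_order_top ps_p og.
  have [h2 h_q q'h] := meta_order_base qs_q oh.
  have := congr1 (fun a : J => a.1) cgh; rewrite !metaM /= h2.
  rewrite {2}/act_exp expn0 mulr1n addrC => /addIr/eqP.
  rewrite /act_exp mulrn_fix ?expn_gt0 ?(u_gt0 qs_q) // dvd_n => /allP/(_ q qs_q).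
  rewrite Euclid_dvdM // (negPf q'h) /= -mod1 uP // => e_g.
  apply: contra p'g => Epq; apply: dvdn_trans e_g.
  by rewrite dvdn_prod_primes // ps_p.
apply: (adj_commute (x := meta_top p) (y := meta_base q)) => //; rewrite ?inE ?order_meta_base ?order_meta_top //.
rewrite /commute !metaM /= add0r !addr0 add0r (act_exp_mod power_order1).
suff -> : act_exp u (Mp p) (inZp (Np q) : 'I_n.+1) = inZp (Np q) by [].
apply/eqP; rewrite /act_exp mulrn_fix ?expn_gt0 ?(u_gt0 qs_q) // /= /dvdn modnMml -/(dvdn _ _).
rewrite (nM qs_q) mulnC dvdn_mul // -mod1 uP // prod_primes_dvdn //.
apply/allP=> p' ps_p'; apply/implyP=> Ep'q; rewrite dvdn_prod_primes ?pr_p // ps_p'.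
by apply: contraNneq nE_pq => <-.
Qed.

Lemma primes_meta t : prime t -> (t %| #|[set: J]|) = (t \in ps) || (t \in qs).
Proof.
by move=> pr_t; rewrite card_meta nE mE Euclid_dvdM // !dvdn_prod_primes // !andbT orbC.
Qed.

Section Character.

Variables (A B : pred nat) (r : nat).
Hypotheses (AB : forall p q, p \in ps -> q \in qs -> A p -> B q -> ~~ E p q).
Hypotheses (pr_r : prime r) (r1 : (\prod_(p <- ps) p * \prod_(q <- qs) q)%N %| r.-1).

Let mA := (\prod_(p <- ps | A p) p)%N.
Let mA' := (\prod_(p <- ps | ~~ A p) p)%N.
Let nB := (\prod_(q <- qs | B q) q)%N.

Let mA'_m : mA' %| m.+1.
Proof.
by rewrite prod_primes_dvdn //; apply/allP=> p ps_p; apply/implyP=> _; rewrite mE dvdn_prod_primes ?pr_p // ps_p.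
Qed.
Let mA_m : mA %| m.+1.
Proof.
by rewrite prod_primes_dvdn //; apply/allP=> p ps_p; apply/implyP=> _; rewrite mE dvdn_prod_primes ?pr_p // ps_p.
Qed.
Let nB_n : nB %| n.+1.
Proof.
by rewrite prod_primes_dvdn //; apply/allP=> p ps_p; apply/implyP=> _; rewrite nE dvdn_prod_primes ?pr_q // ps_p.
Qed.

(* The primes satisfying [A] commute with those satisfying [B], so [lam] below is
   multiplicative on the preimage of the top subgroup of order [mA]. *)
Let Cset := [set g : J | mA' %| g.2].
Let C_group_set : group_set Cset.
Proof.
apply/group_setP; split; first by rewrite inE.
by move=> g h; rewrite !inE metaM /= => Cg Ch; rewrite /dvdn modn_dvdm // -/(dvdn _ _) dvdn_add.
Qed.
Let C := Group C_group_set.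

(** The coordinates of an element are the exponents of roots of unity of orders [nB] and [mA]. For a
    prime outside [B] the base element of that order has value 1; for a prime outside [A] the top
    element of that order generates a group meeting [C] trivially. *)
Lemma meta_character : exists (C : {group J}) (lam : J -> 'F_r),
  [/\ lam 1 = 1%R, {in C &, forall c d, lam (c * d)%g = (lam c * lam d)%R},
      forall t, prime t -> t %| #|[set: J]| -> (if t \in ps then A t else B t) ->
        forall g, #[g] = t -> forall x, g ^ x \in C /\ lam (g ^ x) != 1%R &
      forall t, prime t -> t %| #|[set: J]| -> ~~ (if t \in ps then A t else B t) ->
        exists2 g, #[g] = t & {in C :&: <[g]>, forall c, lam c = 1%R}].
Proof.
have [||zeta zetaP] := @Fp_prim_root r nB => //.
  by apply: dvdn_trans r1; rewrite -nE dvdn_mull.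
have [||omega omegaP] := @Fp_prim_root r mA => //.
  by apply: dvdn_trans r1; rewrite -mE dvdn_mulr.
pose lam (g : J) := (zeta ^+ g.1 * omega ^+ g.2)%R.
have zeta_mod a : (zeta ^+ (a %% n.+1) = zeta ^+ a)%R.
  by rewrite -(prim_expr_mod zetaP) modn_dvdm // (prim_expr_mod zetaP).
have omega_mod a : (omega ^+ (a %% m.+1) = omega ^+ a)%R.
  by rewrite -(prim_expr_mod omegaP) modn_dvdm // (prim_expr_mod omegaP).
exists C, lam; split.
- by rewrite /lam /= !expr0 mulr1.
- move=> g h; rewrite !inE => Cg Ch; rewrite /lam metaM /=.
  rewrite zeta_mod omega_mod !exprD mulrACA -!mulrA; congr (_ * _)%R.
  rewrite mulrCA -[RHS]mulrCA; congr (_ * (_ * _))%R.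
  rewrite /act_exp Zp_mulrn /= zeta_mod.
  (* By [AB], the primes [p] with [E p q] for some [q] satisfying [B] fail [A], so they divide
     [mA']: elements of [C] act trivially modulo [nB]. *)
  have uy1 : (u ^ g.2 == 1 %[mod nB])%N.
    have [nB1 | [q qs_q]] : nB = 1%N \/ exists q, q \in qs.
      by rewrite /nB; case: (qs) => [|q s]; [left; rewrite big_nil | right; exists q; rewrite mem_head].
      by rewrite nB1 !modn1.
    rewrite eqn_mod_dvd ?expn_gt0 ?(u_gt0 qs_q) // prod_primes_dvdn //.
    apply/allP=> q' qs_q'; apply/implyP=> Bq'.
    rewrite -eqn_mod_dvd ?expn_gt0 ?(u_gt0 qs_q) // uP //; apply: dvdn_trans Cg.
    rewrite prod_primes_dvdn //; apply/allP=> p ps_p; apply/implyP=> Epq.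
    rewrite dvdn_prod_primes ?pr_p // ps_p /=; apply: contraL Epq => Ap; exact: AB Ap Bq'.
  by rewrite -(prim_expr_mod zetaP (_ * _)) -modnMmr (eqP uy1) modnMmr muln1 (prim_expr_mod zetaP).
- move=> t pr_t; rewrite primes_meta // => t_J St g og x; rewrite inE meta_snd_conj.
  have ogx : #[g ^ x] = t by rewrite orderJ.
  have [ps_t | ps't] := boolP (t \in ps).
    rewrite ps_t in St; have [g_t t'g] := meta_order_top ps_t og.
    split.
      apply: dvdn_trans g_t; rewrite prod_primes_dvdn //; apply/allP=> p ps_p; apply/implyP=> nAp.
      by rewrite dvdn_prod_primes ?pr_p // ps_p; apply: contraNneq nAp => ->.
    rewrite /lam meta_snd_conj; apply: contra t'g => /eqP l1.
    (* This power removes the factor coming from [zeta], and [t], being in [ps], does not divide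
       [nB]. *)
    have := congr1 (fun a => a ^+ nB)%R l1.
    rewrite exprMn expr1n exprAC (prim_expr_order zetaP) expr1n mul1r -exprM => /eqP.
    rewrite -(prim_order_dvd omegaP) => d.
    have : t %| g.2 * nB by apply: dvdn_trans d; rewrite dvdn_prod_primes // ps_t.
    rewrite Euclid_dvdM // dvdn_prod_primes // => /orP[// | /andP[/ps'q]].
    by rewrite ps_t.
  rewrite (negPf ps't) /= in t_J; rewrite (negPf ps't) in St.
  have [g2 _ _] := meta_order_base t_J og; have [gx2 _ t'gx] := meta_order_base t_J ogx.
  rewrite g2 dvdn0 /lam gx2 expr0 mulr1 -(prim_order_dvd zetaP); split=> //.
  apply: contra t'gx; apply: dvdn_trans.
  by rewrite dvdn_prod_primes // t_J.
move=> t pr_t; rewrite primes_meta // => t_J nSt.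
have [ps_t | ps't] := boolP (t \in ps).
  rewrite ps_t in nSt; exists (meta_top t); first exact: order_meta_top.
  move=> c; rewrite !inE => /andP[Cc /cycleP[k def_c]].
  suff -> : c = 1 by rewrite /lam /= !expr0 mulr1.
  rewrite def_c; apply/eqP; rewrite -order_dvdn order_meta_top //.
  move: Cc; rewrite def_c meta_top_exp Zp_mulrn /= => Cc.
  have t_mA' : t %| mA' by rewrite dvdn_prod_primes // ps_t.
  have t_m : t %| m.+1 by rewrite mE dvdn_prod_primes // ps_t.
  have dm a : (t %| a %% m.+1) = (t %| a) by rewrite /dvdn modn_dvdm.
  have := dvdn_trans t_mA' Cc; rewrite dm Euclid_dvdM // dm dvdn_prod_primes //.
  by rewrite eqxx andbF.
rewrite (negPf ps't) /= in t_J; rewrite (negPf ps't) in nSt.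
exists (meta_base t); first exact: order_meta_base.
move=> c; rewrite !inE => /andP[_ /cycleP[k ->]].
rewrite meta_base_exp /lam /= expr0 mulr1 Zp_mulrn /= zeta_mod.
apply/eqP; rewrite -(prim_order_dvd zetaP) dvdn_mulr //.
rewrite /dvdn modn_dvdm // -/(dvdn _ _) prod_primes_dvdn //; apply/allP=> q qs_q; apply/implyP=> Bq.
by rewrite dvdn_prod_primes ?pr_q // qs_q; apply: contraNneq nSt => <-.
Qed.

End Character.

End WithExponent.

End Frobenius.

(** * Realisation of graphs *)

Section Product.

Variables jT kT : finGroupType.
Local Notation L := [set: (jT * kT)%type].

Lemma pair_expg (z : (jT * kT)%type) k : z ^+ k = (z.1 ^+ k, z.2 ^+ k).
Proof. by elim: k => // k IHk; rewrite !expgS IHk. Qed.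

Lemma card_prodT : #|L| = (#|[set: jT]| * #|[set: kT]|)%N.
Proof. by rewrite !cardsT card_prod. Qed.

Lemma adj_prodl t t' : prime t -> prime t' -> t != t' ->
  ~~ (t %| #|[set: kT]|) -> ~~ (t' %| #|[set: kT]|) -> adj L t t' = adj [set: jT] t t'.
Proof.
move=> pr_t pr_t' neq Kt Kt'; apply/idP/idP=> [/adjP[] // x [y [_ _ cxy ox oy]] | ].
  have o1 (z : (jT * kT)%type) s : prime s -> ~~ (s %| #|[set: kT]|) -> #[z] = s -> #[fst z] = s.
    move=> pr_s Ks oz; have [z1s z2s] : z.1 ^+ s = 1 /\ z.2 ^+ s = 1.
      by have := pair_expg z s; rewrite -{1}oz expg_order => -[<- <-].
    apply: nt_prime_order => //.
    apply: contra Ks => /eqP z1; have : #[snd z] %| s.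
      by rewrite order_dvdn z2s.
    have /primeP[_ P] := pr_s; case/P/orP=> /eqP o2; last by rewrite -o2 order_dvdG ?inE.
    move/eqP: o2; rewrite order_eq1 => /eqP z2.
    by move: pr_s; rewrite -oz [z]surjective_pairing z1 z2 order1.
  apply: (adj_commute (x := x.1) (y := y.1)) => //; rewrite ?inE ?(o1 x t) ?(o1 y t') //.
  exact: (congr1 fst cxy).
rewrite -(adj_injm _ _ (injm_pairg1 jT kT) (subxx _)); exact: adjS (subsetT _).
Qed.

Lemma adj_prodr t t' : prime t -> prime t' -> t != t' ->
  ~~ (t %| #|[set: jT]|) -> ~~ (t' %| #|[set: jT]|) -> adj L t t' = adj [set: kT] t t'.
Proof.
move=> pr_t pr_t' neq Kt Kt'; apply/idP/idP=> [/adjP[] // x [y [_ _ cxy ox oy]] | ].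
  have o1 (z : (jT * kT)%type) s : prime s -> ~~ (s %| #|[set: jT]|) -> #[z] = s -> #[snd z] = s.
    move=> pr_s Ks oz; have [z1s z2s] : z.1 ^+ s = 1 /\ z.2 ^+ s = 1.
      by have := pair_expg z s; rewrite -{1}oz expg_order => -[<- <-].
    apply: nt_prime_order => //.
    apply: contra Ks => /eqP z1; have : #[fst z] %| s.
      by rewrite order_dvdn z1s.
    have /primeP[_ P] := pr_s; case/P/orP=> /eqP o2; last by rewrite -o2 order_dvdG ?inE.
    move/eqP: o2; rewrite order_eq1 => /eqP z2.
    by move: pr_s; rewrite -oz [z]surjective_pairing z1 z2 order1.
  apply: (adj_commute (x := x.2) (y := y.2)) => //; rewrite ?inE ?(o1 x t) ?(o1 y t') //.
  exact: (congr1 snd cxy).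
rewrite -(adj_injm _ _ (injm_pair1g jT kT) (subxx _)); exact: adjS (subsetT _).
Qed.

Lemma adj_prod t t' : prime t -> prime t' -> t != t' ->
  t %| #|[set: jT]| -> t' %| #|[set: kT]| -> adj L t t'.
Proof.
move=> pr_t pr_t' neq Jt Kt'.
have [x _ ox] := Cauchy pr_t Jt; have [y _ oy] := Cauchy pr_t' Kt'.
apply: (adj_commute (x := pairg1 kT x) (y := pair1g jT y)) => //; rewrite ?inE //.
- by rewrite /commute /pairg1 /pair1g; congr (_, _); rewrite ?mulg1 ?mul1g.
- by rewrite (order_injm (injm_pairg1 _ _)) ?inE // ox.
by rewrite (order_injm (injm_pair1g _ _)) ?inE // oy.
Qed.

Lemma good_prod : solvable [set: jT] -> good [set: kT]%G -> good [set: (jT * kT)%type]%G.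
Proof.
move=> solJ goodK; apply: (good_ext (f := snd_morphism jT kT) (subsetT _)).
  have sub : 'ker_L (snd_morphism jT kT) \subset pairg1 kT @* [set: jT].
    apply/subsetP=> -[x y]; rewrite inE => /andP[_ /(kerP _ (in_setT _)) /= y1].
    by rewrite -[y]/(snd (x, y)) y1; apply/morphimP; exists x; rewrite ?inE.
  exact: solvableS sub (morphim_sol _ solJ).
rewrite (_ : (_ @* _)%G = [set: kT]%G) //; apply/val_inj/setP=> y /=; rewrite inE.
by apply/morphimP; exists (1, y); rewrite ?inE.
Qed.

End Product.

(** * Modules of [PSL(2,7)] without fixed vectors of elements of order 7 *)

Section PSLModule.

Variables (kT : finGroupType) (r : nat).
Hypotheses (factsK : PSL27_facts [set: kT]%G) (pr_r : prime r) (r_big : 168 < r).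

Let inF a b : a < r -> b < r -> (a%:R == b%:R :> 'F_r)%R = (a == b).
Proof.
by move=> ar br; rewrite -(inj_eq val_inj) /= !val_Fp_nat // !modn_small.
Qed.

(* [7 * 1_S - 1] for a subgroup [S] of order [24], a complement to every Sylow
   [7]-subgroup. *)
Lemma PSL_module : exists w : kT -> 'F_r,
  [/\ w 1 = 6%:R%R, forall y, w y = 6%:R%R \/ w y = (-1)%R &
      forall v, #[v] = 7 -> forall y, (\sum_(i < 7) w (y * v ^+ i)%g)%R = 0%R].
Proof.
have [cardK _ _ [S [_ cardS]]] := factsK.
pose w (y : kT) : 'F_r := (if y \in S then 6%:R else -1)%R.
exists w; split; first by rewrite /w group1.
  by move=> y; rewrite /w; case: ifP; [left | right].
move=> v ov y.
have ti : S :&: <[v]> = 1 by apply: coprime_TIg; rewrite -orderE cardS ov.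
have defK : S * <[v]> = [set: kT].
  apply/eqP; rewrite eqEcard subsetT /= TI_cardMg // -orderE cardS ov.
  by move: cardK; rewrite /= => ->.
have /mulsgP[s vj Ss vvj def_y] : y \in S * <[v]> by rewrite defK inE.
have /cyclePmin[k] : vj^-1 \in <[v]> by rewrite groupV.
rewrite ov => k7 def_k; have Sk : y * v ^+ k = s by rewrite def_y -def_k mulgK.
rewrite (bigD1 (Ordinal k7)) //= Sk {1}/w Ss.
rewrite (eq_bigr (fun _ => -1)%R); last first.
  move=> i neq_ik; rewrite /w ifN //; apply: contra neq_ik => Si.
  have : s^-1 * (y * v ^+ i) \in S :&: <[v]>.
    rewrite inE groupM ?groupV //= def_y !mulgA mulVg mul1g groupM //.
    exact: mem_cycle.
  rewrite ti => /set1P; rewrite -Sk invMg -!mulgA mulKg => /eqP.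
  by rewrite -eq_mulVg1 eq_sym eq_expg_mod_order ov !modn_small // -val_eqE.
rewrite sumr_const cardC1 card_ord /= mulNrn.
by rewrite subrr.
Qed.

Lemma PSL_nt : exists w : kT -> 'F_r, (exists z, w z != 0%R) /\
  forall v, pred1 7 #[v] -> forall y, (\sum_(i < #[v]) w (y * v ^+ i)%g)%R = 0%R.
Proof.
have [w [w1 _ w7]] := PSL_module; exists w; split.
  by exists 1; rewrite w1 (inF (b := 0)) // (leq_trans _ r_big).
by move=> v /eqP ov y; rewrite ov w7.
Qed.

(** Summing [w] over [<[g]>] gives an invariant function. Its value at 1 is [7 * k - t] with
    [k <= t <= 3]; both terms are below [r], and their equality would make 7 divide [t]. *)
Lemma PSL_fix t : prime t -> t %| #|[set: kT]| -> ~~ pred1 7 t ->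
  exists (g : kT) (w : kT -> 'F_r), [/\ #[g] = t, exists z, w z != 0%R, forall y, w (y * g) = w y &
    forall v, pred1 7 #[v] -> forall y, (\sum_(i < #[v]) w (y * v ^+ i)%g)%R = 0%R].
Proof.
move=> pr_t Kt; rewrite /= => t7; have [w [w1 wv w7]] := PSL_module.
have t3 : t <= 3.
  have := dvdn_K factsK pr_t; rewrite Kt !inE (negPf t7) orbF => /esym/orP[] /eqP-> //.
have [g _ og] := Cauchy pr_t Kt.
exists g, (fun y => \sum_(h in <[g]>) w (y * h)%g)%R; split=> //.
- exists 1; pose k := #|[set h in <[g]> | w h == 6%:R%R]|.
  have -> : (\sum_(h in <[g]>) w (1 * h)%g = (7 * k)%:R - t%:R)%R.
    under eq_bigr => h _ do rewrite mul1g.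
    have wE h : (w h = 7%:R *+ (w h == 6%:R%R) - 1)%R.
      case: eqP => [-> | ]; first exact: (natrB _ (isT : 1 <= 7)).
      by case: (wv h) => -> //; rewrite mulr0n add0r.
    under eq_bigr => h _ do rewrite wE.
    rewrite big_split /= sumr_const -orderE og mulNrn; congr (_ - _)%R.
    rewrite sumrMnr -mulrnA; congr (1 *+ (7 * _))%R.
    by rewrite /k -sum1dep_card big_mkcondr; apply: eq_bigr => h _; case: eqP.
  rewrite subr_eq0 inF; last first.
  - by apply: leq_trans r_big; apply: leq_ltn_trans t3 _.
  - apply: leq_ltn_trans (_ : 21 < r); last exact: leq_trans r_big.
    rewrite (leq_mul2l 7 k 3) /=; apply: leq_trans t3; rewrite -og orderE.
    by apply/subset_leq_card/subsetP=> h; rewrite inE => /andP[].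
  apply/eqP=> def_t; have : 7 <= t by apply: dvdn_leq (prime_gt0 pr_t) _; rewrite -def_t dvdn_mulr.
  by rewrite leqNgt (leq_ltn_trans t3).
- move=> y; rewrite [RHS](reindex_inj (mulgI g)) /=.
  by apply: eq_big => h; rewrite ?groupMl ?cycle_id ?mulgA.
move=> v /eqP ov y; rewrite exchange_big /= big1 // => h _; rewrite ov.
have := w7 (v ^ h); rewrite orderJ => /(_ ov (y * h)%g) sum0; rewrite -[RHS]sum0.
by apply: eq_bigr => i _; rewrite -conjXg -!mulgA -conjgC.
Qed.

End PSLModule.

Lemma metacyclic_exists (ps qs : seq nat) (E : rel nat) :
  all prime ps -> uniq ps -> all prime qs -> uniq qs ->
  (forall q, q \in qs -> q \notin ps) ->
  (forall q, q \in qs -> \prod_(p <- ps) p %| q.-1) ->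
  exists J : finGroupType,
  [/\ solvable [set: J],
      forall t, prime t -> (t %| #|[set: J]|) = (t \in ps) || (t \in qs),
      {in ps &, forall p p', p != p' -> adj [set: J] p p'} /\
      {in qs &, forall q q', q != q' -> adj [set: J] q q'},
      {in ps & qs, forall p q, adj [set: J] p q = ~~ E p q} &
      forall (A B : pred nat) r, {in ps & qs, forall p q, A p -> B q -> ~~ E p q} ->
        prime r -> (\prod_(p <- ps) p * \prod_(q <- qs) q)%N %| r.-1 ->
        exists (C : {group J}) (lam : J -> 'F_r),
        [/\ lam 1 = 1%R, {in C &, forall c d, lam (c * d)%g = (lam c * lam d)%R},
          forall t, prime t -> t %| #|[set: J]| -> (if t \in ps then A t else B t) ->
            forall g, #[g] = t -> forall x, g ^ x \in C /\ lam (g ^ x) != 1%R &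
          forall t, prime t -> t %| #|[set: J]| -> ~~ (if t \in ps then A t else B t) ->
            exists2 g, #[g] = t & {in C :&: <[g]>, forall c, lam c = 1%R}]].
Proof.
move=> pr_ps ups pr_qs uqs ps'q q1.
have [u uP] := power_exists E pr_ps ups pr_qs uqs q1.
exists (metacyclic_type (power_order1 pr_ps ups pr_qs uqs uP)); split.
- exact: meta_solvable.
- by move=> t pr_t; rewrite primes_meta.
- by split=> p p' *; [apply: adj_meta_top | apply: adj_meta_base].
- by move=> p q *; apply: adj_meta.
by move=> A B r AB pr_r r1; apply: meta_character.
Qed.

Section MetacyclicProduct.

Variables (kT : finGroupType) (ps qs rs : seq nat) (E : rel nat) (SK : nat -> pred nat).
Local Notation K := [set: kT]%G.
Hypotheses (goodK : good K) (pr_ps : all prime ps) (pr_qs : all prime qs) (pr_rs : all prime rs).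
Hypotheses (ups : uniq ps) (uqs : uniq qs) (urs : uniq rs).
Hypotheses (ps'q : forall q, q \in qs -> q \notin ps)
  (rs' : forall r, r \in rs -> (r \notin ps) && (r \notin qs)).
Hypothesis K' : forall t, t \in ps ++ qs ++ rs -> ~~ (t %| #|K|).
Hypotheses (q1 : forall q, q \in qs -> \prod_(p <- ps) p %| q.-1)
  (r1 : forall r, r \in rs -> (\prod_(p <- ps) p * \prod_(q <- qs) q)%N %| r.-1).
Hypothesis E3 : forall p q r, p \in ps -> q \in qs -> r \in rs -> E p r -> E q r -> ~~ E p q.
Hypothesis K_fix : forall r, r \in rs -> forall t, prime t -> t %| #|K| -> ~~ SK r t ->
  exists (g : kT) (w : kT -> 'F_r), [/\ #[g] = t, exists z, w z != 0%R, forall y, w (y * g) = w y &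
    forall v, SK r #[v] -> forall y, (\sum_(i < #[v]) w (y * v ^+ i)%g)%R = 0%R].
Hypothesis K_nt : forall r, r \in rs -> exists w : kT -> 'F_r, (exists z, w z != 0%R) /\
    forall v, SK r #[v] -> forall y, (\sum_(i < #[v]) w (y * v ^+ i)%g)%R = 0%R.

(** Triangle-freeness enters through [E3]: a prime of [ps] and one of [qs] that must both act
    without fixed vectors on the module for [r] are adjacent, as the construction of the character
    requires. *)
Lemma metacyclic_product_with_sinks : exists (gT : finGroupType) (G : {group gT}),
  [/\ good G,
    forall t, prime t -> (t %| #|G|) = (t %| #|K|) || (t \in ps ++ qs ++ rs),
    [/\ forall t t', prime t -> prime t' -> t != t' -> t %| #|K| -> t' %| #|K| -> adj G t t' = adj K t t',
        forall t s, prime t -> t %| #|K| -> s \in ps ++ qs -> adj G t s &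
        forall t r, prime t -> t %| #|K| -> r \in rs -> adj G t r = ~~ SK r t],
    [/\ {in ps &, forall p p', p != p' -> adj G p p'},
        {in qs &, forall q q', q != q' -> adj G q q'} &
        {in rs &, forall r r', r != r' -> adj G r r'}] &
    [/\ {in ps & qs, forall p q, adj G p q = ~~ E p q},
        {in ps & rs, forall p r, adj G p r = ~~ E p r} &
        {in qs & rs, forall q r, adj G q r = ~~ E q r}]].
Proof.
have [J [solJ primesJ [adj_ps adj_qs] adj_pq charJ]] := metacyclic_exists E pr_ps ups pr_qs uqs ps'q q1.
have prJ t : t \in ps ++ qs -> prime t.
  by rewrite mem_cat => /orP[]; [move/(allP pr_ps) | move/(allP pr_qs)].
have Jt t : t \in ps ++ qs -> t %| #|[set: J]|.
  by move=> psq; rewrite primesJ ?prJ // -mem_cat.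
have KJ t : t \in ps ++ qs -> ~~ (t %| #|K|).
  by move=> psq; apply: K'; rewrite catA mem_cat psq.
have JK t : prime t -> t %| #|K| -> ~~ (t %| #|[set: J]|).
  by move=> pr_t; apply: contraL; rewrite primesJ // -mem_cat => /KJ.
have rsP r : r \in rs -> [/\ prime r, ~~ (r %| #|[set: J]|) & ~~ (r %| #|K|)].
  move=> rsr; have pr_r := allP pr_rs _ rsr; split=> //.
    by rewrite primesJ // negb_or rs'.
  by apply: K'; rewrite !mem_cat rsr !orbT.
have coJK : coprime #|[set: J]| #|K|.
  rewrite coprime_has_primes ?cardG_gt0 //; apply/hasPn=> t.
  by rewrite !mem_primes => /and3P[pr_t _ Kt]; rewrite (negPf (JK t pr_t Kt)) !andbF.
pose L := [set: (J * kT)%type]%G.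
have oL : #|L| = (#|[set: J]| * #|K|)%N := card_prodT J kT.
have goodL : good L := good_prod solJ goodK.
(* The inner branches coincide; this is the form in which [charJ] states its conclusion when both
   its predicates are [E^~ r]. *)
pose S r t := if t %| #|[set: J]| then (if t \in ps then E t r else E t r) else SK r t.
have [r rsr | gT [G [phi [[_ goodG] [m oG mP] adjL adj_rs adj_rt]]]] := add_sinks (rs := rs) (S := S) goodL urs.
  have [pr_r r'J r'K] := rsP r rsr; split=> //; first by rewrite oL Euclid_dvdM // negb_or r'J.
  have [p q psp qsq Er Er' | C [lam [lam1 lamM lam_reg lam_fix]]] := charJ (E^~ r) (E^~ r) r _ pr_r (r1 rsr).
    exact: E3 rsr Er Er'.
  exact: (module_exists (S := fun t => if t \in ps then E t r else E t r) pr_r r'J r'K coJK lam1 lamM lam_reg lam_fix (K_fix rsr) (K_nt rsr)).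
have SE r t : t \in ps ++ qs -> S r t = E t r by move=> /Jt Jt'; rewrite /S Jt'; case: ifP.
have SKE r t : prime t -> t %| #|K| -> S r t = SK r t.
  by move=> pr_t Kt; rewrite /S (negPf (JK t pr_t Kt)).
have LJ t : t \in ps ++ qs -> t %| #|L| by move=> /Jt; rewrite oL; apply: dvdn_mulr.
have LK t : t %| #|K| -> t %| #|L| by rewrite oL; apply: dvdn_mull.
have adjJ t t' : t \in ps ++ qs -> t' \in ps ++ qs -> t != t' -> adj G t t' = adj [set: J] t t'.
  by move=> st st' neq; rewrite adjL ?adj_prodl ?LJ ?prJ ?KJ.
have inP p : p \in ps -> p \in ps ++ qs by rewrite mem_cat => ->.
have inQ q : q \in qs -> q \in ps ++ qs by rewrite mem_cat orbC => ->.
have neq_pq p q : p \in ps -> q \in qs -> p != q.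
  by move=> psp qsq; apply: contraTneq psp => ->; apply: ps'q.
exists gT, G; split=> //.
- move=> t pr_t; rewrite oG Euclid_dvdM // oL Euclid_dvdM // mP // primesJ // !mem_cat.
  by case: (t %| #|_|); rewrite ?orbT //= orbF -orbA.
- split=> [t t' pr_t pr_t' neq Kt Kt' | t s pr_t Kt ss | t r pr_t Kt rsr].
  + by rewrite adjL ?adj_prodr ?LK ?JK.
  + have neq : t != s by apply: contraTneq Kt => ->; apply: KJ.
    by rewrite adjL ?(LK t) ?(LJ s) ?(prJ s) // adjC adj_prod ?(prJ s) ?Jt // eq_sym.
  by rewrite adjC adj_rt ?LK // SKE.
- split=> [p p' sp sp' neq | q q' sq sq' neq | //].
  + by rewrite adjJ ?inP ?adj_ps.
  by rewrite adjJ ?inQ ?adj_qs.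
split=> [p q sp sq | p r sp sr | q r sq sr].
- by rewrite adjJ ?(inP p) ?(inQ q) ?adj_pq ?neq_pq.
- by rewrite adjC adj_rt ?(LJ p) ?(inP p) ?(prJ p) ?(inP p) // SE ?(inP p).
by rewrite adjC adj_rt ?(LJ q) ?(prJ q) ?(inQ q) // SE ?(inQ q).
Qed.

End MetacyclicProduct.

Lemma choose_primes (T : finType) n M : 0 < n -> exists2 f : T -> nat, injective f &
  forall x, [/\ prime (f x), M < f x & n %| (f x).-1].
Proof.
move=> n_gt0; suff [f injf fP] : exists2 f : T -> nat, {in enum T &, injective f} &
    {in enum T, forall x, [/\ prime (f x), M < f x & n %| (f x).-1]}.
  by exists f => [x y | x]; [apply: injf | apply: fP]; rewrite mem_enum.
elim: (enum T) => [|a s [f injf fP]]; first by exists (fun=> 0).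
have [q [pr_q q_gt n_q]] := dirichlet1 (maxn M (\max_(x <- s) f x)) n_gt0.
have [Mq sq] : M < q /\ forall x, x \in s -> f x < q.
  split; first by apply: leq_ltn_trans q_gt; rewrite leq_maxl.
  move=> x sx; apply: leq_ltn_trans q_gt; rewrite leq_max; apply/orP; right.
  exact: leq_bigmax_seq.
exists (fun x => if x \in s then f x else q).
  have E x : x \in a :: s -> x \notin s -> x = a by rewrite inE => /predU1P[-> // | ->].
  move=> x y ax ay; case: ifP => sx; case: ifP => sy; first exact: injf.
  - by move=> fq; have := sq x sx; rewrite fq ltnn.
  - by move=> fq; have := sq y sy; rewrite -fq ltnn.
  by rewrite (E x) ?sx // (E y) ?sy.
by move=> x _; case: ifP => [/fP | _].
Qed.

(** * From a coloured graph to a group *)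

Section ColouredGraph.

Variables (T : finType) (e : rel T) (kT : finGroupType) (X : {set T}) (pX : T -> nat).
Variables (col : T -> 'I_3) (k0 : 'I_3) (SK : T -> pred nat).
Local Notation K := [set: kT]%G.
Local Notation ebar := (graph_compl e).

Hypotheses (e_sym : symmetric e) (e_irr : irreflexive e) (goodK : good K).
Hypotheses (pX_inj : {in X &, injective pX}) (pX_prime : {in X, forall x, prime (pX x)})
  (pX_onto : forall t, prime t -> (t %| #|K|) = [exists x in X, pX x == t]).
Hypothesis eX : {in X &, forall x y, x != y -> adj K (pX x) (pX y) = e x y}.
Hypothesis col_proper : forall x y, x \notin X -> y \notin X -> ebar x y -> col x != col y.
Hypothesis no_triangle : forall x y z, x \notin X -> y \notin X -> z \notin X -> ~~ triangle ebar x y z.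
Hypothesis eX_col : forall x y, x \in X -> y \notin X -> col y != k0 -> e x y.
Hypothesis eX_sink : forall x y, x \in X -> y \notin X -> col y = k0 -> e x y = ~~ SK y (pX x).
Hypothesis K_fix : forall y r, prime r -> #|K| < r -> forall t, prime t -> t %| #|K| -> ~~ SK y t ->
  exists (g : kT) (w : kT -> 'F_r), [/\ #[g] = t, exists z, w z != 0%R, forall y, w (y * g) = w y &
    forall v, SK y #[v] -> forall y, (\sum_(i < #[v]) w (y * v ^+ i)%g)%R = 0%R].
Hypothesis K_nt : forall y r, prime r -> #|K| < r -> exists w : kT -> 'F_r, (exists z, w z != 0%R) /\
    forall v, SK y #[v] -> forall y, (\sum_(i < #[v]) w (y * v ^+ i)%g)%R = 0%R.

(** Serves for [X] empty with [K] trivial, and for [X] the triangle with [K] a copy of [PSL(2,7)].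
    The colour [k0] is realised last, by modules: the direct product makes [K] adjacent to the
    primes of the two other colours, which is why [eX_col] is assumed. *)
Lemma coloured_graph_realizable : exists (gT : finGroupType) (G : {group gT}),
  pseudo_PSL27_solvable G /\ graph_iso e (prime_graph G).
Proof.
have [k1] := third_colour k0 k0; rewrite andbb => k10.
have [k2 /andP[k20 k21]] := third_colour k0 k1.
have k3 k : k != k1 -> k != k2 -> k = k0.
  move=> kk1 kk2; apply/eqP; apply: contraT => kk0.
  have: size [:: k; k0; k1; k2] <= size (enum 'I_3).
    apply: uniq_leq_size => [|i _]; last by rewrite mem_enum.
    by rewrite /= !inE !negb_or kk0 kk1 kk2 [k0 == k1]eq_sym [k0 == k2]eq_sym [k1 == k2]eq_sym k10 k20 k21.
  by rewrite size_enum_ord.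
pose D1 := [seq x <- enum T | (x \notin X) && (col x == k1)].
pose D2 := [seq x <- enum T | (x \notin X) && (col x == k2)].
pose D3 := [seq x <- enum T | (x \notin X) && (col x == k0)].
have mD k x : x \in [seq x <- enum T | (x \notin X) && (col x == k)] = (x \notin X) && (col x == k).
  by rewrite mem_filter mem_enum andbT.
have [f1 f1i f1P] := choose_primes T #|K| (ltn0Sn 0).
pose N1 := (\prod_(p <- map f1 D1) p)%N.
have N1_gt0 : 0 < N1 by rewrite /N1 big_map prodn_gt0 // => x; have [/prime_gt0] := f1P x.
have [f2 f2i f2P] := choose_primes T (#|K| + N1) N1_gt0.
pose N2 := (\prod_(p <- map f2 D2) p)%N.
have N2_gt0 : 0 < N2 by rewrite /N2 big_map prodn_gt0 // => x; have [/prime_gt0] := f2P x.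
have N12_gt0 : 0 < N1 * N2 by rewrite muln_gt0 N1_gt0.
have [f3 f3i f3P] := choose_primes T (#|K| + N1 * N2) N12_gt0.
have f1_le x : x \in D1 -> f1 x <= N1.
  move=> Dx; apply: dvdn_leq => //; rewrite /N1 big_map (big_rem x) //=; exact: dvdn_mulr.
have f2_le x : x \in D2 -> f2 x <= N1 * N2.
  move=> Dx; apply: dvdn_leq => //; apply: dvdn_mull; rewrite /N2 big_map (big_rem x) //=; exact: dvdn_mulr.
(* Levels 0 to 3 are [X] and the colours [k1], [k2], [k0]. The primes increase with the level, which
   separates the levels, and a pair of vertices may be assumed ordered by level. *)
pose lv x : nat := (if x \in X then 0 else if col x == k1 then 1 else if col x == k2 then 2 else 3)%N.
pose pr x := if x \in X then pX x else if col x == k1 then f1 x else if col x == k2 then f2 x else f3 x.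
have lvP x : [\/ [/\ lv x = 0, x \in X & pr x = pX x], [/\ lv x = 1%N, x \in D1 & pr x = f1 x],
                 [/\ lv x = 2, x \in D2 & pr x = f2 x] | [/\ lv x = 3, x \in D3 & pr x = f3 x]].
  rewrite /lv /pr !mD; case: (boolP (x \in X)) => Xx; first by constructor 1.
  case: (boolP (col x == k1)) => c1; first by constructor 2.
  case: (boolP (col x == k2)) => c2; first by constructor 3.
  by constructor 4; split=> //; rewrite /= (k3 (col x)).
have pXK x : x \in X -> pX x %| #|K|.
  by move=> Xx; rewrite pX_onto ?pX_prime //; apply/exists_inP; exists x.
have pXle x : x \in X -> pX x <= #|K| by move=> /pXK; apply: dvdn_leq; apply: cardG_gt0.
have b1 x : #|K| < f1 x by case: (f1P x).
have b2 x : #|K| + N1 < f2 x by case: (f2P x).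
have b3 x : #|K| + N1 * N2 < f3 x by case: (f3P x).
have lt_pr x y : lv x < lv y -> pr x < pr y.
  case: (lvP x) => -[-> Hx ->]; case: (lvP y) => -[-> Hy ->] // _.
  - exact: leq_ltn_trans (pXle _ Hx) (b1 y).
  - exact: leq_ltn_trans (leq_trans (pXle _ Hx) (leq_addr _ _)) (b2 y).
  - exact: leq_ltn_trans (leq_trans (pXle _ Hx) (leq_addr _ _)) (b3 y).
  - exact: leq_ltn_trans (leq_trans (f1_le _ Hx) (leq_addl _ _)) (b2 y).
  - apply: leq_ltn_trans (leq_trans (f1_le _ Hx) _) (b3 y).
    exact: leq_trans (leq_pmulr N1 N2_gt0) (leq_addl _ _).
  exact: leq_ltn_trans (leq_trans (f2_le _ Hx) (leq_addl _ _)) (b3 y).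
have pr_inj : injective pr.
  move=> x y eq_xy; have := lt_pr x y; have := lt_pr y x; rewrite eq_xy ltnn.
  move: eq_xy; case: (lvP x) => -[-> Hx ->]; case: (lvP y) => -[-> Hy ->] eq_xy lt_yx lt_xy;
    try by [have := lt_yx isT | have := lt_xy isT].
  - exact: pX_inj.
  - exact: f1i.
  - exact: f2i.
  exact: f3i.
have pr_prime x : prime (pr x).
  by case: (lvP x) => -[_ Xx ->]; [exact: pX_prime | case: (f1P x) | case: (f2P x) | case: (f3P x)].
pose E s t := [exists x, exists y, [&& pr x == s, pr y == t & ebar x y]].
have EE x y : E (pr x) (pr y) = ebar x y.
  apply/idP/idP=> [/existsP[x' /existsP[y' /and3P[/eqP/pr_inj-> /eqP/pr_inj->]]] // | exy].
  by apply/existsP; exists x; apply/existsP; exists y; rewrite !eqxx.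
(* The predicates [SK] transported from vertices to primes; a number that is not the prime of a
   vertex receives [pred0]. *)
pose SKr r := if [pick y | pr y == r] is Some y then SK y else pred0.
have SKE y : SKr (pr y) = SK y.
  by rewrite /SKr; case: pickP => [z /eqP/pr_inj-> // | /(_ y)]; rewrite eqxx.
have e1 : map f1 D1 = map pr D1.
  by apply/eq_in_map => x; rewrite mD /pr => /andP[/negPf-> ->].
have e2 : map f2 D2 = map pr D2.
  by apply/eq_in_map => x; rewrite mD /pr => /andP[/negPf-> /eqP->]; rewrite (negPf k21) eqxx.
have pr3 x : x \in D3 -> pr x = f3 x.
  by rewrite mD /pr => /andP[/negPf-> /eqP->]; rewrite ![k0 == _]eq_sym (negPf k10) (negPf k20).
have prD (D : seq T) : all prime (map pr D) by apply/allP=> _ /mapP[x _ ->].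
have uD (D : seq T) : uniq D -> uniq (map pr D) by rewrite map_inj_uniq.
have big x : x \notin X -> #|K| < pr x.
  move=> X'x; rewrite /pr (negPf X'x); do 2!case: ifP => // _.
  - exact: leq_ltn_trans (leq_addr _ _) (b2 x).
  exact: leq_ltn_trans (leq_addr _ _) (b3 x).
have X'K x : x \notin X -> ~~ (pr x %| #|K|).
  by move=> X'x; apply: contraL (big x X'x) => /(dvdn_leq (cardG_gt0 K)); rewrite -leqNgt.
have mem_pr x (D : seq T) : (pr x \in map pr D) = (x \in D) by rewrite mem_map.
have [|||||||||||||||gT [G [goodG primesG [adjKK adjKJ adjKr] [adj11 adj22 adj33] [adj12 adj13 adj23]]]] :=
  @metacyclic_product_with_sinks kT (map pr D1) (map pr D2) (map pr D3) E SKr.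
all: try by [|exact: prD|apply: uD; rewrite filter_uniq ?enum_uniq].
- move=> q /mapP[x Dx ->]; rewrite mem_pr mD; move: Dx; rewrite mD => /andP[-> /eqP->].
  by rewrite (negPf k21).
- move=> q /mapP[x Dx ->]; rewrite !mem_pr !mD; move: Dx; rewrite mD => /andP[-> /eqP->].
  by rewrite ![k0 == _]eq_sym k10 k20.
- move=> t; rewrite -!map_cat => /mapP[x Dx ->]; apply: X'K.
  by move: Dx; rewrite !mem_cat !mD => /or3P[] /andP[].
- by move=> q; rewrite -e1 -e2 => /mapP[x _ ->]; case: (f2P x).
- by move=> q /mapP[x Dx ->]; rewrite -e1 -e2 pr3 //; case: (f3P x).
- move=> _ _ _ /mapP[x Dx ->] /mapP[y Dy ->] /mapP[z Dz ->]; rewrite !EE => xz yz.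
  apply/negP=> xy; have := no_triangle (x := x) (y := y) (z := z).
  move: Dx Dy Dz; rewrite !mD => /andP[-> _] /andP[-> _] /andP[-> _] /(_ isT isT isT).
  by rewrite /triangle xy yz xz.
- move=> _ /mapP[x + ->]; rewrite mD SKE => /andP[/big ? _] t.
  exact: K_fix.
- move=> _ /mapP[x + ->]; rewrite mD SKE => /andP[/big ? _].
  exact: K_nt.
have same x y : x \notin X -> y \notin X -> x != y -> col x = col y -> e x y.
  move=> Xx Xy neq cxy; apply: contraT => nexy.
  by have := col_proper Xx Xy; rewrite /graph_compl neq nexy cxy eqxx => /(_ isT).
have D12 x : (x \in D1) || (x \in D2) -> (x \notin X) && (col x != k0).
  by rewrite !mD => /orP[] /andP[-> /eqP->].
have adj_pr x y : x != y -> adj G (pr x) (pr y) = e x y.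
  wlog le_xy : x y / lv x <= lv y => [IH neq | neq].
    by case/orP: (leq_total (lv x) (lv y)) => le_xy; [|rewrite adjC e_sym]; apply: IH; rewrite // eq_sym.
  have neqp : pr x != pr y by rewrite (inj_eq pr_inj).
  have ebarE : e x y = ~~ ebar x y by rewrite /graph_compl neq negbK.
  move: le_xy; case: (lvP x) => -[-> Hx prx]; case: (lvP y) => -[-> Hy pry] // _.
  - by rewrite adjKK ?prx ?pry ?eX ?pXK ?pX_prime // -prx -pry.
  - have /D12/andP[X'y y0] : (y \in D1) || (y \in D2) by rewrite Hy.
    by rewrite adjKJ ?mem_cat ?mem_pr ?Hy ?eX_col // prx pXK.
  - have /D12/andP[X'y y0] : (y \in D1) || (y \in D2) by rewrite Hy orbT.
    by rewrite adjKJ ?mem_cat ?mem_pr ?Hy ?orbT ?eX_col // prx pXK.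
  - have /andP[X'y /eqP y0] : (y \notin X) && (col y == k0) by rewrite -mD.
    by rewrite adjKr ?mem_pr // ?SKE ?prx ?pXK ?eX_sink ?pX_prime.
  - move: (Hx) (Hy); rewrite !mD => /andP[Xx /eqP cx] /andP[Xy /eqP cy].
    by rewrite adj11 ?mem_pr // same // cx.
  - by rewrite adj12 ?mem_pr // EE -ebarE.
  - by rewrite adj13 ?mem_pr // EE -ebarE.
  - move: (Hx) (Hy); rewrite !mD => /andP[Xx /eqP cx] /andP[Xy /eqP cy].
    by rewrite adj22 ?mem_pr // same // cx.
  - by rewrite adj23 ?mem_pr // EE -ebarE.
  move: (Hx) (Hy); rewrite !mD => /andP[Xx /eqP cx] /andP[Xy /eqP cy].
  by rewrite adj33 ?mem_pr // same // cx.
have mem_primesG x : pr x \in primes #|G|.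
  rewrite mem_primes pr_prime cardG_gt0 primesG //= !mem_cat !mem_pr.
  case: (lvP x) => -[_ Hx prx]; rewrite ?Hx ?orbT //.
  by rewrite prx pXK.
have onto t : t \in primes #|G| -> exists x, pr x = t.
  rewrite mem_primes => /and3P[pr_t _]; rewrite primesG // -!map_cat => /orP[|/mapP[x _ ->]]; last by exists x.
  rewrite pX_onto // => /exists_inP[x Xx /eqP <-]; exists x.
  by rewrite /pr Xx.
pose f x : seq_sub (primes #|G|) := SeqSub (mem_primesG x).
have f_inj : injective f by move=> x y /(congr1 val) /pr_inj.
exists gT, G; split; first exact/pseudo_goodP.
exists f.
  apply: (inj_card_bij f_inj); rewrite -(card_codom f_inj); apply: subset_leq_card.
  apply/subsetP=> t _; have [x xt] := onto _ (valP t).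
  by apply/codomP; exists x; apply: val_inj.
move=> x y; rewrite /prime_graph (inj_eq f_inj) /=.
by have [-> | neq] := eqVneq x y; rewrite ?e_irr // -adj_pr.
Qed.

End ColouredGraph.

(** * Transfer of the conditions along a graph isomorphism *)

Section Isomorphism.

Variables (T : finType) (e : rel T) (gT : finGroupType) (G : {group gT}).
Variable f : T -> seq_sub (primes #|G|).
Hypotheses (f_bij : bijective f) (f_mono : {mono f : x y / e x y >-> prime_graph G x y}).
Local Notation pr := (fun x => ssval (f x)).

Let pr_inj : injective pr.
Proof. by move=> x y /val_inj/(bij_inj f_bij). Qed.

Let pr_onto t : t \in primes #|G| -> exists x, pr x = t.
Proof.
move=> Gt; have [g fK gK] := f_bij.
by exists (g (SeqSub Gt)); rewrite gK.
Qed.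

Lemma graph_complE x y : graph_compl e x y = nadj G (pr x) (pr y).
Proof.
rewrite /nadj !(valP (f _)) /= (inj_eq pr_inj) /graph_compl -f_mono /prime_graph.
by have [-> | neq] := eqVneq x y; rewrite //= (inj_eq (bij_inj f_bij)) neq.
Qed.

Lemma sparse_compl : sparse G -> triangle_free (graph_compl e) /\
  exists col : T -> 'I_3, three_coloring (graph_compl e) col.
Proof.
case=> no3 [col colP]; split=> [x y z | ].
  by rewrite /triangle !graph_complE; apply: no3.
by exists (fun x => col (pr x)) => x y; rewrite graph_complE; apply: colP.
Qed.

Lemma one_triangle_compl : one_triangle G -> exists a b c : T,
  [/\ unique_triangle (graph_compl e) a b c,
      forall x : T, x \notin [set a; b; c] -> ~~ graph_compl e a x /\ ~~ graph_compl e b x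
    & exists col : T -> 'I_3, three_coloring (graph_compl e) col /\
        forall x y : T, graph_compl e c x -> x \notin [set a; b] ->
          graph_compl e c y -> y \notin [set a; b] -> col x = col y].
Proof.
case=> n237 uniq3 out23 [col colP col7].
have /and3P[/and4P[G2 G3 _ _] /and4P[_ G7 _ _] _] := n237.
have [a pra] := pr_onto G2; have [b prb] := pr_onto G3; have [c prc] := pr_onto G7.
have in237 x : (pr x \in [:: 2; 3; 7]) = (x \in [set a; b; c]).
  have -> : [:: 2; 3; 7] = map pr [:: a; b; c] by rewrite /= pra prb prc.
  by rewrite (mem_map pr_inj) !inE orbA.
have tri : triangle (graph_compl e) a b c by rewrite /triangle !graph_complE pra prb prc.
exists a, b, c; split=> [|x|].
- split=> // x y z xyz; apply/eqP; rewrite eqEcard; apply/andP; split.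
    have [] := uniq3 (pr x) (pr y) (pr z); first by rewrite /nadj3 -!graph_complE.
    by rewrite !in237 !subUset !sub1set => -> -> ->.
  apply: leq_trans (_ : 3 <= _).
    by apply: leq_trans (leq_card_setU _ _) _; rewrite cards2 cards1; case: (a != b).
  have /and3P[/andP[xy _] /andP[yz _] /andP[xz _]] := xyz.
  rewrite setUC cardsU1 cards2 xy !inE negb_or ![z == _]eq_sym xz yz //.
- by rewrite -in237 !graph_complE pra prb => /out23.
exists (fun x => col (pr x)); split=> [x y | x y].
  by rewrite graph_complE; apply: colP.
have colc z : graph_compl e c z -> z \notin [set a; b] -> col (pr z) = ord0.
  move=> cz abz; apply: col7; last by rewrite -prc -graph_complE.
  by rewrite in237 in_setU in_set1 (negPf abz) eq_sym; case/andP: cz.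
by move=> cx abx cy aby; rewrite !colc.
Qed.

End Isomorphism.

(** * The two cases of the converse *)

Section Converse.

Variables (T : finType) (e : rel T).
Hypotheses (e_sym : symmetric e) (e_irr : irreflexive e).
Local Notation ebar := (graph_compl e).

Let ebarC : symmetric ebar.
Proof. by move=> x y; rewrite /graph_compl eq_sym e_sym. Qed.

Lemma const_module (kT : finGroupType) r t : prime r -> prime t -> t %| #|[set: kT]| ->
  exists (g : kT) (w : kT -> 'F_r), [/\ #[g] = t, exists z, w z != 0%R, forall y, w (y * g) = w y &
    forall v, pred0 #[v] -> forall y, (\sum_(i < #[v]) w (y * v ^+ i)%g)%R = 0%R].
Proof.
move=> pr_r pr_t /(Cauchy pr_t)[g _ og]; by exists g, (fun=> 1%R); split.
Qed.

Lemma realize_triangle_free : triangle_free ebar ->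
  (exists col : T -> 'I_3, three_coloring ebar col) ->
  exists (gT : finGroupType) (G : {group gT}), pseudo_PSL27_solvable G /\ graph_iso e (prime_graph G).
Proof.
move=> no3 [col colP].
(* The trivial group as a full type, so that the factor [K] of the general construction
   disappears. *)
pose kT : finGroupType := subg_of (1%G : {group 'S_0}).
have oK : #|[set: kT]| = 1%N by rewrite cardsT card_sub /= cards1.
have K'p t : prime t -> (t %| #|[set: kT]|) = false.
  by move=> pr_t; rewrite oK dvdn1 gtn_eqF ?prime_gt1.
apply: (@coloured_graph_realizable T e kT set0 (fun=> 0) col ord0 (fun=> pred0)) => //.
all: try by [move=> x; rewrite inE | move=> x y; rewrite inE].
- by apply: good_solvable; rewrite /= (card1_trivg oK) solvable1.
- move=> t pr_t; rewrite K'p //; apply/esym/exists_inP=> -[x]; by rewrite inE.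
- by move=> x y _ _; apply: colP.
- by move=> y r pr_r _ t pr_t; rewrite K'p.
by move=> y r pr_r _; exists (fun=> 1%R); split=> //; exists 1; rewrite oner_neq0.
Qed.

Lemma realize_triangle (a b c : T) (col : T -> 'I_3) :
  unique_triangle ebar a b c ->
  (forall x, x \notin [set a; b; c] -> ~~ ebar a x /\ ~~ ebar b x) ->
  three_coloring ebar col ->
  (forall x y, ebar c x -> x \notin [set a; b] -> ebar c y -> y \notin [set a; b] -> col x = col y) ->
  exists (gT : finGroupType) (G : {group gT}), pseudo_PSL27_solvable G /\ graph_iso e (prime_graph G).
Proof.
move=> [tri uniq3] outab colP colc.
pose X := [set a; b; c]; pose kT : finGroupType := subg_of PSL27.
have isoK : PSL27 \isog [set: kT]%G := isog_subg _.
have factsK : PSL27_facts [set: kT]%G by apply: PSL27_facts_isog isoK PSL27_factsP.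
have oK := card_K factsK.
have /and3P[ab bc ac] := tri.
have [/andP[neq_ab _] /andP[neq_bc _] /andP[neq_ac _]] := And3 ab bc ac.
(* The vertex [c] must receive 7, the prime whose elements fix no nonzero vector in the module built
   from [PSL_module]; [a] and [b] are interchangeable. *)
pose pX x := if x == a then 2 else if x == b then 3 else 7.
have pa : pX a = 2 by rewrite /pX eqxx.
have pb : pX b = 3 by rewrite /pX eq_sym (negPf neq_ab) eqxx.
have pc : pX c = 7 by rewrite /pX ![c == _]eq_sym (negPf neq_ac) (negPf neq_bc).
have XP x : x \in X -> [\/ x = a, x = b | x = c].
  by rewrite !inE -orbA => /or3P[] /eqP; [constructor 1 | constructor 2 | constructor 3].
(* If [c] has no neighbour besides [a] and [b], any colour can be the last one, and [ord0] is
   taken. *)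
have [k0 k0P] : exists k0, forall x, ebar c x -> x \notin [set a; b] -> col x = k0.
  have [x /andP[cx abx] | none] := pickP (fun x => ebar c x && (x \notin [set a; b])).
    by exists (col x) => y cy aby; apply: colc.
  by exists ord0 => x cx abx; have := none x; rewrite cx abx.
(* Only the neighbours of [c] need a module on which elements of order 7 fix nothing; with [pred0]
   every prime of [K] keeps a fixed vector. *)
pose SK y := if ebar c y then pred1 7 else pred0.
have ebarX x y : x \in X -> y \notin X -> e x y = ~~ ebar x y.
  move=> Xx X'y; rewrite /graph_compl negb_and negbK negbK orb_idl // => /eqP eq_xy.
  by rewrite eq_xy (negPf X'y) in Xx.
have outX x y : x \in X -> y \notin X -> ebar x y -> x = c.
  by move=> /XP[] -> // /outab[/negPf ay /negPf by_]; rewrite ?ay ?by_.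
have pX_prime : {in X, forall x, prime (pX x)} by move=> x /XP[] ->; rewrite ?pa ?pb ?pc.
apply: (@coloured_graph_realizable T e kT X pX col k0 SK) => //.
- by apply: good_simple; [apply: K_simple factsK | rewrite isog_sym].
- by move=> x y /XP[]-> /XP[]->; rewrite ?pa ?pb ?pc.
- move=> t pr_t; rewrite (dvdn_K factsK pr_t); apply/idP/exists_inP.
    rewrite !inE => /or3P[] /eqP ->; [exists a | exists b | exists c]; rewrite ?pa ?pb ?pc //;
    by rewrite /X !inE eqxx ?orbT.
  by case=> x /XP[] -> /eqP<-; rewrite ?pa ?pb ?pc.
- have nadjK x y : x \in X -> y \in X -> x != y -> ~~ adj [set: kT]%G (pX x) (pX y).
    move=> Xx Xy neq; apply: (K_nadj factsK); rewrite ?(dvdn_K factsK) ?pX_prime //.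
    + by case/XP: Xx => ->; rewrite ?pa ?pb ?pc.
    + by case/XP: Xy => ->; rewrite ?pa ?pb ?pc.
    by move: neq; case/XP: Xx => ->; case/XP: Xy => ->; rewrite ?pa ?pb ?pc ?eqxx.
  have nE x y : ebar x y -> e x y = false by case/andP=> _ /negPf.
  move=> x y Xx Xy neq; rewrite (negPf (nadjK x y Xx Xy neq)); apply/esym.
  by case/XP: Xx neq => ->; case/XP: Xy => -> neq; rewrite ?eqxx // in neq; apply: nE; rewrite // ebarC.
- by move=> x y _ _; apply: colP.
- move=> x y z X'x X'y X'z; apply: contra X'x => /uniq3; rewrite -/X => <-.
  by rewrite !inE eqxx.
- move=> x y Xx X'y; rewrite ebarX //; apply: contra => exy.
  have := outX x y Xx X'y exy => xc; rewrite xc in exy; apply/eqP/k0P => //.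
  by apply: contra X'y; rewrite !inE => ->.
- move=> x y Xx X'y _; rewrite ebarX //; congr (~~ _); rewrite /SK.
  case/XP: (Xx) => ->; rewrite ?pa ?pb ?pc.
  + by have [/negPf-> _] := outab y X'y; case: ifP.
  + by have [_ /negPf->] := outab y X'y; case: ifP.
  by case: ifP.
- move=> y r pr_r r_big t pr_t Kt; rewrite oK in r_big; rewrite /SK; case: ifP => _.
    exact: (PSL_fix factsK pr_r r_big pr_t Kt).
  by move=> _; apply: const_module.
move=> y r pr_r; rewrite oK /SK => r_big; case: ifP => _; first exact: PSL_nt.
by exists (fun=> 1%R); split=> //; exists 1; rewrite oner_neq0.
Qed.

End Converse.

Theorem theorem3p7 (T : finType) (e : rel T)
    (e_sym : symmetric e) (e_irr : irreflexive e) :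
  (exists (gT : finGroupType) (G : {group gT}),
      pseudo_PSL27_solvable G /\ graph_iso e (prime_graph G))
  <->
  (triangle_free (graph_compl e) /\
     (exists col : T -> 'I_3, three_coloring (graph_compl e) col))
  \/
  (exists a b c : T,
     [/\ unique_triangle (graph_compl e) a b c,
         forall x : T, x \notin [set a; b; c] ->
           ~~ graph_compl e a x /\ ~~ graph_compl e b x
       & exists col : T -> 'I_3,
           three_coloring (graph_compl e) col /\
           forall x y : T,
             graph_compl e c x -> x \notin [set a; b] ->
             graph_compl e c y -> y \notin [set a; b] ->
             col x = col y]).
Proof.
split=> [[gT [G [/pseudo_goodP goodG [f f_bij f_mono]]]] | [[no3 col] | [a [b [c [tri out [col [colP colc]]]]]]]].
- have [sp | tr] := good_prime_graph goodG; [left | right].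
    exact: (sparse_compl f_bij f_mono).
  exact: (one_triangle_compl f_bij f_mono).
- exact: realize_triangle_free.
exact: realize_triangle tri out colP colc.
Qed.
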